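(* Let $(K,v)$ be a valued field, fix any extension of $v$ to the algebraic closure $\tilde K$, and let $(K^r,v)$ be the absolute ramification field of $(K,v)$ with respect to this extension. Then $(K^r,v)$ is a gdr field if and only if $(K,v)$ is a gdr field, and $(K^r,v)$ is a semitame field if and only if $(K,v)$ is a semitame field.
   Context: The absolute ramification field $(K^r,v)$ of $(K,v)$ (w.r.t. a fixed extension of $v$ to $\tilde K$) is the ramification field of the normal extension $(K^{sep}|K,v)$, $K^{sep}$ the separable-algebraic closure. For a valued field $(F,u)$ with value group $uF$, residue field $Fu$, completion $\hat F$ with valuation ring $\mathcal{O}_{\hat F}$: (DRvr): if $\operatorname{char}Fu=p>0$, then $x\mapsto x^p$ is surjective on $\mathcal{O}_{\hat F}/p\mathcal{O}_{\hat F}$; (DRvp): if $\operatorname{char}Fu=p>0$, then $up$ is not the smallest positive element of $uF$ ($up=\infty$ if $\operatorname{char}F=p$); (DRst): if $\operatorname{char}Fu=p>0$, then $uF$ is $p$-divisible. Gdr field: (DRvr) and (DRvp). Semitame field: (DRvr) and (DRst). *)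

(* Defs.v *)
From HB Require Import structures.
From mathcomp Require Import all_boot all_order all_algebra all_field.
Set Implicit Arguments. Unset Strict Implicit. Unset Printing Implicit Defensive.
Import GRing.Theory.
Local Open Scope ring_scope.

(* A (Krull) valuation on a field F is given by its valuation ring O. *)
Definition valuation_ring (F : fieldType) (O : F -> Prop) : Prop :=
  [/\ O 0, O 1,
      (forall x y, O x -> O y -> O (x - y)),
      (forall x y, O x -> O y -> O (x * y)) &
      (forall x, x != 0 -> O x \/ O x^-1)].

(* vle O x y  <->  v x <= v y ;  vlt O x y <-> v x < v y  (v 0 = infinity) *)
Definition vle (F : fieldType) (O : F -> Prop) (x y : F) : Prop :=
  y = 0 \/ (x <> 0 /\ O (y / x)).
Definition vlt (F : fieldType) (O : F -> Prop) (x y : F) : Prop :=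
  vle O x y /\ ~ vle O y x.

Definition residue_char (F : fieldType) (O : F -> Prop) (p : nat) : Prop :=
  prime p /\ vlt O 1 (p%:R).

Definition is_filter (E : Type) (Fl : (E -> Prop) -> Prop) : Prop :=
  [/\ Fl (fun _ => True), ~ Fl (fun _ => False),
      (forall A B, Fl A -> Fl B -> Fl (fun x => A x /\ B x)) &
      (forall A B : E -> Prop, (forall x, A x -> B x) -> Fl A -> Fl B)].

Definition vcauchy (E : fieldType) (OE : E -> Prop) (Fl : (E -> Prop) -> Prop) :=
  forall c : E, c != 0 ->
    exists A, Fl A /\ forall x y, A x -> A y -> vlt OE c (x - y).

Definition vconverges (E : fieldType) (OE : E -> Prop) (Fl : (E -> Prop) -> Prop)
  (l : E) := forall c : E, c != 0 -> Fl (fun x => vlt OE c (x - l)).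

Definition vcomplete (E : fieldType) (OE : E -> Prop) : Prop :=
  forall Fl, is_filter Fl -> vcauchy OE Fl -> exists l, vconverges OE Fl l.

(* We treat a valued field given as a subfield S of a field L, with valuation
   ring (O restricted to S).  A whole field K is the case S = everything. *)

Definition is_completion (L : fieldType) (O S : L -> Prop)
  (E : fieldType) (OE : E -> Prop) (j : L -> E) : Prop :=
  valuation_ring OE /\
  j 1 = 1 /\
  (forall x y, S x -> S y -> j (x + y) = j x + j y) /\
  (forall x y, S x -> S y -> j (x * y) = j x * j y) /\
  (forall x, S x -> (OE (j x) <-> O x)) /\
  (forall e c : E, c != 0 -> exists s, S s /\ vlt OE c (e - j s)) /\
  vcomplete OE.

Definition DRvr (L : fieldType) (O S : L -> Prop) : Prop :=
  forall p, residue_char O p ->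
  forall (E : fieldType) (OE : E -> Prop) (j : L -> E), is_completion O S OE j ->
  forall a, OE a -> exists b, OE b /\ exists d, OE d /\ a - b ^+ p = p%:R * d.

(* (DRvp) : v p is not the smallest positive element of the value group
   (v p = infinity when p = 0 in the field) *)
Definition DRvp (L : fieldType) (O S : L -> Prop) : Prop :=
  forall p, residue_char O p ->
    (p%:R = 0 :> L) \/ exists x, S x /\ vlt O 1 x /\ vlt O x (p%:R).

(* (DRst) : the value group of S is p-divisible *)
Definition DRst (L : fieldType) (O S : L -> Prop) : Prop :=
  forall p, residue_char O p ->
  forall x, S x -> x != 0 ->
    exists y, [/\ S y, y != 0, O (x / y ^+ p) & O (y ^+ p / x)].

Definition gdr_in (L : fieldType) (O S : L -> Prop) : Prop := DRvr O S /\ DRvp O S.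
Definition semitame_in (L : fieldType) (O S : L -> Prop) : Prop := DRvr O S /\ DRst O S.

Definition algebraic_over (K : fieldType) (L : fieldType) (iota : {rmorphism K -> L}) :=
  forall x : L, exists p : {poly K}, p != 0 /\ root (map_poly iota p) x.

Definition separable_over (K L : fieldType) (iota : {rmorphism K -> L}) (x : L) :=
  exists p : {poly K}, [/\ p != 0, separable_poly p & root (map_poly iota p) x].

Definition K_aut (K L : fieldType) (iota : {rmorphism K -> L}) (s : {rmorphism L -> L}) :=
  bijective s /\ forall a, s (iota a) = iota a.

Definition in_ram_group (K L : fieldType) (iota : {rmorphism K -> L}) (OL : L -> Prop)
  (s : {rmorphism L -> L}) :=
  K_aut iota s /\
  forall b, separable_over iota b -> b != 0 -> vlt OL b (s b - b).

Definition ram_field (K L : fieldType) (iota : {rmorphism K -> L}) (OL : L -> Prop) :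
  L -> Prop :=
  fun x => separable_over iota x /\
    forall s : {rmorphism L -> L}, in_ram_group iota OL s -> s x = x.

(* Main.v *)
From HB Require Import structures.
From mathcomp Require Import all_boot all_order all_algebra all_field ring.
From mathcomp Require Import boolp classical_sets functions.
Require Import Defs.
Set Implicit Arguments. Unset Strict Implicit. Unset Printing Implicit Defensive.
Import GRing.Theory.
Local Open Scope ring_scope.

(** Write v for the valuation, O for its ring, M for the maximal ideal, p for the residue
    characteristic. Condition (DRvr) speaks of a completion, but density turns it into a condition
    on the field itself ([DRvr_root]): for each nonzero c, every integral element is a p-th power
    modulo p O + c M ([root_cond]). Given this, (DRvp) amounts to p-divisibility of the convex
    subgroup generated by v p ([pdiv]): if 0 <= v x < v p, a p-th root of x modulo p O + x M shows
    that v x is divisible by p, and v p is a sum of two such values once it is not the smallest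
    positive one ([root_vp_pdiv], [pdiv_vp]).

    So roots and divisibility of values have to be carried between K and K^r. Divisibility passes
    because the value group of K^r is torsion of order prime to p modulo that of K ([coprime_pdiv]).
    For roots, K^r is reached from K by simple extensions. A field S between K and K^r is [good] if
    it has this torsion property, if roots in S of elements of K modulo p O + c M descend to K, and
    if the hypotheses on K give roots to all integral elements of S. Two kinds of steps preserve
    goodness.

    In the first ([good_henselian]) one adjoins b with v b > 0 whose other conjugates are units. The
    value group is unchanged, and the integral elements of S(b) are fractions of A[X]/f at b, where
    A is the integral part of S and f'(b) is a unit ([henselian_frac]). This is an etale situation,
    where the relative Frobenius in characteristic p is injective and surjective ([etale_inj],
    [etale_surj]); applied over A modulo p O + c M, this moves p-th roots down and up.

    In the second ([good_orth]) the powers of b, and also those of b^p, form a basis for which the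
    value of a combination is the least value of its terms. Comparing constant terms gives descent,
    and expanding along the powers of b^p gives ascent. Radicals of degree prime to p and lifts of
    separable residues are of this kind.

    Zorn's lemma gives a maximal good field T. By maximality it contains the elements b of the first
    kind, so automorphisms over T preserve v ([T_isometry]); it contains the radicals and the lifts,
    so up to p-power exponents every value and residue of L comes from T ([T_value], [T_residue]).
    Hence for an automorphism s over T a p-power of s b / b has residue 1, so s b / b has residue 1
    and s is in the ramification group ([T_fixing_ram]). Galois theory then puts K^r inside T, so
    K^r is good ([good_ramS]), and the transfer follows ([gdr_ram], [semitame_ram]). *)

Record vring (F : fieldType) :=
  VRing {vring_pred :> F -> Prop; vringP : valuation_ring vring_pred}.

(** * The preorder of values *)

Definition lev (F : fieldType) (O : vring F) (x y : F) : bool := `[< vle O x y >].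
Definition ltv (F : fieldType) (O : vring F) (x y : F) : bool := ~~ lev O y x.
Definition eqv (F : fieldType) (O : vring F) (x y : F) : bool := lev O x y && lev O y x.

Reserved Notation "x <=v y" (at level 70, y at next level).
Reserved Notation "x <v y" (at level 70, y at next level).
Reserved Notation "x =v y" (at level 70, y at next level).

Section ValuationOrder.
Variables (F : fieldType) (O : vring F).
Local Notation "x <=v y" := (lev O x y).
Local Notation "x <v y" := (ltv O x y).
Local Notation "x =v y" := (eqv O x y).
Implicit Types x y z c : F.

Lemma vO0 : O 0. Proof. by case: (vringP O). Qed.
Lemma vO1 : O 1. Proof. by case: (vringP O). Qed.
Lemma vOB x y : O x -> O y -> O (x - y). Proof. by case: (vringP O) => _ _ + _ _; apply. Qed.
Lemma vON x : O x -> O (- x). Proof. by rewrite -sub0r; apply/vOB/vO0. Qed.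
Lemma vOD x y : O x -> O y -> O (x + y).
Proof. by move=> hx hy; rewrite -[y]opprK; apply/vOB/vON. Qed.
Lemma vOM x y : O x -> O y -> O (x * y). Proof. by case: (vringP O) => _ _ _ + _; apply. Qed.
Lemma vOV x : x != 0 -> O x \/ O x^-1. Proof. by case: (vringP O) => _ _ _ _; apply. Qed.

(** Divisibility in O treats zero arguments uniformly, zero being the largest element, so order
    lemmas become ring identities. *)
Lemma levP x y : reflect (exists2 t, O t & y = x * t) (x <=v y).
Proof.
apply: (iffP (asboolP _)) => [[->|[/eqP x0 Ot]]|[t Ot ->]].
- by exists 0; [exact: vO0 | rewrite mulr0].
- by exists (y / x) => //; rewrite mulrC divfK.
have [->|x0] := eqVneq x 0; first by left; rewrite mul0r.
by right; split; [exact/eqP | rewrite mulrC mulKf].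
Qed.

Lemma vltP x y : vlt O x y <-> x <v y.
Proof.
rewrite /vlt /ltv; split=> [[_ h]|/asboolPn h]; first exact/asboolPn.
split=> //; apply: contrapT => h'; apply: h.
have [->|x0] := eqVneq x 0; first by left.
have y0 : y != 0 by apply/eqP => y0; apply: h'; left.
right; split; first exact/eqP.
have [//|] := vOV (mulf_neq0 x0 (invr_neq0 y0)).
by rewrite invf_div => h1; case: h'; right; split=> //; apply/eqP.
Qed.

Lemma lev1 x : (1 <=v x) <-> O x.
Proof.
split; first by case/levP => t Ot ->; rewrite mul1r.
by move=> h; apply/levP; exists x; rewrite ?mul1r.
Qed.

Lemma lev_refl x : x <=v x.
Proof. by apply/levP; exists 1; [exact: vO1 | rewrite mulr1]. Qed.
Hint Resolve lev_refl : core.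

Lemma lev_trans y x z : x <=v y -> y <=v z -> x <=v z.
Proof.
by move=> /levP[t Ot ->] /levP[u Ou ->]; apply/levP; exists (t * u);
  [exact: vOM | rewrite mulrA].
Qed.

Lemma ltvW x y : x <v y -> x <=v y.
Proof. by move/vltP=> [h _]; apply/asboolP. Qed.

Lemma ltvNge x y : (x <v y) = ~~ (y <=v x). Proof. by []. Qed.
Lemma levNgt x y : (x <=v y) = ~~ (y <v x). Proof. by rewrite /ltv negbK. Qed.

Lemma lev_total x y : (x <=v y) || (y <=v x).
Proof. by case: (boolP (x <=v y)) => //= /ltvW. Qed.

Lemma lev_lt_trans y x z : x <=v y -> y <v z -> x <v z.
Proof. by move=> h; apply: contra => h'; apply: lev_trans h' h. Qed.
Lemma ltv_le_trans y x z : x <v y -> y <=v z -> x <v z.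
Proof. by move=> h1 h2; apply: contra h1 => h'; apply: lev_trans h2 h'. Qed.
Lemma ltv_trans y x z : x <v y -> y <v z -> x <v z.
Proof. by move=> h /ltvW; apply: ltv_le_trans. Qed.
Lemma ltvv x : (x <v x) = false. Proof. by rewrite /ltv lev_refl. Qed.

Lemma levr0 x : x <=v 0.
Proof. by apply/levP; exists 0; [exact: vO0 | rewrite mulr0]. Qed.
Hint Resolve levr0 : core.
Lemma lev0r x : (0 <=v x) = (x == 0).
Proof. by apply/levP/eqP => [[t _ ->]|->]; [rewrite mul0r | exists 0; [exact: vO0 | rewrite mulr0]]. Qed.
Lemma ltvr0 x : (x <v 0) = (x != 0). Proof. by rewrite /ltv lev0r. Qed.
Lemma ltv_neq0 x y : x <v y -> x != 0.
Proof. by apply: contraTneq => ->; rewrite /ltv levr0. Qed.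

Lemma levN x y : (x <=v - y) = (x <=v y).
Proof.
have h z : x <=v z -> x <=v - z.
  by case/levP => t Ot ->; apply/levP; exists (- t); [exact: vON | rewrite mulrN].
by apply/idP/idP => [/h|/h //]; rewrite opprK.
Qed.
Lemma levNl x y : (- x <=v y) = (x <=v y).
Proof.
have h z : z <=v y -> - z <=v y.
  by case/levP => t Ot ->; apply/levP; exists (- t); [exact: vON | rewrite mulrNN].
by apply/idP/idP => [/h|/h //]; rewrite opprK.
Qed.
Lemma ltvN x y : (x <v - y) = (x <v y). Proof. by rewrite /ltv levNl. Qed.
Lemma ltvNl x y : (- x <v y) = (x <v y). Proof. by rewrite /ltv levN. Qed.

Lemma levD c x y : c <=v x -> c <=v y -> c <=v x + y.
Proof.
move=> /levP[t Ot ->] /levP[u Ou ->]; apply/levP; exists (t + u); first exact: vOD.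
by rewrite mulrDr.
Qed.
Lemma levB c x y : c <=v x -> c <=v y -> c <=v x - y.
Proof. by move=> h1 h2; apply: levD; rewrite ?levN. Qed.

Lemma ltvD c x y : c <v x -> c <v y -> c <v x + y.
Proof.
move=> hx hy; have [h|h] := orP (lev_total x y).
  by apply: ltv_le_trans hx _; apply: levD.
by apply: ltv_le_trans hy _; apply: levD.
Qed.
Lemma ltvB c x y : c <v x -> c <v y -> c <v x - y.
Proof. by move=> h1 h2; apply: ltvD; rewrite ?ltvN. Qed.

Lemma lev_sum (I : Type) (r : seq I) (P : pred I) (G : I -> F) c :
  (forall i, P i -> c <=v G i) -> c <=v \sum_(i <- r | P i) G i.
Proof. by move=> h; elim/big_ind: _ => // x y; exact: levD. Qed.
Lemma ltv_sum (I : Type) (r : seq I) (P : pred I) (G : I -> F) c :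
  c != 0 -> (forall i, P i -> c <v G i) -> c <v \sum_(i <- r | P i) G i.
Proof. by move=> c0 h; elim/big_ind: _ => // [|x y]; [rewrite ltvr0 | exact: ltvD]. Qed.

Lemma levM a b c d : a <=v b -> c <=v d -> a * c <=v b * d.
Proof.
move=> /levP[t Ot ->] /levP[u Ou ->]; apply/levP; exists (t * u); first exact: vOM.
by rewrite mulrACA.
Qed.
Lemma levM2l z x y : z != 0 -> (z * x <=v z * y) = (x <=v y).
Proof.
move=> z0; apply/idP/idP => h; last exact: levM.
by have := levM (lev_refl z^-1) h; rewrite !mulKf.
Qed.
Lemma levM2r z x y : z != 0 -> (x * z <=v y * z) = (x <=v y).
Proof. by move=> z0; rewrite ![_ * z]mulrC levM2l. Qed.
Lemma ltvM2l z x y : z != 0 -> (z * x <v z * y) = (x <v y).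
Proof. by move=> z0; rewrite /ltv levM2l. Qed.
Lemma ltvM2r z x y : z != 0 -> (x * z <v y * z) = (x <v y).
Proof. by move=> z0; rewrite /ltv levM2r. Qed.
Lemma ltv_leM a b c d : c != 0 -> a <v b -> c <=v d -> a * c <v b * d.
Proof.
by move=> c0 h1 h2; apply: ltv_le_trans (levM (lev_refl b) h2); rewrite ltvM2r.
Qed.
Lemma lev_ltM a b c d : a != 0 -> a <=v b -> c <v d -> a * c <v b * d.
Proof. by move=> a0 h1 h2; rewrite [a * _]mulrC [b * _]mulrC; apply: ltv_leM. Qed.

Lemma levX n x y : x <=v y -> x ^+ n <=v y ^+ n.
Proof. by move=> h; elim: n => // n IH; rewrite !exprS levM. Qed.
Lemma ltvX n x y : (0 < n)%N -> x <v y -> x ^+ n <v y ^+ n.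
Proof.
case: n => // n _ h; rewrite !exprS; apply: ltv_leM => //; last exact/levX/ltvW.
by rewrite expf_neq0 // (ltv_neq0 h).
Qed.
Lemma levX_iff n x y : (0 < n)%N -> (x ^+ n <=v y ^+ n) = (x <=v y).
Proof.
move=> n0; apply/idP/idP; last exact: levX.
by apply: contraTT; apply: ltvX.
Qed.
Lemma ltvX_iff n x y : (0 < n)%N -> (x ^+ n <v y ^+ n) = (x <v y).
Proof. by move=> n0; rewrite /ltv levX_iff. Qed.
Lemma levV x y : x != 0 -> y != 0 -> (x^-1 <=v y^-1) = (y <=v x).
Proof.
move=> x0 y0; rewrite -(levM2l _ _ (mulf_neq0 x0 y0)) mulrAC mulfV // mul1r.
by rewrite mulfK.
Qed.

Lemma lev1X n x : 1 <=v x -> 1 <=v x ^+ n.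
Proof. by move=> h; rewrite -(expr1n _ n) levX. Qed.
Lemma lev1M x y : 1 <=v x -> 1 <=v y -> 1 <=v x * y.
Proof. by rewrite -{3}[1]mul1r; apply: levM. Qed.
Lemma levMr c x y : 1 <=v y -> c <=v x -> c <=v x * y.
Proof. by rewrite -{2}[c]mulr1 => h1 h2; apply: levM. Qed.
Lemma levMl c x y : 1 <=v x -> c <=v y -> c <=v x * y.
Proof. by rewrite mulrC; apply: levMr. Qed.
Lemma ltvMr c x y : 1 <=v y -> c <v x -> c <v x * y.
Proof. by move=> h1 h2; apply: ltv_le_trans h2 _; apply: levMr. Qed.
Lemma ltvMl c x y : 1 <=v x -> c <v y -> c <v x * y.
Proof. by rewrite mulrC; apply: ltvMr. Qed.
Lemma lev1_nat n : 1 <=v n%:R.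
Proof. by elim: n => // n IH; rewrite mulrS levD. Qed.
Lemma lev1_prod (I : Type) (r : seq I) (P : pred I) (G : I -> F) :
  (forall i, P i -> 1 <=v G i) -> 1 <=v \prod_(i <- r | P i) G i.
Proof. by move=> h; elim/big_ind: _ => // x y; exact: lev1M. Qed.

Lemma eqv_refl x : x =v x. Proof. by rewrite /eqv lev_refl. Qed.
Hint Resolve eqv_refl : core.
Lemma eqv_sym x y : (x =v y) = (y =v x). Proof. by rewrite /eqv andbC. Qed.
Lemma eqv_trans y x z : x =v y -> y =v z -> x =v z.
Proof.
by move=> /andP[h1 h2] /andP[h3 h4]; rewrite /eqv (lev_trans h1 h3) (lev_trans h4 h2).
Qed.
Lemma eqv_le x y : x =v y -> x <=v y. Proof. by case/andP. Qed.
Lemma eqv_ge x y : x =v y -> y <=v x. Proof. by case/andP. Qed.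
Lemma eqv_ltl x y z : x =v y -> (x <v z) = (y <v z).
Proof. by case/andP => h1 h2; apply/idP/idP; apply: lev_lt_trans. Qed.
Lemma eqv_ltr x y z : x =v y -> (z <v x) = (z <v y).
Proof. by case/andP => h1 h2; apply/idP/idP => h; apply: (ltv_le_trans h). Qed.
Lemma eqv_lel x y z : x =v y -> (x <=v z) = (y <=v z).
Proof. by case/andP => h1 h2; apply/idP/idP; apply: lev_trans. Qed.
Lemma eqv_ler x y z : x =v y -> (z <=v x) = (z <=v y).
Proof. by case/andP => h1 h2; apply/idP/idP => h; apply: (lev_trans h). Qed.
Lemma eqv0 x y : x =v y -> (x == 0) = (y == 0).
Proof. by case/andP => h1 h2; apply/eqP/eqP => e; apply/eqP; move: h1 h2; rewrite e ?lev0r. Qed.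
Lemma eqvM a b c d : a =v b -> c =v d -> a * c =v b * d.
Proof. by case/andP => ? ? /andP[? ?]; rewrite /eqv !levM. Qed.
Lemma eqvX n x y : x =v y -> x ^+ n =v y ^+ n.
Proof. by case/andP => ? ?; rewrite /eqv !levX. Qed.
Lemma eqvX_iff n x y : (0 < n)%N -> (x ^+ n =v y ^+ n) = (x =v y).
Proof. by move=> n0; rewrite /eqv !levX_iff. Qed.
Lemma eqvM2l z x y : z != 0 -> (z * x =v z * y) = (x =v y).
Proof. by move=> z0; rewrite /eqv !levM2l. Qed.
Lemma eqvM2r z x y : z != 0 -> (x * z =v y * z) = (x =v y).
Proof. by move=> z0; rewrite /eqv !levM2r. Qed.
Lemma eqvV x y : x =v y -> x^-1 =v y^-1.
Proof.
move=> h; have [x0|x0] := eqVneq x 0.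
  by move: (eqv0 h); rewrite x0 eqxx => /esym/eqP ->.
have y0 : y != 0 by rewrite -(eqv0 h).
by case/andP: h => ? ?; rewrite /eqv !levV // andbC; apply/andP.
Qed.
Lemma eqvN x y : (x =v - y) = (x =v y). Proof. by rewrite /eqv levN levNl. Qed.
Lemma eqvNl x y : (- x =v y) = (x =v y). Proof. by rewrite eqv_sym eqvN eqv_sym. Qed.
Lemma ltv_eqv x y : x <v y -> ~~ (x =v y).
Proof. by rewrite /ltv /eqv => /negbTE ->; rewrite andbF. Qed.

Lemma eqv_addr x y : x <v y -> x =v x + y.
Proof.
move=> h; apply/andP; split; first by apply: levD (ltvW h).
rewrite levNgt; apply/negP => h1.
suff : x <v x by rewrite ltvv.
by rewrite -{2}[x](addrK y); apply: ltvB.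
Qed.
Lemma eqv_sub x y : x <v x - y -> x =v y.
Proof.
move=> h; have := @eqv_addr x (- (x - y)); rewrite ltvN => /(_ h).
by rewrite opprB addrC subrK.
Qed.

Lemma eqv1M x y : 1 =v x -> 1 =v y -> 1 =v x * y.
Proof. by move=> h1 h2; rewrite -[1]mul1r eqvM. Qed.
Lemma eqv1X n x : 1 =v x -> 1 =v x ^+ n.
Proof. by move=> h; rewrite -(expr1n _ n) eqvX. Qed.
Lemma eqv1_neq0 x : 1 =v x -> x != 0.
Proof. by move/eqv0 <-; rewrite oner_eq0. Qed.
Lemma eqv1V x : 1 =v x -> 1 =v x^-1.
Proof. by move=> h; rewrite -[1]invr1 eqvV. Qed.
Lemma eqv_divl x y : y != 0 -> x =v y -> 1 =v x / y.
Proof. by move=> y0 h; rewrite -(eqvM2r _ _ y0) mul1r divfK // eqv_sym. Qed.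
Lemma eqv1_prod (I : eqType) (r : seq I) (G : I -> F) :
  (forall i, i \in r -> 1 =v G i) -> 1 =v \prod_(i <- r) G i.
Proof. by move=> h; rewrite big_seq; elim/big_ind: _ => // x y; exact: eqv1M. Qed.

(** In a Bezout relation u n - w p = 1 the left side would have positive value if n had. *)
Lemma coprime_eqv1 (p n : nat) : prime p -> 1 <v p%:R -> coprime n p -> 1 =v n%:R.
Proof.
move=> pp hp; case: n => [|n] cp.
  by move: cp pp; rewrite /coprime gcd0n => /eqP ->.
have [u v e _] := egcdnP p (ltn0Sn n).
rewrite /eqv lev1_nat /= levNgt; apply/negP => h.
have : 1 <v u%:R * n.+1%:R - v%:R * p%:R.
  by apply: ltvB; (apply: ltvMl; first exact: lev1_nat).
by rewrite -!natrM e (eqP cp) natrD addrAC subrr add0r ltvv.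
Qed.

(** The inner binomial coefficients are multiples of p. *)
Lemma lev_powsum (p : nat) x y : prime p -> 1 <=v x -> 1 <=v y ->
  p%:R <=v (x + y) ^+ p - (x ^+ p + y ^+ p).
Proof.
move=> pp hx hy; case: p pp => // p pp.
rewrite exprDn big_ord_recl; case: p pp => [//|p] pp.
rewrite big_ord_recr /= subn0 expr0 mulr1 bin0 mulr1n.
rewrite /bump /= add1n subnn expr0 mul1r binn mulr1n addrA opprD addrACA subrr.
rewrite addr0 addrAC subrr add0r; apply: lev_sum => i _; rewrite /bump /= add1n.
have /dvdnP[k ->] : (p.+2 %| 'C(p.+2, i.+1))%N by rewrite prime_dvd_bin //= ltnS ltn_ord.
rewrite -[_ *+ (_ * _)]mulr_natr natrM mulrA; apply: levMl => //.
by apply: lev1M; [apply: lev1M; exact: lev1X | exact: lev1_nat].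
Qed.

End ValuationOrder.

(** [Zorn_bigcup] also requires the union of the empty chain, so P is enlarged by the empty set. If
    the empty set comes out as maximal, every Y with P Y is empty and X0 serves. *)
Lemma Zorn_union (T : Type) (P : set T -> Prop) (X0 : set T) : P X0 ->
  (forall C : set (set T), (exists X, C X) -> (forall X, C X -> P X) ->
     (forall X Y, C X -> C Y -> (X `<=` Y)%classic \/ (Y `<=` X)%classic) ->
     P (fun t => exists2 X, C X & X t)) ->
  exists2 X, P X & forall Y, (X `<=` Y)%classic -> P Y -> (Y `<=` X)%classic.
Proof.
move=> P0 Pch; pose P' X := P X \/ X = set0.
have [|A [PA maxA]] := @Zorn_bigcup T P'.
  move=> C CP Ctot; have [[X CX]|h] := lem (exists X, C X /\ P X).
    left; pose C' Y := C Y /\ P Y.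
    have -> : (\bigcup_(Y in C) Y)%classic = (fun t => exists2 Y, C' Y & Y t).
      apply/funext => t; apply/propext; split=> [[Y CY Yt]|[Y [CY _] Yt]]; last by exists Y.
      by exists Y => //; split=> //; case: (CP _ CY) => // Y0; rewrite Y0 in Yt.
    apply: Pch; [by exists X | by move=> Y [] | move=> Y Z [CY _] [CZ _]; exact: Ctot].
  right; apply/seteqP; split=> // t [Y CY Yt].
  case: (CP _ CY) => [PY|Y0]; last by rewrite Y0 in Yt.
  by case: h; exists Y.
have maxA' Y : (A `<=` Y)%classic -> P Y -> (Y `<=` A)%classic.
  move=> AY PY; apply: contrapT => h; apply: (maxA Y); last by left.
  by split.
case: PA => [PA|A0]; first by exists A.
exists X0 => // Y _ PY; have := maxA' Y; rewrite A0 => /(_ (@sub0set _ Y) PY) Y0 t Yt.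
by case: (Y0 t Yt).
Qed.

(** * Subfields, subrings and minimal polynomials *)

Record sfield (L : fieldType) :=
  SField {sf_pred :> {pred L}; sf_closed : divring_closed sf_pred}.
HB.instance Definition _ (L : fieldType) (S : sfield L) :=
  GRing.isDivringClosed.Build L (sf_pred S) (sf_closed S).

(** Subfields are predicates on one ambient field, so towers and unions need no embeddings; this
    subtype is used only where the subfield must itself be a field type. *)
Definition subF (L : fieldType) (S : sfield L) := {x : L | x \in sf_pred S}.
HB.instance Definition _ (L : fieldType) (S : sfield L) := SubChoice.on (subF S).
HB.instance Definition _ (L : fieldType) (S : sfield L) :=
  [SubChoice_isSubIntegralDomain of subF S by <:].
HB.instance Definition _ (L : fieldType) (S : sfield L) :=
  [SubIntegralDomain_isSubField of subF S by <:].

Record sring (L : fieldType) :=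
  SRing {sr_pred :> {pred L}; sr_closed : subring_closed sr_pred}.
HB.instance Definition _ (L : fieldType) (S : sring L) :=
  GRing.isSubringClosed.Build L (sr_pred S) (sr_closed S).

Definition subR (L : fieldType) (S : sring L) := {x : L | x \in sr_pred S}.
HB.instance Definition _ (L : fieldType) (S : sring L) := SubChoice.on (subR S).
HB.instance Definition _ (L : fieldType) (S : sring L) :=
  [SubChoice_isSubComNzRing of subR S by <:].


Lemma ex_minpoly (F L : fieldType) (a : {rmorphism F -> L}) (x : L) :
  (exists2 P : {poly F}, P != 0 & root (map_poly a P) x) ->
  exists h : {poly F}, [/\ h \is monic, root (map_poly a h) x &
    forall P, root (map_poly a P) x -> h %| P].
Proof.
move=> [P0 P00 rP0].
pose Q n := `[< exists P : {poly F}, [/\ P != 0, root (map_poly a P) x & size P = n] >].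
have exQ : exists n, Q n by exists (size P0); apply/asboolP; exists P0.
case: (ex_minnP exQ) => n /asboolP[h [h0 rh sh]] hmin.
exists ((lead_coef h)^-1 *: h); split.
- by rewrite monicE lead_coefZ mulVf // lead_coef_eq0.
- by rewrite map_polyZ rootZ // fmorph_eq0 invr_eq0 lead_coef_eq0.
move=> P rP; rewrite dvdpZl ?invr_eq0 ?lead_coef_eq0 // /dvdp; apply/eqP.
apply: contrapT => /eqP r0.
have : Q (size (P %% h)).
  apply/asboolP; exists (P %% h); split=> //.
  move: rP; rewrite {1}(divp_eq P h) rmorphD rmorphM /= !rootE hornerD hornerM.
  by rewrite (rootP rh) mulr0 add0r.
by move/hmin; rewrite leqNgt -sh ltn_modp h0.
Qed.

(** * Extension of isomorphisms between subfields to automorphisms *)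

Definition is_graph (L : fieldType) (G : L * L -> Prop) :=
  [/\ G (1, 1), (forall z w, G z -> G w -> G (z - w)),
      (forall z w, G z -> G w -> G (z * w)),
      (forall z, G z -> G (z.1^-1, z.2^-1)) &
      (forall z, G z -> (z.1 == 0) = (z.2 == 0))].

(** Graph of an isomorphism between two subfields of L: the last clause of [is_graph], applied to
    differences, makes it single-valued and injective. It is itself a field, embedded in L by both
    projections. *)
Record fgraph (L : fieldType) :=
  FGraph {fg_pred :> L * L -> Prop; fg_closed : is_graph fg_pred}.

Definition fg_mem (L : fieldType) (G : fgraph L) : {pred (L * L)%type} :=
  fun z => `[< G z >].

Lemma fg_unit (L : fieldType) (G : fgraph L) z : G z -> z != 0 -> z \is a GRing.unit.
Proof.
case: (fg_closed G) => _ _ _ _ h /h; case: z => z1 z2 /= e.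
rewrite -pair_eqE /= -[_ \is a _]/((z1 \is a GRing.unit) && (z2 \is a GRing.unit)).
by rewrite !unitfE e; case: (z2 == 0).
Qed.

Lemma fg_divring (L : fieldType) (G : fgraph L) : divring_closed (fg_mem G).
Proof.
case: (fg_closed G) => G1 GB GM GV Gr; split=> [|z w|z w]; first exact/asboolP.
  by move=> /asboolP ? /asboolP ?; apply/asboolP/GB.
move=> /asboolP Gz /asboolP Gw; apply/asboolP/GM => //.
have [->|w0] := eqVneq w 0; first by rewrite invr0; have := GB _ _ G1 G1; rewrite subrr.
suff -> : w^-1 = (w.1^-1, w.2^-1) by exact: GV.
have := fg_unit Gw w0; case: w {Gw w0} => w1 w2.
rewrite -[_ \is a _]/((w1 \is a GRing.unit) && (w2 \is a GRing.unit)) => u.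
by rewrite -[LHS]/(if (w1 \is a GRing.unit) && (w2 \is a GRing.unit) then (w1^-1, w2^-1) else (w1, w2)) u.
Qed.

Definition fgT (L : fieldType) (G : fgraph L) := {z : L * L | z \in fg_mem G}.
HB.instance Definition _ (L : fieldType) (G : fgraph L) := SubChoice.on (fgT G).
HB.instance Definition _ (L : fieldType) (G : fgraph L) :=
  GRing.isDivringClosed.Build (L * L)%type (fg_mem G) (fg_divring G).
HB.instance Definition _ (L : fieldType) (G : fgraph L) :=
  [SubChoice_isSubComUnitRing of fgT G by <:].

Fact fgT_field (L : fieldType) (G : fgraph L) : GRing.field_axiom (fgT G).
Proof.
move=> x x0; have : val x \is a GRing.unit.
  apply: (@fg_unit _ G); first exact/asboolP/(valP x).
  by apply: contraNneq x0 => e; apply/eqP/val_inj; rewrite e rmorph0.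
by [].
Qed.
HB.instance Definition _ (L : fieldType) (G : fgraph L) :=
  GRing.ComUnitRing_isField.Build (fgT G) (@fgT_field L G).

Section Proj.
Variables (L : fieldType) (G : fgraph L).
Definition fg1 (z : fgT G) : L := (val z).1.
Definition fg2 (z : fgT G) : L := (val z).2.
HB.instance Definition _ := GRing.RMorphism.copy fg1 (fst \o val).
HB.instance Definition _ := GRing.RMorphism.copy fg2 (snd \o val).
End Proj.

(** The gcd of h and P cannot vanish at x, for h would then divide P. So its cofactor in h vanishes
    at x, is divisible by h, and the gcd is constant. *)
Lemma minpoly_inv (F L : fieldType) (a : {rmorphism F -> L}) (x : L) (h P : {poly F}) :
  h \is monic -> root (map_poly a h) x ->
  (forall Q, root (map_poly a Q) x -> h %| Q) -> ~~ root (map_poly a P) x ->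
  exists u v, u * h + v * P = 1.
Proof.
move=> hm rh hmin nrP; have h0 := monic_neq0 hm.
have cp : coprimep h P.
  rewrite coprimep_def; have gh := dvdp_gcdl h P; case/dvdpP: (gh) => k ek.
  have g0 : gcdp h P != 0 by apply: contraNneq h0 => e; rewrite ek e mulr0.
  have : ~~ root (map_poly a (gcdp h P)) x.
    apply: contra nrP => rg; have := dvdp_trans (hmin _ rg) (dvdp_gcdr h P).
    by case/dvdpP => q ->; rewrite rmorphM rootM rh orbT.
  move: rh; rewrite {1}ek rmorphM rootM => /orP[rk ng|-> //].
  have k0 : k != 0 by apply: contraNneq h0 => e; rewrite ek e mul0r.
  have := dvdp_leq k0 (hmin _ rk); rewrite {1}ek size_mul //.
  have : (0 < size (gcdp h P))%N by rewrite lt0n size_poly_eq0.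
  case: (size (gcdp h P)) => // m _; rewrite addnS /=.
  by rewrite -{2}(addn0 (size k)) leq_add2l leqn0 => /eqP ->.
have [[u v]] := Bezout_eq1_coprimepP _ _ cp.
by exists u, v.
Qed.

(** The isomorphism from F[x] to F[x'] through F[X]/h, with F embedded by a on one side and by b on
    the other. *)
Lemma graph_adjoin (F L : fieldType) (a b : {rmorphism F -> L}) (x x' : L) (h : {poly F}) :
  h \is monic -> root (map_poly a h) x ->
  (forall P, root (map_poly a P) x -> h %| P) -> root (map_poly b h) x' ->
  is_graph (fun z => exists P : {poly F}, z = ((map_poly a P).[x], (map_poly b P).[x'])).
Proof.
move=> hm rh hmin rh'; split.
- by exists 1; rewrite !rmorph1 !hornerC.
- by move=> _ _ [P ->] [Q ->]; exists (P - Q); rewrite !rmorphB !hornerD !hornerN.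
- by move=> _ _ [P ->] [Q ->]; exists (P * Q); rewrite !rmorphM !hornerM.
- move=> _ [P ->] /=; have [rP|nrP] := boolP (root (map_poly a P) x).
    have /dvdpP[q e] := hmin _ rP; exists 0; rewrite !rmorph0 !hornerC.
    by rewrite (rootP rP) e rmorphM hornerM (rootP rh') mulr0 invr0.
  have [u [v e]] := minpoly_inv hm rh hmin nrP; exists v.
  have ea : (map_poly a v).[x] * (map_poly a P).[x] = 1.
    have := congr1 (fun R => (map_poly a R).[x]) e.
    by rewrite /= rmorphD !rmorphM rmorph1 hornerD !hornerM (rootP rh) mulr0 add0r hornerC.
  have eb : (map_poly b v).[x'] * (map_poly b P).[x'] = 1.
    have := congr1 (fun R => (map_poly b R).[x']) e.
    by rewrite /= rmorphD !rmorphM rmorph1 hornerD !hornerM (rootP rh') mulr0 add0r hornerC.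
  have ia u1 v1 : u1 * v1 = 1 :> L -> v1^-1 = u1.
    move=> e1; have v0 : v1 != 0 by apply: contraTneq (oner_neq0 L) => v0; rewrite -e1 v0 mulr0 eqxx.
    by apply: (mulIf v0); rewrite mulVf.
  by rewrite (ia _ _ ea) (ia _ _ eb).
move=> _ [P ->] /=; have [rP|nrP] := boolP (root (map_poly a P) x).
  have /dvdpP[q e] := hmin _ rP; rewrite (rootP rP).
  by rewrite e rmorphM hornerM (rootP rh') mulr0.
have [u [v e]] := minpoly_inv hm rh hmin nrP.
rewrite -rootE (negbTE nrP); apply/esym/negbTE/eqP => e0.
have := congr1 (fun R => (map_poly b R).[x']) e.
rewrite /= rmorphD !rmorphM rmorph1 hornerD !hornerM (rootP rh') e0 !mulr0 add0r hornerC.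
by move/esym/eqP; rewrite oner_eq0.
Qed.

Definition is_minpoly (L : fieldType) (S : sfield L) (x : L) (h : {poly L}) :=
  [/\ h \is monic, h \is a polyOver S, root h x &
      forall P, P \is a polyOver S -> root P x -> h %| P].

Definition alg_over (L : fieldType) (S : sfield L) (x : L) :=
  exists2 P : {poly L}, P != 0 /\ P \is a polyOver S & root P x.

Lemma polyOver_lift (L : fieldType) (S : sfield L) (P : {poly L}) :
  P \is a polyOver S -> exists Q : {poly subF S}, map_poly val Q = P.
Proof.
move=> /polyOverP hP; exists (\poly_(i < size P) (insubd (0 : subF S) P`_i)).
apply/polyP => i; rewrite coef_map coef_poly; case: ltnP => hi /=.
  by rewrite val_insubd hP.
by rewrite nth_default.
Qed.

Lemma polyOver_val (L : fieldType) (S : sfield L) (Q : {poly subF S}) :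
  map_poly val Q \is a polyOver S.
Proof. by apply/polyOverP => i; rewrite coef_map; exact: (valP Q`_i). Qed.

Lemma exists_minpoly (L : fieldType) (S : sfield L) (x : L) :
  alg_over S x -> exists h, is_minpoly S x h.
Proof.
move=> [P [P0 PS] rP]; have [Q eQ] := polyOver_lift PS.
have [|h [hm rh hmin]] := @ex_minpoly _ _ (val : {rmorphism subF S -> L}) x.
  exists Q; last by rewrite eQ.
  by apply: contraNneq P0 => e; rewrite -eQ e rmorph0.
exists (map_poly val h); split=> //; first by rewrite map_monic.
  exact: polyOver_val.
by move=> R /polyOver_lift[R' <-] rR; rewrite dvdp_map; exact: hmin.
Qed.

Section ExtendAut.
Variables (L : closedFieldType) (S : sfield L).
Hypothesis algS : forall x, alg_over S x.

(** In a maximal graph containing that of S(x) to S(x'), every y is algebraic over the domain and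
    its transported minimal polynomial has a root, L being algebraically closed; maximality makes
    the domain all of L. *)
Lemma extend_aut (x x' : L) (h : {poly L}) : is_minpoly S x h -> root h x' ->
  exists s : {rmorphism L -> L}, [/\ bijective s, {in S, s =1 id} & s x = x'].
Proof.
move=> [hm hS rh hmin] rh'; have [h0 eh0] := polyOver_lift hS.
pose a : {rmorphism subF S -> L} := val.
pose G0 z := exists P : {poly subF S}, z = ((map_poly a P).[x], (map_poly a P).[x']).
have G0g : is_graph G0.
  apply: (@graph_adjoin _ _ a a x x' h0); rewrite ?eh0 //; first by rewrite -(map_monic a) eh0.
  by move=> P rP; rewrite -(dvdp_map a) eh0; apply: hmin => //; exact: polyOver_val.
have G0S z : z \in S -> G0 (z, z).
  by move=> zS; exists (Sub z zS)%:P; rewrite map_polyC !hornerC.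
have G0x : G0 (x, x') by exists 'X; rewrite map_polyX !hornerX.
have [||G [Gg G0G] Gmax] := @Zorn_union (L * L)%type
    (fun G => is_graph G /\ (G0 `<=` G)%classic) G0.
- by split.
- move=> C [X0 CX0] CP Ctot.
  have two z w : (exists2 X, C X & X z) -> (exists2 X, C X & X w) ->
      exists X, [/\ C X, X z & X w].
    move=> [X CX Xz] [Y CY Yw]; have [XY|YX] := Ctot _ _ CX CY.
      by exists Y; split=> //; exact: XY.
    by exists X; split=> //; exact: YX.
  split; last by move=> z G0z; exists X0 => //; case: (CP _ CX0) => _; apply.
  split.
  + by exists X0 => //; case: (CP _ CX0) => [[]].
  + move=> z w hz hw; have [X [CX Xz Xw]] := two _ _ hz hw; exists X => //.
    by case: (CP _ CX) => [[_ + _ _ _] _]; apply.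
  + move=> z w hz hw; have [X [CX Xz Xw]] := two _ _ hz hw; exists X => //.
    by case: (CP _ CX) => [[_ _ + _ _] _]; apply.
  + by move=> z [X CX Xz]; exists X => //; case: (CP _ CX) => [[_ _ _ + _] _]; apply.
  + by move=> z [X CX Xz]; case: (CP _ CX) => [[_ _ _ _ +] _]; apply.
pose GG := FGraph Gg; pose b : {rmorphism fgT GG -> L} := @fg1 L GG.
pose c : {rmorphism fgT GG -> L} := @fg2 L GG.
have inG z (Gz : G z) : exists w : fgT GG, b w = z.1 /\ c w = z.2.
  have Gz' : z \in fg_mem GG by apply/asboolP.
  by exists (Sub z Gz').
have total y : exists y', G (y, y').
  have [|k [km rk kmin]] := @ex_minpoly _ _ b y.
    have [P [P0 PS] rP] := algS y.
    have : exists Q : {poly fgT GG}, map_poly b Q = P.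
      pose pre (u : L) : fgT GG := if pselect (exists w, b w = u) is left e then sval (cid e) else 0.
      have preK u : u \in S -> b (pre u) = u.
        move=> uS; rewrite /pre; case: pselect => [e|[]]; first exact: (svalP (cid e)).
        by have [w [e _]] := inG _ (G0G _ (G0S _ uS)); exists w.
      exists (\poly_(i < size P) pre P`_i); apply/polyP => i; rewrite coef_map coef_poly.
      case: ltnP => hi; first by apply: preK; exact: (polyOverP PS).
      by rewrite nth_default //; exact: rmorph0.
    case=> Q eQ; exists Q; last by rewrite eQ.
    by apply: contraNneq P0 => e; rewrite -eQ e rmorph0.
  have [y' ry'] : exists y', root (map_poly c k) y'.
    apply/closed_rootP; rewrite size_map_poly; apply/eqP => k1.
    move: rk; have /eqP := k1; rewrite eqn_leq => /andP[/size1_polyC ek _].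
    rewrite ek map_polyC rootC fmorph_eq0 => k0.
    by move: (monic_neq0 km); rewrite ek polyC_eq0 k0.
  have G'g := graph_adjoin km rk kmin ry'.
  have GG' : (G `<=` (fun z => exists P, z = ((map_poly b P).[y], (map_poly c P).[y'])))%classic.
    by move=> [z1 z2] /inG[w [/= <- <-]]; exists w%:P; rewrite !map_polyC !hornerC.
  have := Gmax _ GG'; move/(_ (conj G'g (subset_trans G0G GG'))) => G'G.
  by exists y'; apply: G'G; exists 'X; rewrite !map_polyX !hornerX.
have [s sG] := choice total.
have [G1 GB GM GV Gr] := Gg.
have func y y1 y2 : G (y, y1) -> G (y, y2) -> y1 = y2.
  move=> h1 h2; have := GB _ _ h1 h2; move=> /Gr /=; rewrite subrr eqxx => /esym/eqP.
  by move/eqP; rewrite subr_eq0 => /eqP.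
have sB : zmod_morphism s by move=> u v; apply: (func (u - v)) => //; exact: (GB (u, _) (v, _)).
have sM : monoid_morphism s.
  by split=> [|u v]; [exact: (func 1) | apply: (func (u * v)) => //; exact: (GM (u, _) (v, _))].
pose s1 := HB.pack_for {rmorphism L -> L} s (GRing.isZmodMorphism.Build _ _ s sB)
  (GRing.isMonoidMorphism.Build _ _ s sM).
have sS : {in S, s1 =1 id} by move=> y yS; apply: (func y) => //; exact/G0G/G0S.
exists s1; split=> //; last by apply: (func x) => //; exact: G0G.
(* The finite set of roots of P is mapped injectively into itself, hence permuted. *)
have surj y : exists z, s1 z = y.
  have [P [P0 PS] rP] := algS y.
  have [rs ers] := closed_field_poly_normal P.
  have mem z : (z \in rs) = root P z.
    by rewrite ers rootZ ?lead_coef_eq0 // root_prod_XsubC.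
  have sub : {subset map s1 (undup rs) <= undup rs}.
    move=> _ /mapP[z + ->]; rewrite !mem_undup !mem => /rootP rz; apply/rootP.
    have eP : map_poly s1 P = P.
      by apply/polyP => i; rewrite coef_map; apply: sS; exact: (polyOverP PS).
    by rewrite -eP horner_map rz rmorph0.
  have uq : uniq (map s1 (undup rs)) by rewrite (map_inj_uniq (fmorph_inj s1)) undup_uniq.
  have [|_ em] := uniq_min_size uq sub; first by rewrite size_map.
  have : y \in undup rs by rewrite mem_undup mem.
  by rewrite -em => /mapP[z _ ->]; exists z.
have [t tK] := choice surj; exists t => [z|//].
by apply: (fmorph_inj s1); rewrite tK.
Qed.

End ExtendAut.

(** * Separable elements *)

Section Separable.
Variables (F L : fieldType) (iota : {rmorphism F -> L}).
Hypothesis algL : algebraic_over iota.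

(** Finitely many elements are placed in one finite extension of F, where the library theory of
    separability applies; [separable_nu] translates back to L. *)
Lemma fieldExt_of_seq (zs : seq L) :
  exists (E : fieldExtType F) (nu : {rmorphism E -> L}),
    (forall a, nu a%:A = iota a) /\ forall z, z \in zs -> exists e, nu e = z.
Proof.
elim: zs => [|z zs [E [nu [nuF nuz]]]].
  by exists F^o, iota; split=> // a; rewrite /GRing.scale /= mulr1.
have [|h [hm rh hmin]] := @ex_minpoly _ _ nu z.
  have [P [P0 rP]] := algL z; exists (map_poly (in_alg E) P); first by rewrite map_poly_eq0.
  by rewrite -map_poly_comp (eq_map_poly (g := iota)).
have hirr : irreducible_poly h.
  apply/(subfx_irreducibleP rh (monic_neq0 hm)) => q rq q0.
  exact: (dvdp_leq q0 (hmin _ rq)).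
pose E1 : fieldExtType E := SubFieldExtType rh hirr.
exists (baseFieldType E1), (subfx_inj : {rmorphism E1 -> L}); split=> [a|w].
  rewrite baseField_scaleE -nuF. exact: (subfx_inj_base rh (monic_neq0 hm)).
rewrite inE => /predU1P[->|/nuz[e <-]].
  exists (subfx_root nu z h); exact: (subfx_inj_root rh (monic_neq0 hm)).
by exists (e%:A : E1); exact: (subfx_inj_base rh (monic_neq0 hm)).
Qed.

Lemma separable_nu (E : fieldExtType F) (nu : {rmorphism E -> L}) :
  (forall a, nu a%:A = iota a) ->
  forall e, separable_over iota (nu e) <-> separable_element 1%AS e.
Proof.
move=> nuF e; have iE (P : {poly F}) : map_poly iota P = map_poly nu (map_poly (in_alg E) P).
  by rewrite -map_poly_comp; apply: eq_map_poly => a /=; rewrite nuF.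
split=> [[P [P0 sP rP]]|/separable_elementP[f [f1 rf sf]]].
  apply/separable_elementP; exists (map_poly (in_alg E) P); split.
  - by apply/polyOver1P; exists P.
  - by move: rP; rewrite iE fmorph_root.
  - by rewrite separable_map.
have /polyOver1P[P eP] := f1; exists P; split.
- by move: (separable_poly_neq0 sf); rewrite eP map_poly_eq0.
- by rewrite -(separable_map (in_alg E)) -eP.
- by rewrite iE -eP fmorph_root.
Qed.

Lemma nu_pre (zs : seq L) : (forall z, z \in zs -> separable_over iota z) ->
  forall w : L, exists (E : fieldExtType F) (nu : {rmorphism E -> L}) (es : seq E) (e : E),
   [/\ (forall a, nu a%:A = iota a), map nu es = zs, nu e = w &
      separable 1%AS <<1%AS & es>>%AS].
Proof.
move=> hz w; have [E [nu [nuF nuz]]] := fieldExt_of_seq (w :: zs).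
have [e ee] : exists e, nu e = w by apply: nuz; rewrite inE eqxx.
have [es ees] : exists es, map nu es = zs.
  have : forall z, z \in zs -> exists e, nu e = z.
    by move=> z hz'; apply: nuz; rewrite inE hz' orbT.
  elim: (zs) => [|z s IH] h; first by exists [::].
  have [e1 e1e] := h z (mem_head _ _).
  have [|es1 es1e] := IH; first by move=> z1 hz1; apply: h; rewrite inE hz1 orbT.
  by exists (e1 :: es1); rewrite /= e1e es1e.
exists E, nu, es, e; split=> //; apply: separable_Fadjoin_seq.
apply/allP => e1 he1; apply/(separable_nu nuF)/hz; rewrite -ees.
exact: map_f.
Qed.

Lemma separable_overB x y : separable_over iota x -> separable_over iota y ->
  separable_over iota (x - y).
Proof.
move=> sx sy; have [|E [nu [es [e [nuF ees _ /separableP ss]]]]] := @nu_pre [:: x; y] _ 0.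
  by move=> z; rewrite !inE => /orP[]/eqP->.
case: es ees ss => [|e1 [|e2 [|//]]] //= [<- <-] ss; rewrite -rmorphB.
apply/(separable_nu nuF); apply: ss; apply: rpredB; apply: seqv_sub_adjoin.
  by rewrite !inE eqxx.
by rewrite !inE eqxx orbT.
Qed.

Lemma separable_overM x y : separable_over iota x -> separable_over iota y ->
  separable_over iota (x * y).
Proof.
move=> sx sy; have [|E [nu [es [e [nuF ees _ /separableP ss]]]]] := @nu_pre [:: x; y] _ 0.
  by move=> z; rewrite !inE => /orP[]/eqP->.
case: es ees ss => [|e1 [|e2 [|//]]] //= [<- <-] ss; rewrite -rmorphM.
apply/(separable_nu nuF); apply: ss; apply: rpredM; apply: seqv_sub_adjoin.
  by rewrite !inE eqxx.
by rewrite !inE eqxx orbT.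
Qed.

Lemma separable_overV x : separable_over iota x -> separable_over iota x^-1.
Proof.
move=> sx; have [|E [nu [es [e [nuF ees _ /separableP ss]]]]] := @nu_pre [:: x] _ 0.
  by move=> z; rewrite !inE => /eqP->.
case: es ees ss => [|e1 [|//]] //= [<-] ss; rewrite -fmorphV.
apply/(separable_nu nuF); apply: ss; rewrite rpredV; apply: seqv_sub_adjoin.
by rewrite !inE eqxx.
Qed.

Lemma separable_overC a : separable_over iota (iota a).
Proof.
exists ('X - a%:P); rewrite polyXsubC_eq0 rmorphB /= map_polyX map_polyC root_XsubC eqxx.
by split=> //; rewrite unlock !derivCE coprimep1.
Qed.

(** The minimal polynomial of x over the field of the coefficients divides P, and inseparability
    would force P'(x) = 0. Transitivity of separability concludes. *)
Lemma separable_over_trans (P : {poly L}) x :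
  (forall i, separable_over iota P`_i) -> root P x -> P^`().[x] != 0 ->
  separable_over iota x.
Proof.
move=> sP rP dP; have [|E [nu [es [e [nuF ees ee ss]]]]] := @nu_pre P _ x.
  by move=> z /(nthP 0)[i _ <-].
have eP : map_poly nu (Poly es) = P.
  apply/polyP => i; rewrite coef_map coef_Poly -ees.
  have [hi|hi] := ltnP i (size es); first by rewrite (nth_map 0).
  by rewrite [RHS]nth_default ?size_map // nth_default //; apply: rmorph0.
rewrite -ee; apply/(separable_nu nuF).
have PS : Poly es \is a polyOver <<1%AS & es>>%AS.
  apply/polyOverP => i; rewrite coef_Poly; have [hi|hi] := ltnP i (size es).
    by apply: seqv_sub_adjoin; exact: mem_nth.
  by rewrite nth_default // rpred0.
have se : separable_element <<1%AS & es>>%AS e.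
  have := separable_root_der <<1%AS & es>>%AS e; case: separable_element => //= r.
  have re : root (Poly es) e by rewrite -(fmorph_root nu) eP ee.
  have /dvdpP[q eq] := minPoly_dvdp PS re.
  case/eqP: dP; rewrite -eP -ee deriv_map horner_map eq derivM hornerD !hornerM.
  by rewrite (rootP r) (rootP (root_minPoly _ _)) !mulr0 addr0 rmorph0.
move: se; rewrite adjoin_separable_eq => /(separable_trans ss)/separableP; apply.
exact: memv_adjoin.
Qed.

End Separable.

(** * The relative Frobenius of R[X]/f in characteristic p *)

Section RelativeFrobenius.
Variables (R : comNzRingType) (p : nat).
Hypothesis chR : p \in [pchar R].
Let pp : prime p := pcharf_prime chR.
Let p0 : (0 < p)%N := prime_gt0 pp.
Let sg := pFrobenius_aut chR.

Lemma pchar_poly : p \in [pchar {poly R}].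
Proof. exact: (rmorph_pchar polyC). Qed.
Let chP := pchar_poly.

Lemma natr_inv (k : nat) : ~~ (p %| k)%N -> exists u : R, k%:R * u = 1.
Proof.
case: k => [|k]; first by rewrite dvdn0.
rewrite -prime_coprime // coprime_sym => cp; have [u v e _] := egcdnP p (ltn0Sn k).
exists u%:R; rewrite -natrM mulnC e (eqP cp) natrD natrM (pcharf0 chR) mulr0 add0r.
by [].
Qed.

Lemma frob_poly (G : {poly R}) : G ^+ p = map_poly sg G \Po 'X^p.
Proof.
elim/poly_ind: G => [|G c IH]; first by rewrite rmorph0 comp_poly0 expr0n gtn_eqF.
rewrite -(pFrobenius_autE chP) rmorphD rmorphM /= !pFrobenius_autE IH.
rewrite rmorphD rmorphM /= map_polyX map_polyC comp_polyD comp_polyM comp_polyX comp_polyC.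
by rewrite -polyC_exp.
Qed.

Lemma deriv_compXp (G : {poly R}) : (G \Po 'X^p)^`() = 0.
Proof. by rewrite deriv_comp derivXn -mulr_natr (pcharf0 chP) !mulr0. Qed.

Lemma deriv_expp (G : {poly R}) : (G ^+ p)^`() = 0.
Proof. by rewrite frob_poly deriv_compXp. Qed.

Lemma deriv0_comp (G : {poly R}) : G^`() = 0 -> exists G0, G = G0 \Po 'X^p.
Proof.
move=> dG; exists (\poly_(i < size G) G`_(i * p)%N); apply/polyP => i.
rewrite coef_comp_poly_Xn //; case: ifP => [/dvdnP[k ->]|/negbT pi].
  rewrite mulnK // coef_poly; case: ltnP => // hk; rewrite nth_default //.
  by apply: leq_trans hk _; rewrite leq_pmulr.
case: i pi => [|i] pi; first by rewrite dvdn0 in pi.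
have := congr1 (fun P : {poly R} => P`_i) dG; rewrite coef_deriv coef0.
by have [u e] := natr_inv pi; rewrite -mulr_natr => /(congr1 (fun z => z * u)); rewrite -mulrA e mulr1 mul0r.
Qed.

Lemma compXp_inj (G H : {poly R}) : G \Po 'X^p = H \Po 'X^p -> G = H.
Proof.
move=> e; apply/polyP => i; have := congr1 (fun P : {poly R} => P`_(i * p)%N) e.
by rewrite !coef_comp_poly_Xn // dvdn_mull // mulnK.
Qed.

Lemma derivn_p (G : {poly R}) : G^`(p) = 0.
Proof.
apply/polyP => i; rewrite coef_derivn coef0 -mulr_natr.
suff /dvdnP[k ->] : (p %| (p + i) ^_ p)%N by rewrite natrM (pcharf0 chR) !mulr0.
by rewrite -bin_ffact dvdn_mull // dvdn_fact // p0 leqnn.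
Qed.

(** Only coefficients of index -1 modulo p cannot be integrated, and these are killed by the
    vanishing of the derivative of order p - 1. *)
Lemma derivn_prim (H : {poly R}) : H^`(p.-1) = 0 -> exists H2, H = H2^`().
Proof.
move=> dH.
have inv k : exists u : R, ~~ (p %| k)%N -> k%:R * u = 1.
  by case: (boolP (p %| k)%N) => [_|/natr_inv[u e]]; [exists 0 | exists u].
have [iv ivP] := choice inv.
exists (\poly_(i < (size H).+1) (H`_i.-1 * iv i)); apply/polyP => i.
rewrite coef_deriv coef_poly ltnS /=.
have [hi|hi] := ltnP i (size H); last by rewrite nth_default // mul0rn.
rewrite -mulr_natr -mulrA [_ * _%:R]mulrC.
have [/dvdnP[k e]|ni] := boolP (p %| i.+1)%N; last by rewrite ivP // mulr1.
suff -> : H`_i = 0 by rewrite mul0r.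
case: k e => // k e.
have ei : i = (p.-1 + k * p)%N by apply: succn_inj; rewrite e -addSn prednK // mulSn.
have := congr1 (fun P : {poly R} => P`_(k * p)%N) dH.
rewrite coef_derivn coef0 -ei -mulr_natr.
(* As i is -1 modulo p, the p - 1 factors of this falling factorial are prime to p. *)
have [|u eu] := @natr_inv (i ^_ p.-1)%N.
  rewrite ffact_prod; elim/big_ind: _ => [|x y hx hy|j _].
  - by rewrite dvdn1 gtn_eqF // prime_gt1.
  - by rewrite Euclid_dvdM // negb_or hx.
  have hj : (j < p.-1)%N := ltn_ord j.
  rewrite ei addnC -addnBA ?(ltnW hj) // dvdn_addr ?dvdn_mull // gtnNdvd ?subn_gt0 //.
  by rewrite -[X in (_ < X)%N](prednK p0) ltnS leq_subr.
by move=> /(congr1 (fun z => z * u)); rewrite -mulrA eu mulr1 mul0r.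
Qed.

Lemma monic_mul0 (f w : {poly R}) : f \is monic -> f * w = 0 -> w = 0.
Proof.
move=> fm e; apply/eqP; apply: contraT => w0.
have := size_monicM fm w0; rewrite e size_poly0.
have : (0 < size f)%N by rewrite lt0n size_poly_eq0 monic_neq0.
rewrite -size_poly_eq0 -lt0n in w0; case: (size f) => // m _; case: (size w) w0 => // k _.
by rewrite addnS.
Qed.

Variable f : {poly R}.
Hypothesis fm : f \is monic.
Let d := f^`() ^+ p.

(** Injectivity of the relative Frobenius up to a power of f'. Since d and polynomials in X^p have
    derivative zero, differentiating d^j Q(X^p) = f^(j+1) u shows that f divides f' u, so a further
    factor d gains a factor f. At j = p - 1 the cofactor of f^p has derivative zero, hence is a
    polynomial in X^p, and X^p can be replaced by X throughout. *)
Lemma etale_inj (Q u : {poly R}) : Q \Po 'X^p = f * u ->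
  exists V, map_poly sg f^`() ^+ p.-1 * Q = map_poly sg f * V.
Proof.
move=> eQ.
have loop j : (j < p)%N -> exists u, d ^+ j * (Q \Po 'X^p) = f ^+ j.+1 * u.
  elim: j => [|j IH] hj; first by exists u; rewrite expr0 mul1r expr1.
  have [w ew] := IH (ltnW hj).
  have := congr1 (fun P : {poly R} => P^`()) ew.
  rewrite derivM deriv_exp /d deriv_expp mul0r mul0rn deriv_compXp mulr0 addr0.
  rewrite derivM deriv_exp /= -mulr_natr => e.
  have [|v ev] := @natr_inv j.+1; first by rewrite gtnNdvd.
  have e1 : f^`() * w * j.+1%:R = - (f * w^`()).
    apply/eqP; rewrite -subr_eq0 opprK; apply/eqP.
    apply: (@monic_mul0 (f ^+ j)); first exact: monic_exp.
    by move: e; rewrite mul0r => ->; rewrite exprS; ring.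
  have e2 : f^`() * w = f * (- w^`() * v%:P).
    have ev' : (j.+1%:R : {poly R}) * v%:P = 1 by rewrite -polyC_natr -polyCM ev.
    by rewrite -[LHS]mulr1 -ev' mulrA e1; ring.
  exists (f^`() ^+ p.-1 * (- w^`() * v%:P)); rewrite exprS -mulrA ew /d.
  rewrite -{1}(prednK p0) exprS [f ^+ j.+2]exprSr.
  transitivity (f ^+ j.+1 * f^`() ^+ p.-1 * (f^`() * w)); first by ring.
  by rewrite e2; ring.
have [|w ew] := loop p.-1; first by rewrite prednK.
rewrite prednK // in ew.
have /deriv0_comp[V eV] : w^`() = 0.
  apply: (@monic_mul0 (f ^+ p)); first exact: monic_exp.
  have := congr1 (fun P : {poly R} => P^`()) ew.
  rewrite derivM deriv_exp /d deriv_expp mul0r mul0rn deriv_compXp mulr0 addr0 mul0r.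
  by rewrite derivM deriv_expp mul0r add0r.
by exists V; apply: compXp_inj; rewrite !comp_polyM rmorphXn /= -!frob_poly ew eV.
Qed.

(** Leibniz formula modulo f^(m - j + 1): only the term where all derivatives fall on the power of f
    survives. *)
Lemma derivn_fexp (m j : nat) (H : {poly R}) : (j <= m)%N -> exists S,
  (f ^+ m * H)^`(j) = f ^+ (m - j) * (f^`() ^+ j * H * (m ^_ j)%:R) + f ^+ (m - j).+1 * S.
Proof.
elim: j => [|j IH] hj.
  by exists 0; rewrite subn0 mulr0 addr0 derivn0 expr0 mul1r ffactn0 mulr1.
have [S eS] := IH (ltnW hj); have [k ek] : exists k, (m - j)%N = k.+1.
  by case: (m - j)%N (subn_gt0 j m) => [|k]; [rewrite hj | exists k].
have ek' : (m - j.+1)%N = k by rewrite subnS ek.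
have dE n : (f ^+ n.+1)^`() = f^`() * f ^+ n * n.+1%:R by rewrite deriv_exp -mulr_natr.
rewrite derivnS eS ek ek' ffactnSr ek natrM [f^`() ^+ j.+1]exprS.
exists (f^`() * S * k.+2%:R + f * S^`() + (f^`() ^+ j * H * (m ^_ j)%:R)^`()).
move: (f^`() ^+ j) ((m ^_ j)%:R : {poly R}) => A B.
rewrite derivD (derivM _ (A * H * B)) (derivM _ S) !dE.
move: (A * H * B)^`() S^`() => C' S'.
rewrite [f ^+ k.+2]exprS [f ^+ k.+1]exprS.
move: (k.+1%:R : {poly R}) (k.+2%:R : {poly R}) (f ^+ k) f^`() => n1 n2 fk f'.
ring.
Qed.

(** Surjectivity of the relative Frobenius up to powers of f'. Adding multiples of f makes the
    derivative of d^m G divisible by f^(p-1), and, since derivatives of order p vanish, by f^p after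
    one more factor d. The remaining cofactor can be integrated, and what is left has derivative
    zero, so is a polynomial in X^p. *)
Lemma etale_surj (G : {poly R}) : exists k U W,
  G * f^`() ^+ (p * k) = U \Po 'X^p + f * W.
Proof.
have dd : d^`() = 0 by exact: deriv_expp.
have loop k : (k < p)%N -> exists m W H,
    (d ^+ m * G + f * W)^`() = f ^+ k * H.
  elim: k => [|k IH] hk; first by exists 0%N, 0, G^`(); rewrite !expr0 !mul1r mulr0 addr0.
  have [m [W [H e]]] := IH (ltnW hk).
  have [|v ev] := @natr_inv k.+1; first by rewrite gtnNdvd.
  have ev' : (k.+1%:R : {poly R}) * v%:P = 1 by rewrite -polyC_natr -polyCM ev.
  (* Modulo f^(k+1), the derivative of f^(k+1) f'^(p-1) H is (k+1) d f^k H, so subtracting it with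
     coefficient v = 1/(k+1) cancels the term d f^k H. *)
  exists m.+1, (d * W - v%:P * f^`() ^+ p.-1 * f ^+ k * H).
  exists (- v%:P * (f^`() ^+ p.-1 * H)^`()).
  have -> : d ^+ m.+1 * G + f * (d * W - v%:P * f^`() ^+ p.-1 * f ^+ k * H) =
     d * (d ^+ m * G + f * W) - v%:P * (f ^+ k.+1 * (f^`() ^+ p.-1 * H)).
    by rewrite !exprS; ring.
  rewrite derivB [(d * _)^`()]derivM dd mul0r add0r e.
  rewrite [(v%:P * _)^`()]derivM derivC mul0r add0r [(f ^+ k.+1 * _)^`()]derivM.
  rewrite [(f ^+ k.+1)^`()]deriv_exp -mulr_natr /=.
  have -> : d = f^`() * f^`() ^+ p.-1 by rewrite -exprS prednK.
  transitivity ((1 - k.+1%:R * v%:P) * (f^`() * f^`() ^+ p.-1 * f ^+ k * H) +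
     f ^+ k.+1 * (- v%:P * (f^`() ^+ p.-1 * H)^`())); first by ring.
  by rewrite ev' subrr mul0r add0r.
have [|m [W [H e]]] := loop p.-1; first by rewrite prednK.
have [S eS] := derivn_fexp H (leqnn p.-1).
have [v ev] : exists v : R, (p.-1 ^_ p.-1)%:R * v = 1.
  apply: natr_inv; rewrite ffactnn fact_prod big_add1 big_mkord.
  elim/big_ind: _ => [|x y hx hy|j _].
  - by rewrite dvdn1 gtn_eqF // prime_gt1.
  - by rewrite Euclid_dvdM // negb_or hx.
  by rewrite gtnNdvd // -[X in (_ < X)%N](prednK p0) ltnS ltn_ord.
have e1 : f^`() ^+ p.-1 * H = f * (- S * v%:P).
  have : (f ^+ p.-1 * H)^`(p.-1) = 0 by rewrite -e -derivSn prednK // derivn_p.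
  rewrite eS subnn expr0 mul1r expr1 => /eqP; rewrite addr_eq0 => /eqP e1.
  have ev' : ((p.-1 ^_ p.-1)%:R : {poly R}) * v%:P = 1 by rewrite -polyC_natr -polyCM ev.
  by rewrite -[LHS]mulr1 -ev' mulrA e1; ring.
have fp : f ^+ p = f * f ^+ p.-1 by rewrite -exprS prednK.
pose H1 := f^`() * (- S * v%:P).
have e2 : (d * (d ^+ m * G + f * W))^`() = f ^+ p * H1.
  rewrite derivM dd mul0r add0r e fp.
  have -> : d = f^`() * f^`() ^+ p.-1 by rewrite -exprS prednK.
  transitivity (f ^+ p.-1 * f^`() * (f^`() ^+ p.-1 * H)); first by ring.
  by rewrite e1 /H1; ring.
have [|H2 eH2] := @derivn_prim H1.
  apply: (@monic_mul0 (f ^+ p)); first exact: monic_exp.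
  have <- : (f ^+ p * H1)^`(p.-1) = f ^+ p * H1^`(p.-1).
    elim: p.-1 => [|j IH]; first by rewrite !derivn0.
    by rewrite !derivnS IH derivM deriv_expp mul0r add0r.
  by rewrite -e2 -derivSn prednK // derivn_p.
have [U eU] : exists U, d * (d ^+ m * G + f * W) - f ^+ p * H2 = U \Po 'X^p.
  by apply: deriv0_comp; rewrite derivB e2 derivM deriv_expp mul0r add0r -eH2 subrr.
exists m.+1, U, (f ^+ p.-1 * H2 - d * W); rewrite -eU exprM -/d.
by rewrite fp [d ^+ m.+1]exprS; ring.
Qed.

End RelativeFrobenius.

(** * Construction of the completion *)

Definition nzT (F : fieldType) := {c : F | c != 0}.
HB.instance Definition _ (F : fieldType) := SubChoice.on (nzT F).
HB.instance Definition _ (F : fieldType) :=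
  isPointed.Build (nzT F) (exist _ 1 (oner_neq0 F)).

Section Nets.
Local Open Scope quotient_scope.
Variables (F : fieldType) (O : vring F).
Local Notation "x <=v y" := (lev O x y).
Local Notation "x <v y" := (ltv O x y).
Local Notation "x =v y" := (eqv O x y).

(** Nets are indexed by the nonzero elements ordered by value: the value group may have uncountable
    cofinality, where sequences do not suffice. *)
Definition evt (P : nzT F -> Prop) := exists d : nzT F, forall e : nzT F,
  val d <=v val e -> P e.

Lemma evt_sub (P Q : nzT F -> Prop) : (forall e, P e -> Q e) -> evt P -> evt Q.
Proof. by move=> h [d hd]; exists d => e /hd/h. Qed.
Lemma evt_and (P Q : nzT F -> Prop) : evt P -> evt Q -> evt (fun e => P e /\ Q e).
Proof.
move=> [d hd] [d' hd']; have [h|h] := orP (lev_total O (val d) (val d')).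
  by exists d' => e he; split; [apply: hd; exact: lev_trans he | exact: hd'].
by exists d => e he; split; [exact: hd | apply: hd'; exact: lev_trans he].
Qed.
Lemma evt_ex P : evt P -> exists e, P e.
Proof. by move=> [d hd]; exists d; apply: hd; apply: lev_refl. Qed.
Lemma evtT (P : nzT F -> Prop) : (forall e, P e) -> evt P.
Proof. by move=> h; exists point. Qed.

Definition cauchy (f : nzT F -> F) := forall c, c != 0 ->
  exists a, evt (fun e => c <v f e - a).
Definition null (f : nzT F -> F) := forall c, c != 0 -> evt (fun e => c <v f e).

Lemma cauchy_bounded f : cauchy f -> exists2 b, b != 0 & evt (fun e => b <=v f e).
Proof.
move=> /(_ 1 (oner_neq0 F))[a ha].
have [h|h] := orP (lev_total O 1 a).
  by exists 1; [exact: oner_neq0 | apply: evt_sub ha => e /ltvW h'; rewrite -(subrK a (f e)) levD].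
exists a; first by apply: contraTneq h => ->; rewrite lev0r oner_neq0.
by apply: evt_sub ha => e /ltvW /(lev_trans h) h'; rewrite -(subrK a (f e)) levD ?lev_refl.
Qed.

Lemma cauchy_cst a : cauchy (fun _ => a).
Proof. by move=> c c0; exists a; apply: evtT => e; rewrite subrr ltvr0. Qed.

Lemma cauchyB f g : cauchy f -> cauchy g -> cauchy (f - g).
Proof.
move=> hf hg c c0; have [a ha] := hf c c0; have [b hb] := hg c c0; exists (a - b).
apply: evt_sub (evt_and ha hb) => e [h1 h2].
have -> : (f - g) e - (a - b) = (f e - a) - (g e - b) by rewrite -[(f - g) e]/(f e - g e); ring.
exact: ltvB.
Qed.

Lemma cauchyM f g : cauchy f -> cauchy g -> cauchy (f * g).
Proof.
move=> hf hg c c0.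
have [bf bf0 hbf] := cauchy_bounded hf; have [bg bg0 hbg] := cauchy_bounded hg.
have [a ha] := hf (c / bg) (mulf_neq0 c0 (invr_neq0 bg0)).
have [b1 hb1] := hg (c / bf) (mulf_neq0 c0 (invr_neq0 bf0)).
have [e0 [[ha0 hb0] [hf0 hg0]]] := evt_ex (evt_and (evt_and ha hb1) (evt_and hbf hbg)).
exists (f e0 * g e0); apply: evt_sub (evt_and (evt_and ha hb1) (evt_and hbf hbg)).
move=> e [[h1 h2] [h3 h4]].
have -> : (f * g) e - f e0 * g e0 = ((f e - a) - (f e0 - a)) * g e + ((g e - b1) - (g e0 - b1)) * f e0.
  by rewrite -[(f * g) e]/(f e * g e); ring.
apply: ltvD; [rewrite -(divfK bg0 c)|rewrite -(divfK bf0 c)];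
  by apply: ltv_leM => //; apply: ltvB.
Qed.

Lemma nullB f g : null f -> null g -> null (f - g).
Proof. by move=> hf hg c c0; apply: evt_sub (evt_and (hf c c0) (hg c c0)) => e [h1 h2]; exact: ltvB. Qed.
Lemma nullM f g : cauchy f -> null g -> null (f * g).
Proof.
move=> hf hg c c0; have [b b0 hb] := cauchy_bounded hf.
apply: evt_sub (evt_and hb (hg (c / b) (mulf_neq0 c0 (invr_neq0 b0)))) => e [h1 h2].
rewrite -(divfK b0 c) mulrC -[(f * g) e]/(f e * g e).
exact: lev_ltM.
Qed.
Lemma null0 : null 0.
Proof. by move=> c c0; apply: evtT => e; rewrite ltvr0. Qed.

Definition net_pred : {pred nzT F -> F} := fun f => `[< cauchy f >].
Fact net_closed : subring_closed net_pred.
Proof.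
split=> [|f g|f g]; first exact/asboolP/cauchy_cst.
  by move=> /asboolP ? /asboolP ?; apply/asboolP/cauchyB.
by move=> /asboolP ? /asboolP ?; apply/asboolP/cauchyM.
Qed.
HB.instance Definition _ := GRing.isSubringClosed.Build (nzT F -> F) net_pred net_closed.
Definition net := {f : nzT F -> F | f \in net_pred}.
HB.instance Definition _ := SubChoice.on net.
HB.instance Definition _ := [SubChoice_isSubComNzRing of net by <:].

Lemma netP (f : net) : cauchy (val f). Proof. exact/asboolP/(valP f). Qed.

Definition nullI : {pred net} := fun f => `[< null (val f) >].
Fact null_ideal : idealr_closed nullI.
Proof.
split.
- by apply/asboolP; rewrite rmorph0; exact: null0.
- apply/asboolPn => /(_ 1 (oner_neq0 F))/evt_ex[e].
  by rewrite rmorph1 -[(1 : nzT F -> F) e]/1 ltvv.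
move=> a u v /asboolP hu /asboolP hv; apply/asboolP; rewrite rmorphD rmorphM /=.
rewrite -[val v]opprK; apply: nullB; first exact: nullM (netP a) hu.
by rewrite -sub0r; apply: nullB => //; exact: null0.
Qed.
HB.instance Definition _ := isIdealr.Build net nullI null_ideal.

Definition compl := {ideal_quot nullI}.
HB.instance Definition _ := GRing.ComNzRing.on compl.

Definition pic (f : net) : compl := \pi_compl f.
Fact pic_zmod : zmod_morphism pic.
Proof. exact: (rmorphB (\pi_{ideal_quot nullI} : {rmorphism net -> {ideal_quot nullI}})). Qed.
Fact pic_monoid : monoid_morphism pic.
Proof.
by split; [exact: (rmorph1 (\pi_{ideal_quot nullI} : {rmorphism net -> {ideal_quot nullI}}))
  | exact: (rmorphM (\pi_{ideal_quot nullI} : {rmorphism net -> {ideal_quot nullI}}))].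
Qed.
HB.instance Definition _ := GRing.isZmodMorphism.Build net compl pic pic_zmod.
HB.instance Definition _ := GRing.isMonoidMorphism.Build net compl pic pic_monoid.
Lemma picP x : exists f, x = pic f. Proof. by exists (repr x); rewrite /pic reprK. Qed.
Lemma pic_eq f g : pic f = pic g <-> null (val (f - g)).
Proof.
split=> [/eqP|h]; first by rewrite -Quotient.idealrBE => /asboolP.
by apply/eqP; rewrite -Quotient.idealrBE; apply/asboolP.
Qed.


Lemma pic_eq0 f : pic f = 0 <-> null (val f).
Proof. by rewrite -(rmorph0 pic) pic_eq subr0. Qed.

Definition netc (a : F) : net := exist _ (fun _ => a) (asboolT (cauchy_cst a)).

(** If the net is not eventually beyond c, an approximation a of it within c has value at most v c,
    so the net eventually has the value of a. *)
Lemma non_null f : cauchy f -> ~ null f -> exists2 a, a != 0 & evt (fun e => a <v f e - a).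
Proof.
move=> cf nf; have [c [c0 hc]] : exists c, c != 0 /\ ~ evt (fun e => c <v f e).
  apply: contrapT => h; apply: nf => c c0; apply: contrapT => hc; apply: h.
  by exists c.
have [a ha] := cf c c0; have ac : a <=v c.
  rewrite levNgt; apply/negP => h; apply: hc; apply: evt_sub ha => e h'.
  by rewrite -(subrK a (f e)) ltvD.
exists a; first by apply: contraTneq ac => ->; rewrite lev0r.
by apply: evt_sub ha => e; apply: lev_lt_trans.
Qed.

Lemma compl_inv_ex (x : compl) : exists y : compl, (x != 0 -> y * x = 1) /\ (x = 0 -> y = 0).
Proof.
have [->|x0] := eqVneq x 0; first by exists 0; split.
have [f ef] := picP x; have [|a a0 ha] := non_null (netP f).
  by move=> h; case/eqP: x0; rewrite ef; apply/pic_eq0.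
have ha' : evt (fun e => a =v val f e).
  by apply: evt_sub ha => e /eqv_addr; rewrite addrC subrK.
pose g e := (val f e)^-1.
have cg : cauchy g.
  move=> c c0; have [b hb] := netP f (mulf_neq0 c0 (mulf_neq0 a0 a0)).
  have [e0 [he0 h0]] := evt_ex (evt_and ha' hb); exists (g e0).
  apply: evt_sub (evt_and ha' hb) => e [h1 h2].
  have n0 : val f e != 0 by rewrite -(eqv0 h1).
  have n1 : val f e0 != 0 by rewrite -(eqv0 he0).
  have -> : g e - g e0 = ((val f e0 - b) - (val f e - b)) / (val f e * val f e0).
    by rewrite /g; field; rewrite n0 n1.
  rewrite -(mulfK (mulf_neq0 a0 a0) c); apply: ltv_leM; first by rewrite invr_eq0 mulf_neq0.
    exact: ltvB.
  by apply/eqv_le/eqvV/eqvM.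
exists (pic (exist _ g (asboolT cg))); split=> [_|e]; last by rewrite e eqxx in x0.
rewrite ef -rmorphM -(rmorph1 pic); apply/pic_eq => c c0.
apply: evt_sub ha' => e he; have n0 : val f e != 0 by rewrite -(eqv0 he).
have -> : val ((exist _ g (asboolT cg) : net) * f - 1) e = g e * val f e - 1 by [].
by rewrite mulVf // subrr ltvr0.
Qed.

Definition cinv (x : compl) : compl := sval (cid (compl_inv_ex x)).
Fact cinvP x : x != 0 -> cinv x * x = 1.
Proof. by move=> x0; case: (svalP (cid (compl_inv_ex x))) => + _; apply. Qed.
Fact cinv0 : cinv 0 = 0.
Proof. by case: (svalP (cid (compl_inv_ex 0))) => _; apply. Qed.
HB.instance Definition _ := GRing.ComNzRing_isField.Build compl cinvP cinv0.

Definition jc (a : F) : compl := pic (netc a).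
Fact jc_zmod : zmod_morphism jc.
Proof. by move=> a b; rewrite /jc -rmorphB; congr pic; apply/val_inj/funext. Qed.
Fact jc_monoid : monoid_morphism jc.
Proof.
split; first by rewrite -(rmorph1 pic); congr pic; apply/val_inj/funext.
by move=> a b; rewrite /jc -rmorphM; congr pic; apply/val_inj/funext.
Qed.
HB.instance Definition _ := GRing.isZmodMorphism.Build F compl jc jc_zmod.
HB.instance Definition _ := GRing.isMonoidMorphism.Build F compl jc jc_monoid.

Definition complO (x : compl) := exists2 f, x = pic f & evt (fun e => 1 <=v val f e).

Lemma complO_pic f : complO (pic f) <-> evt (fun e => 1 <=v val f e).
Proof.
split=> [[g /pic_eq h hg]|]; last by exists f.
apply: evt_sub (evt_and hg (h 1 (oner_neq0 F))) => e [h1 /ltvW h2].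
have -> : val f e = (val (f - g) e) + val g e by rewrite -[val (f - g) e]/(val f e - val g e) subrK.
exact: levD.
Qed.

Fact complO_vring : valuation_ring complO.
Proof.
split.
- by rewrite -(rmorph0 pic); apply/complO_pic; apply: evtT => e; exact: levr0.
- by rewrite -(rmorph1 pic); apply/complO_pic; apply: evtT => e; exact: lev_refl.
- move=> _ _ [f -> hf] [g -> hg]; rewrite -rmorphB; apply/complO_pic.
  by apply: evt_sub (evt_and hf hg) => e [h1 h2]; exact: levB.
- move=> _ _ [f -> hf] [g -> hg]; rewrite -rmorphM; apply/complO_pic.
  by apply: evt_sub (evt_and hf hg) => e [h1 h2]; exact: lev1M.
move=> x x0; have [f ef] := picP x; have [g eg] := picP x^-1.
have [|a a0 ha] := non_null (netP f).
  by move=> h; case/eqP: x0; rewrite ef; apply/pic_eq0.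
have [h|h] := orP (lev_total O 1 a).
  left; rewrite ef; apply/complO_pic; apply: evt_sub ha => e /eqv_addr.
  by rewrite addrC subrK => /eqv_le; apply: lev_trans.
right; rewrite eg; apply/complO_pic.
have : null (val (g * f - 1)).
  by apply/pic_eq; rewrite rmorphM /= -ef -eg mulVf // rmorph1.
move/(_ 1 (oner_neq0 F)) => h1; apply: evt_sub (evt_and ha h1) => e [h2 h3].
have h4 : 1 =v val g e * val f e.
  have := eqv_addr h3; rewrite -[val (g * f - 1) e]/(val g e * val f e - 1).
  by rewrite addrC subrK.
have h5 : val f e <=v 1.
  by apply: lev_trans h; have := eqv_addr h2; rewrite addrC subrK => /eqv_ge.
have f0 : val f e != 0 by apply: contraTneq h5 => ->; rewrite lev0r oner_neq0.
by rewrite -(levM2r _ _ _ f0) mul1r; apply: lev_trans h5 (eqv_le h4).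
Qed.
Definition complV : vring compl := VRing complO_vring.

Lemma complV_jc a : complO (jc a) <-> O a.
Proof.
rewrite complO_pic -lev1; split=> [/evt_ex[] //|h].
exact: evtT.
Qed.

Lemma lev_jc a b : lev complV (jc a) (jc b) = (a <=v b).
Proof.
apply/asboolP/asboolP => -[].
- by move/eqP; rewrite fmorph_eq0 => /eqP ->; left.
- rewrite -fmorph_div => -[/eqP]; rewrite fmorph_eq0 => /eqP a0 /complV_jc h.
  by right.
- by move=> ->; left; rewrite rmorph0.
move=> [/eqP a0 h]; right; split; first by apply/eqP; rewrite fmorph_eq0.
by rewrite -fmorph_div; apply/complV_jc.
Qed.

Lemma ltv_jc_pic a f : a != 0 -> evt (fun e => a <v val f e) -> ltv complV (jc a) (pic f).
Proof.
move=> a0 hf; apply/negP => /levP[_ [g -> hg]]; rewrite -rmorphM => /pic_eq/(_ a a0) h.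
have [e [[h1 h2] h3]] := evt_ex (evt_and (evt_and hf hg) h).
have : a <v val f e * val g e by apply: ltvMr.
rewrite -[val (netc a - f * g) e]/(a - val f e * val g e) in h3.
by rewrite -(eqv_ltr _ (eqv_sub h3)) ltvv.
Qed.

Lemma compl_value (x : compl) : x != 0 -> exists2 a, a != 0 & eqv complV (jc a) x.
Proof.
move=> x0; have [f ef] := picP x; have [|a a0 ha] := non_null (netP f).
  by move=> h; case/eqP: x0; rewrite ef; apply/pic_eq0.
exists a => //; have : ltv complV (jc a) (pic (f - netc a)) by exact: ltv_jc_pic.
by rewrite rmorphB /= -ef => /eqv_addr; rewrite addrC subrK.
Qed.

Lemma compl_dense (x c : compl) : c != 0 -> exists s, ltv complV c (x - jc s).
Proof.
move=> c0; have [a a0 ha] := compl_value c0; have [f ef] := picP x.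
have [s hs] := netP f a0; exists s; rewrite -(eqv_ltl _ ha) ef /jc -rmorphB.
exact: ltv_jc_pic.
Qed.

(** For each index a, choose s a in F within a of a set of the filter. These choices form a Cauchy
    net whose class is the limit. *)
Lemma compl_complete : vcomplete complO.
Proof.
move=> Fl [FT F0 FI FS] Fc.
have near (a : nzT F) : exists s, Fl (fun y => ltv complV (jc (val a)) (y - jc s)).
  have a0 : jc (val a) != 0 by rewrite fmorph_eq0; exact: (valP a).
  have [A [FA hA]] := Fc _ a0; have [x Ax] : exists x, A x.
    by apply: contrapT => h; apply: F0; apply: FS FA => x Ax; apply: h; exists x.
  have [s hs] := compl_dense x a0; exists s; apply: FS FA => y Ay.
  have -> : y - jc s = (y - x) + (x - jc s) by ring.
  by apply: ltvD => //; apply/(vltP complV)/hA.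
have [s hs] := choice near.
have sd (c e : nzT F) : val c <=v val e -> val c <v s e - s c.
  move=> ce; have := FI _ _ (hs c) (hs e) => h.
  have [y [h1 h2]] : exists y, ltv complV (jc (val c)) (y - jc (s c)) /\
      ltv complV (jc (val e)) (y - jc (s e)).
    by apply: contrapT => h'; apply: F0; apply: FS h => y hy; apply: h'; exists y.
  rewrite /ltv -lev_jc -/(ltv _ _ _) rmorphB.
  have -> : jc (s e) - jc (s c) = (y - jc (s c)) - (y - jc (s e)) by ring.
  by apply: ltvB => //; apply: lev_lt_trans h2; rewrite lev_jc.
have cs : cauchy s.
  by move=> c c0; exists (s (exist _ c c0)); exists (exist _ c c0) => e; apply: sd.
exists (pic (exist _ s (asboolT cs))) => c c0; have [a a0 ha] := compl_value c0.
pose a' : nzT F := exist _ a a0.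
apply: FS (hs a') => y hy; apply/(vltP complV); rewrite -(eqv_ltl _ ha).
set l := pic _; have -> : y - l = (y - jc (s a')) - (l - jc (s a')) by ring.
apply: ltvB => //; rewrite /l /jc -rmorphB; apply: ltv_jc_pic => //.
by exists a' => e; apply: sd.
Qed.

End Nets.

(** * The ideals p O + c M *)

Section PthRoots.
Variables (F : fieldType) (O : vring F).
Local Notation "x <=v y" := (lev O x y).
Local Notation "x <v y" := (ltv O x y).

Lemma lev_subXX n x y : 1 <=v x -> 1 <=v y -> x - y <=v x ^+ n - y ^+ n.
Proof.
move=> hx hy; rewrite subrXX; apply: levMr; last exact: lev_refl.
by apply: lev_sum => i _; apply: lev1M; exact: lev1X.
Qed.

(* The ideal p O + c M, M the maximal ideal of O. *)
Definition rI (p : nat) (c x : F) := (p%:R <=v x) || (c <v x).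

Lemma rI_le p c x y : x <=v y -> rI p c x -> rI p c y.
Proof.
move=> h /orP[h1|h1]; first by rewrite /rI (lev_trans h1 h).
by rewrite /rI (ltv_le_trans h1 h) orbT.
Qed.
Lemma rID p c x y : rI p c x -> rI p c y -> rI p c (x + y).
Proof.
move=> hx hy; have [h|h] := orP (lev_total O x y).
  by apply: rI_le hx; apply: levD => //; exact: lev_refl.
by apply: rI_le hy; apply: levD => //; exact: lev_refl.
Qed.
Lemma rI0 p c : rI p c 0. Proof. by rewrite /rI levr0. Qed.
Lemma rIp p c x : p%:R <=v x -> rI p c x. Proof. by rewrite /rI => ->. Qed.
Lemma rIN p c x : rI p c (- x) = rI p c x. Proof. by rewrite /rI levN ltvN. Qed.
Lemma rIB p c x y : rI p c x -> rI p c y -> rI p c (x - y).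
Proof. by move=> h1 h2; apply: rID; rewrite ?rIN. Qed.
Lemma rIM p c x y : 1 <=v y -> rI p c x -> rI p c (x * y).
Proof. by move=> h; apply: rI_le; apply: levMr => //; exact: lev_refl. Qed.
Lemma rI_sum p c (I : Type) (r : seq I) (P : pred I) (G : I -> F) :
  (forall i, P i -> rI p c (G i)) -> rI p c (\sum_(i <- r | P i) G i).
Proof. by move=> h; elim/big_ind: _ => // [|x y]; [exact: rI0 | exact: rID]. Qed.
Lemma rI_lec p c c' x : c <=v c' -> rI p c' x -> rI p c x.
Proof. by move=> h /orP[h1|h1]; rewrite /rI ?h1 // (lev_lt_trans h h1) orbT. Qed.

(** Stands for (DRvr) inside the field. For p nonzero in F and in S, the case c = p implies all
    others and is the congruence modulo p; for p = 0 it says that p-th powers approximate every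
    integral element arbitrarily well. *)
Definition root_cond (p : nat) (S : {pred F}) := forall c a,
  c \in S -> c != 0 -> a \in S -> 1 <=v a -> exists2 b, b \in S & rI p c (a - b ^+ p).
End PthRoots.

(** * The condition (DRvr) without the completion *)

Section DRvr.
Variables (L : fieldType) (O : vring L) (S : sfield L) (SP : L -> Prop).
Hypothesis SPE : forall x, SP x <-> x \in S.
Local Notation "x <=v y" := (lev O x y).
Local Notation "x <v y" := (ltv O x y).

Fact vsub_vring : valuation_ring (fun x : subF S => O (val x)).
Proof.
split.
- by rewrite rmorph0; exact: vO0.
- by rewrite rmorph1; exact: vO1.
- by move=> x y; rewrite rmorphB; exact: vOB.
- by move=> x y; rewrite rmorphM; exact: vOM.
by move=> x x0; rewrite fmorphV; apply: vOV; rewrite fmorph_eq0.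
Qed.
Definition vsub := VRing vsub_vring.

Definition jS (x : L) : compl vsub := if insub x is Some u then jc vsub u else 0.

Lemma jSE (x : L) (xS : x \in S) : jS x = jc vsub (Sub x xS).
Proof. by rewrite /jS insubT. Qed.

(** Existence of a completion is what allows (DRvr), a statement about all completions, to be
    instantiated. *)
Lemma compl_is_completion : is_completion O SP (complO (O := vsub)) jS.
Proof.
split; first exact: complO_vring.
split; first by rewrite (jSE (rpred1 S)) -(rmorph1 (jc vsub)); congr jc; apply: val_inj.
split.
  move=> x y /SPE xS /SPE yS; rewrite (jSE (rpredD xS yS)) (jSE xS) (jSE yS) -rmorphD.
  by congr jc; apply: val_inj.
split.
  move=> x y /SPE xS /SPE yS; rewrite (jSE (rpredM xS yS)) (jSE xS) (jSE yS) -rmorphM.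
  by congr jc; apply: val_inj.
split; first by move=> x /SPE xS; rewrite (jSE xS) complV_jc.
split; last exact: compl_complete.
move=> e c c0; have [s hs] := compl_dense e c0.
exists (val s); split; first by apply/SPE; exact: (valP s).
have -> : jS (val s) = jc vsub s by rewrite (jSE (valP s)); congr jc; exact: val_inj.
exact/(vltP (complV vsub)).
Qed.


Section Completion.
Variables (E : fieldType) (OE : vring E) (j : L -> E).
Hypothesis hj : is_completion O SP OE j.
Local Notation "x <=w y" := (lev OE x y) (at level 70).
Local Notation "x <w y" := (ltv OE x y) (at level 70).

Let j1 : j 1 = 1. Proof. by case: hj => _ []. Qed.
Let jD x y : x \in S -> y \in S -> j (x + y) = j x + j y.
Proof. by case: hj => _ [_ [h _]] /SPE xS /SPE; exact: h. Qed.
Let jM x y : x \in S -> y \in S -> j (x * y) = j x * j y.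
Proof. by case: hj => _ [_ [_ [h _]]] /SPE xS /SPE; exact: h. Qed.
Let jO x : x \in S -> (1 <=w j x) = (1 <=v x).
Proof.
case: hj => _ [_ [_ [_ [h _]]]] /SPE /h e.
by apply/idP/idP => /lev1 h1; apply/lev1/e.
Qed.
Let j_dense e c : c != 0 -> exists2 s, s \in S & c <w e - j s.
Proof.
case: hj => _ [_ [_ [_ [_ [h _]]]]] c0; have [s [/SPE sS hs]] := h e c c0.
by exists s => //; apply/vltP.
Qed.
Let j0 : j 0 = 0.
Proof. by apply: (addrI (j 0)); rewrite -jD ?rpred0 // !addr0. Qed.
Let jB x y : x \in S -> y \in S -> j (x - y) = j x - j y.
Proof.
move=> xS yS; apply: (addIr (j y)); rewrite -jD ?rpredB // !subrK //.
Qed.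
Let jX x n : x \in S -> j (x ^+ n) = j x ^+ n.
Proof. by move=> xS; elim: n => // n IH; rewrite !exprS jM ?rpredX // IH. Qed.
Let jn n : j n%:R = n%:R.
Proof. by elim: n => // n IH; rewrite -addn1 !natrD jD ?rpred_nat // IH j1. Qed.
Let j_neq0 x : x \in S -> x != 0 -> j x != 0.
Proof.
move=> xS x0; apply: contraNneq (oner_neq0 E) => e.
by rewrite -j1 -(mulfV x0) jM ?rpredV // e mul0r.
Qed.
Let jV x : x \in S -> x != 0 -> j x^-1 = (j x)^-1.
Proof.
move=> xS x0; apply: (mulfI (j_neq0 xS x0)); rewrite -jM ?rpredV //.
by rewrite !mulfV ?j_neq0.
Qed.
Let lev_j x y : x \in S -> y \in S -> (j x <=w j y) = (x <=v y).
Proof.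
move=> xS yS; have [->|x0] := eqVneq x 0.
  rewrite j0 !lev0r; have [->|y0] := eqVneq y 0; first by rewrite j0 eqxx.
  by apply/negbTE/j_neq0.
have jx0 := j_neq0 xS x0.
rewrite -[j x]mulr1 -(divfK jx0 (j y)) [_ / _ * _]mulrC levM2l // -jV //.
rewrite -jM ?rpredV // jO ?rpredM ?rpredV //.
by rewrite -[x in RHS]mulr1 -{2}(divfK x0 y) [_ / _ * _]mulrC levM2l.
Qed.
Let ltv_j x y : x \in S -> y \in S -> (j x <w j y) = (x <v y).
Proof. by move=> xS yS; rewrite /ltv lev_j. Qed.

Let jrI p c x : c \in S -> x \in S -> rI OE p (j c) (j x) = rI O p c x.
Proof. by move=> cS xS; rewrite /rI -jn lev_j ?ltv_j // rpred_nat. Qed.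

Let approx1 e c : 1 <=w e -> c != 0 -> exists s, [/\ s \in S, 1 <=v s, 1 <=w j s & c <w e - j s].
Proof.
move=> he c0; have [c1 [c10 h1 hc]] : exists c1, [/\ c1 != 0, 1 <=w c1 & c <=w c1].
  have [h|h] := orP (lev_total OE 1 c); first by exists c; rewrite lev_refl.
  by exists 1; rewrite lev_refl oner_neq0.
have [s sS hs] := j_dense e c10; exists s.
have js : 1 <=w j s.
  by rewrite -[j s](subKr e); apply: levB => //; exact: lev_trans h1 (ltvW hs).
by rewrite -jO //; split=> //; exact: lev_lt_trans hs.
Qed.

(** Replacing a root in E by an element of S closer than c changes its p-th power only by an element
    of c M. *)
Lemma completion_root_cond p : (0 < p)%N ->
  (forall a, OE a -> exists b, OE b /\ exists d, OE d /\ a - b ^+ p = p%:R * d) ->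
  root_cond O p S.
Proof.
move=> p0 h c a cS c0 aS a1.
have [|b [/lev1 b1 [d [/lev1 d1 e]]]] := h (j a); first by apply/lev1; rewrite jO.
have [s [sS s1 js1 hs]] := approx1 b1 (j_neq0 cS c0).
exists s => //; rewrite -jrI ?rpredB ?rpredX // jB ?rpredX // jX //.
have -> : j a - j s ^+ p = (j a - b ^+ p) + (b ^+ p - j s ^+ p) by ring.
apply: rID; first by apply: rIp; rewrite e levMr // lev_refl.
by rewrite /rI (ltv_le_trans hs) ?orbT // lev_subXX.
Qed.

(** If p is nonzero in E, the choice c = p solves the congruence. In characteristic p, v(x^p - y^p)
    = p v(x - y), so approximate roots of a form a Cauchy filter, and its limit is an exact root. *)
Lemma root_cond_completion p : prime p -> root_cond O p S ->
  forall a, OE a -> exists b, OE b /\ exists d, OE d /\ a - b ^+ p = p%:R * d.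
Proof.
move=> pp h a /lev1 a1; have p0 := prime_gt0 pp.
have near c : c != 0 -> exists2 b, 1 <=w b & rI OE p c (a - b ^+ p).
  move=> c0; have [s0 s0S hs0] := j_dense c c0; have es0 := eqv_sub hs0.
  have s00 : s0 != 0.
    by apply/eqP => e; move: (eqv0 es0); rewrite e j0 eqxx (negbTE c0).
  have [s [sS s1 js1 hs]] := approx1 a1 c0.
  (* The bound c1 has nonnegative value, which forces the root b to be integral. *)
  have [c1 [c1S c10 h1 hc]] : exists c1, [/\ c1 \in S, c1 != 0, 1 <=v c1 & s0 <=v c1].
    have [h1|h1] := orP (lev_total O 1 s0); first by exists s0; rewrite lev_refl.
    by exists 1; rewrite lev_refl oner_neq0 rpred1.
  have [b bS hb] := h c1 s c1S c10 sS s1; exists (j b).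
    rewrite jO // -(levX_iff _ _ _ p0) expr1n -[b ^+ p](subKr s).
    apply: levB => //; case/orP: hb => [|/ltvW]; first exact/lev_trans/lev1_nat.
    exact: lev_trans.
  have -> : a - j b ^+ p = (a - j s) + (j s - j b ^+ p) by ring.
  apply: rID; first by rewrite /rI hs orbT.
  rewrite -jX // -jB ?rpredX //.
  apply: (@rI_lec _ _ _ _ (j c1)); last by rewrite jrI ?rpredB ?rpredX.
  by rewrite (eqv_lel _ es0) lev_j.
have [pe0|pe0] := eqVneq (p%:R : E) 0; last first.
  have [b b1 hb] := near _ pe0; exists b; split; first exact/lev1.
  have : p%:R <=w a - b ^+ p by case/orP: hb => // /ltvW.
  by case/levP => d Od ed; exists d.
have chE : p \in [pchar E] by rewrite inE pp pe0 eqxx.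
have frB (x y : E) : (x - y) ^+ p = x ^+ p - y ^+ p.
  by rewrite -!(pFrobenius_autE chE) rmorphB.
have near0 c : c != 0 -> exists b, c <w a - b ^+ p.
  move=> c0; have [b _ /orP[|hb]] := near c c0; last by exists b.
  by rewrite pe0 lev0r => /eqP e; exists b; rewrite e ltvr0.
pose Fl (A : E -> Prop) := exists2 c, c != 0 & forall b, c <w a - b ^+ p -> A b.
have Ff : is_filter Fl.
  split.
  - by exists 1 => //; exact: oner_neq0.
  - by case=> c /near0[b hb] /(_ b hb).
  - move=> A B [c c0 hA] [c' c'0 hB]; have [hc|hc] := orP (lev_total OE c c').
      by exists c' => // b hb; split; [apply: hA; exact: lev_lt_trans hb | exact: hB].
    by exists c => // b hb; split; [exact: hA | apply: hB; exact: lev_lt_trans hb].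
  - by move=> A B AB [c c0 hA]; exists c => // b /hA/AB.
have Fc : vcauchy OE Fl.
  move=> c c0; exists (fun b => c ^+ p <w a - b ^+ p); split.
    by exists (c ^+ p) => //; rewrite expf_neq0.
  move=> x y hx hy; apply/vltP; rewrite -(ltvX_iff _ _ _ p0) frB.
  have -> : x ^+ p - y ^+ p = (a - y ^+ p) - (a - x ^+ p) by ring.
  exact: ltvB.
have [l hl] : exists l, vconverges OE Fl l.
  by case: hj => _ [_ [_ [_ [_ [_ hc]]]]]; exact: hc.
have el : a = l ^+ p.
  apply/eqP; rewrite -subr_eq0; apply: contraT => c0; set c := a - _ in c0.
  have [c1 [c10 h1 hc]] : exists c1, [/\ c1 != 0, 1 <=w c1 & c <=w c1].
    have [h1|h1] := orP (lev_total OE 1 c); first by exists c; rewrite lev_refl.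
    by exists 1; rewrite lev_refl oner_neq0.
  have [c2 c20 h2] := hl c1 c10.
  have [c3 [c30 h3 h4]] : exists c3, [/\ c3 != 0, c <=w c3 & c2 <=w c3].
    have [h3|h3] := orP (lev_total OE c c2); first by exists c2; rewrite lev_refl.
    by exists c; rewrite lev_refl.
  have [b hb] := near0 c3 c30.
  have /vltP hbl := h2 b (lev_lt_trans h4 hb).
  suff : c <w c by rewrite ltvv.
  have {2}-> : c = (a - b ^+ p) + (b - l) ^+ p by rewrite /c frB; ring.
  apply: ltvD; first exact: lev_lt_trans hb.
  apply: lev_lt_trans hc _; apply: (@lev_lt_trans _ _ (c1 ^+ p)); last exact: ltvX.
  by rewrite -(prednK p0) exprS levMr ?lev_refl // lev1X.
exists l; split; first by apply/lev1; rewrite -(levX_iff _ _ _ p0) expr1n -el.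
by exists 0; split; [exact: vO0 | rewrite el subrr mulr0].
Qed.

End Completion.

Lemma DRvr_root : DRvr O SP <-> forall p, residue_char O p -> root_cond O p S.
Proof.
split=> h p hp; have pp : prime p by case: hp.
  apply: (@completion_root_cond _ (complV vsub) jS); first exact: compl_is_completion.
    exact: prime_gt0.
  exact: h compl_is_completion.
move=> E OE j hj; have [hOE _] := hj.
exact: (@root_cond_completion E (VRing hOE) j hj p pp (h p hp)).
Qed.

End DRvr.

(** * Conjugates over a subfield and their values *)

Definition fixing (L : fieldType) (S : sfield L) (s : {rmorphism L -> L}) :=
  bijective s /\ {in S, s =1 id}.

Lemma polyOver_fixing (L : fieldType) (S : sfield L) (s : {rmorphism L -> L}) (P : {poly L}) :
  {in S, s =1 id} -> P \is a polyOver S -> map_poly s P = P.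
Proof. by move=> sS /polyOverP PS; apply/polyP => i; rewrite coef_map; exact: sS. Qed.

Lemma root_fixing (L : fieldType) (S : sfield L) (s : {rmorphism L -> L}) (P : {poly L}) x :
  {in S, s =1 id} -> P \is a polyOver S -> root P x -> root P (s x).
Proof.
by move=> sS PS /rootP e; apply/rootP; rewrite -(polyOver_fixing sS PS) horner_map e rmorph0.
Qed.

Section TopSet.
Variables (F : fieldType) (O : vring F).
Local Notation "x <=v y" := (lev O x y).
Local Notation "x <v y" := (ltv O x y).

Lemma prod_ltv (s t : seq F) : size s = size t -> s != [::] ->
  {in s & t, forall x y, x <v y} -> \prod_(x <- s) x <v \prod_(y <- t) y.
Proof.
elim: s t => [|x s IH] [|y t] //= [est] _ h; rewrite !big_cons.
have xy : x <v y by apply: h; rewrite mem_head.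
have [s0|s0] := eqVneq s [::].
  by move: est; rewrite s0 => /esym/size0nil ->; rewrite !big_nil !mulr1.
have lt : \prod_(i <- s) i <v \prod_(i <- t) i.
  by apply: IH => // u v us vt; apply: h; rewrite inE ?us ?vt orbT.
by apply: ltv_leM => //; [exact: ltv_neq0 lt | exact: ltvW].
Qed.

(** The automorphism sends the top roots to equally many roots. Each image outside the top set has
    smaller value than any top root it displaces, so the product is unchanged or drops strictly in
    value. *)
Lemma topset_conj (s : {rmorphism F -> F}) (rs : seq F) (T : pred F) :
  uniq rs -> {in rs, forall r, s r \in rs} -> 0 \notin rs ->
  {in rs &, forall r w, ~~ T r -> T w -> r <v w} ->
  let y := \prod_(r <- rs | T r) r in s y = y \/ s y <v y.
Proof.
move=> urs srs rs0 hT; rewrite -big_filter; set A := filter T rs.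
move=> y; have -> : s y = \prod_(r <- map s A) r.
  by rewrite /y rmorph_prod big_map.
set B := map s A.
have uA : uniq A by rewrite filter_uniq.
have uB : uniq B by rewrite (map_inj_uniq (fmorph_inj s)).
have BA b : b \in B -> b \in rs.
  by case/mapP => r; rewrite mem_filter => /andP[_ /srs hr] ->.
have eA := perm_big _ (permEl (perm_filterC (mem B) A)) : _ = \prod_(i <- A) i.
have eB := perm_big _ (permEl (perm_filterC (mem A) B)) : _ = \prod_(i <- B) i.
have eAB : perm_eq (filter (mem B) A) (filter (mem A) B).
  apply: uniq_perm; rewrite ?filter_uniq // => x.
  by rewrite [LHS]mem_filter [RHS]mem_filter andbC.
have esz : size (filter (predC (mem A)) B) = size (filter (predC (mem B)) A).
  apply/eqP; rewrite -(eqn_add2l (size (filter (mem B) A))).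
  rewrite {1}(perm_size eAB) !size_filter !count_predC.
  by rewrite /B size_map.
rewrite /y -eA -eB !big_cat /= (perm_big _ eAB) /=.
have [e|ne] := eqVneq (filter (predC (mem A)) B) [::].
  by left; move: esz; rewrite e => /esym/size0nil ->.
right; rewrite ltvM2l; last first.
  rewrite big_filter prodf_seq_neq0; apply/allP => x xB; apply/implyP => _.
  by apply: contraNneq rs0 => <-; exact: BA.
apply: prod_ltv => // u w; rewrite mem_filter => /andP[uA' uB'].
rewrite mem_filter => /andP[_]; rewrite mem_filter => /andP[Tw wrs].
apply: hT => //; first exact: BA.
by move: uA'; rewrite inE /= mem_filter (BA _ uB') andbT.
Qed.

End TopSet.

Section Conjugates.
Variables (K : fieldType) (L : closedFieldType) (iota : {rmorphism K -> L}).
Hypothesis algL : algebraic_over iota.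
Variable (O : vring L) (S : sfield L).
Hypothesis KS : forall a, iota a \in S.
Local Notation "x <=v y" := (lev O x y).
Local Notation "x <v y" := (ltv O x y).
Local Notation "x =v y" := (eqv O x y).
Local Notation sepK := (separable_over iota).

Lemma polyOver_iota (P : {poly K}) : map_poly iota P \is a polyOver S.
Proof. by apply/polyOverP => i; rewrite coef_map; exact: KS. Qed.

Lemma algS x : alg_over S x.
Proof.
have [P [P0 rP]] := algL x; exists (map_poly iota P) => //.
by split; [rewrite map_poly_eq0 | exact: polyOver_iota].
Qed.

(* The roots of the minimal polynomial are the conjugates under [fixing S]. *)
Lemma conj_seq x : sepK x -> exists rs : seq L,
  [/\ uniq rs, is_minpoly S x (\prod_(r <- rs) ('X - r%:P)), x \in rs &
   forall r, r \in rs <-> exists2 s, fixing S s & s x = r].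
Proof.
move=> [P [P0 sP rP]]; have [h hh] := exists_minpoly (algS x).
have [hm hS rh hmin] := hh.
have [rs ers] := closed_field_poly_normal h.
rewrite (monicP hm) scale1r in ers; rewrite ers in hh hm hS rh hmin.
exists rs; split=> //.
- rewrite -separable_prod_XsubC; apply: dvdp_separable (hmin _ (polyOver_iota P) rP) _.
  by rewrite separable_map.
- by rewrite -root_prod_XsubC.
move=> r; rewrite -root_prod_XsubC; split=> [rr|[s [bs sS] <-]].
  by have [s [bs sS sx]] := extend_aut algS hh rr; exists s.
exact: root_fixing sS hS rh.
Qed.

Lemma fixed_in x : sepK x -> (forall s, fixing S s -> s x = x) -> x \in S.
Proof.
move=> /conj_seq[rs [urs [hm hS rh _] xrs hrs]] hx.
have e : rs = [:: x].
  have {}hrs r : r \in rs -> r = x by move/hrs => [s /hx -> ->].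
  case: rs urs {hm hS rh} xrs hrs => [//|r [|r' rs]] /=.
    by rewrite inE => _ /eqP <-.
  move=> /andP[]; rewrite inE negb_or => /andP[/eqP ne _] _ _ h; case: ne.
  transitivity x; [apply: h | apply/esym/h]; by rewrite !inE eqxx ?orbT.
move: hS; rewrite e big_seq1 => /polyOverP/(_ 0%N).
by rewrite coefB coefX coefC sub0r rpredN.
Qed.

(** The witness is the trace of y^-1: all conjugates other than y^-1 itself have larger value. *)
Lemma dominant_conj y : sepK y -> y != 0 ->
  (forall s, fixing S s -> s y = y \/ s y <v y) ->
  exists2 a, a \in S & y^-1 <v a - y^-1.
Proof.
move=> sy y0 hy; have [rs [urs [hm hS rh _] yrs hrs]] := conj_seq (separable_overV algL sy).
exists (\sum_(r <- rs) r).
  have := polyOverP hS (size rs).-1; rewrite coefPn_prod_XsubC ?rpredN //.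
  by case: (rs) yrs.
rewrite (bigD1_seq _ yrs urs) /= addrAC subrr add0r -big_filter big_seq.
apply: ltv_sum => [|r]; first by rewrite invr_eq0.
rewrite mem_filter => /andP[ny /hrs[s fs er]]; have [_ sS] := fs.
rewrite -er fmorphV in ny *; have [e|] := hy s fs; first by rewrite e eqxx in ny.
by rewrite /ltv levV // fmorph_eq0.
Qed.

End Conjugates.

Lemma polyOver_divmod (F : fieldType) (A : subringClosed F) (f P : {poly F}) :
  f \is monic -> f \is a polyOver A -> P \is a polyOver A ->
  P %/ f \is a polyOver A /\ P %% f \is a polyOver A.
Proof.
move=> fm fA PA.
suff [q [r [qA rA eP sr]]] : exists q r, [/\ q \is a polyOver A, r \is a polyOver A,
    P = q * f + r & (size r < size f)%N].
  by rewrite eP divp_addl_mul_small // modp_addl_mul_small.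
have [n] := ubnP (size P); elim: n => // n IH in P PA *; rewrite ltnS => sP.
have [h|h] := ltnP (size P) (size f); first by exists 0, P; rewrite rpred0 mul0r add0r.
have f0 := monic_neq0 fm.
have P0 : P != 0.
  by rewrite -size_poly_gt0; apply: leq_trans h; rewrite size_poly_gt0.
pose k := (size P - size f)%N; pose Q : {poly F} := (lead_coef P)%:P * 'X^k.
have QA : Q \is a polyOver A.
  by rewrite rpredM // ?polyOverC ?rpredX ?polyOverX // (polyOverP PA).
have lQ : lead_coef Q = lead_coef P by rewrite lead_coef_Mmonic ?monicXn // lead_coefC.
have Q0 : Q != 0 by rewrite -lead_coef_eq0 lQ lead_coef_eq0.
have sQf : size (Q * f) = size P.
  rewrite size_mul // size_Mmonic ?monicXn ?polyC_eq0 ?lead_coef_eq0 //.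
  rewrite size_polyC lead_coef_eq0 P0 size_polyXn /k /=.
  by rewrite subnK.
have lt : (size (P - Q * f)%R < size P)%N.
  rewrite [X in (_ < X)%N]polySpred //; apply: leq_ltn_trans (_ : (size P).-1 < _)%N => //.
  apply/leq_sizeP => i hi; rewrite coefB.
  have [e|ne] := eqVneq i (size P).-1.
    rewrite e -lead_coefE -[in X in _ - X]sQf -lead_coefE lead_coefM lQ (monicP fm) mulr1.
    by rewrite subrr.
  have {}hi : (size P <= i)%N by rewrite (polySpred P0) ltn_neqAle eq_sym ne.
  by rewrite !nth_default ?subrr // sQf.
have [||q [r [qA rA e sr]]] := IH (P - Q * f); first by rewrite rpredB // rpredM.
  by apply: leq_trans lt sP.
exists (q + Q), r; split=> //; first exact: rpredD.
by rewrite mulrDl addrAC -e subrK.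
Qed.

(** * Simple extensions and integral elements *)

Section Adjoin.
Variables (L : fieldType) (S : sfield L) (b : L).
Hypothesis algb : alg_over S b.

Definition adj_pred : {pred L} :=
  fun x => `[< exists2 P : {poly L}, P \is a polyOver S & x = P.[b] >].
Lemma adjP x : reflect (exists2 P : {poly L}, P \is a polyOver S & x = P.[b]) (x \in adj_pred).
Proof. exact: asboolP. Qed.

Fact adj_closed : divring_closed adj_pred.
Proof.
have M x y : x \in adj_pred -> y \in adj_pred -> x * y \in adj_pred.
  by move=> /adjP[P PS ->] /adjP[Q QS ->]; apply/adjP; exists (P * Q); [exact: rpredM | rewrite hornerM].
split=> [|x y /adjP[P PS ->] /adjP[Q QS ->]|x y xA yA].
- by apply/adjP; exists 1; [exact: rpred1 | rewrite hornerC].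
- by apply/adjP; exists (P - Q); [exact: rpredB | rewrite hornerD hornerN].
apply: M => //; have /adjP[P PS ey] := yA; have [e0|y0] := eqVneq y 0.
  by rewrite e0 invr0 -e0.
have [P0 eP0] := polyOver_lift PS.
have [|h [hm rh hmin]] := @ex_minpoly _ _ (val : {rmorphism subF S -> L}) b.
  have [Q [Q0 QS] rQ] := algb; have [Q1 eQ] := polyOver_lift QS.
  by exists Q1; [apply: contraNneq Q0 => e; rewrite -eQ e rmorph0 | rewrite eQ].
have [|u [v e]] := minpoly_inv (P := P0) hm rh hmin; first by rewrite eP0 rootE -ey.
apply/adjP; exists (map_poly val v); first exact: polyOver_val.
apply: (mulIf y0); rewrite mulVf // ey -eP0 -hornerM -rmorphM.
have := congr1 (fun R => (map_poly (val : {rmorphism subF S -> L}) R).[b]) e.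
by rewrite rmorphD rmorph1 hornerD hornerC (rmorphM _ u) hornerM (rootP rh) mulr0 add0r => ->.
Qed.
Definition adjoin : sfield L := SField adj_closed.

Lemma sub_adjoin x : x \in S -> x \in adjoin.
Proof. by move=> xS; apply/adjP; exists x%:P; rewrite ?polyOverC ?hornerC. Qed.
Lemma mem_adjoin : b \in adjoin.
Proof. by apply/adjP; exists 'X; rewrite ?polyOverX ?hornerX. Qed.
End Adjoin.

Section IntegralPart.
Variables (L : fieldType) (O : vring L).
Fact intp_closed (S : sfield L) : subring_closed [pred x | (x \in S) && lev O 1 x].
Proof.
split=> [|x y|x y]; rewrite !inE.
- by rewrite rpred1 lev_refl.
- by case/andP => xS hx /andP[yS hy]; rewrite rpredB ?levB.
- by case/andP => xS hx /andP[yS hy]; rewrite rpredM ?lev1M.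
Qed.
Definition intp S : sring L := SRing (intp_closed S).
Fact intO_closed : subring_closed [pred x | lev O 1 x].
Proof.
split=> [|x y hx hy|x y hx hy]; first exact: (lev_refl O 1).
  exact: (levB hx hy).
exact: (lev1M hx hy).
Qed.
Definition intO : sring L := SRing intO_closed.

Lemma intpP S x : (x \in intp S) = (x \in S) && lev O 1 x. Proof. by []. Qed.
Lemma polyOver_intp (S : sfield L) (P : {poly L}) :
  P \is a polyOver S -> P \is a polyOver intO -> P \is a polyOver (intp S).
Proof.
move=> /polyOverP h1 /polyOverP h2; apply/polyOverP => i; rewrite intpP h1.
exact: h2.
Qed.
Lemma polyOver_intpS (S : sfield L) (P : {poly L}) : P \is a polyOver (intp S) -> P \is a polyOver S.
Proof. by apply: polyOverS => x /andP[]. Qed.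
Lemma lev1_horner (S : sfield L) (P : {poly L}) x :
  P \is a polyOver (intp S) -> lev O 1 x -> lev O 1 P.[x].
Proof.
move=> /polyOverP h hx; rewrite horner_coef; apply: lev_sum => i _.
by apply: lev1M; [case/andP: (h i) | exact: lev1X].
Qed.
End IntegralPart.

(** * Extensions generated by a Hensel root *)

Section Henselian.
Variables (K : fieldType) (L : closedFieldType) (iota : {rmorphism K -> L}).
Hypothesis algL : algebraic_over iota.
Variable (O : vring L) (S : sfield L).
Hypothesis KS : forall a, iota a \in S.
Local Notation "x <=v y" := (lev O x y).
Local Notation "x <v y" := (ltv O x y).
Local Notation "x =v y" := (eqv O x y).
Local Notation sepK := (separable_over iota).
Hypothesis Ssep : forall x, x \in S -> sepK x.

Lemma sep_prod (rs : seq L) (P : pred L) : (forall r, r \in rs -> sepK r) ->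
  sepK (\prod_(r <- rs | P r) r).
Proof.
move=> h; rewrite big_seq_cond; elim/big_ind: _ => [|x y|r /andP[/h]//].
  by rewrite -(rmorph1 iota); exact: separable_overC.
exact: separable_overM.
Qed.

Lemma sep_conj (s : {rmorphism L -> L}) x : fixing S s -> sepK x -> sepK (s x).
Proof.
move=> [_ sS] [P [P0 sP rP]]; exists P; split=> //.
by apply: root_fixing sS _ rP; exact: polyOver_iota.
Qed.

(** The product of the conjugates of value at least v z and that of the conjugates of value above v
    z differ by the factor z alone; [dominant_conj] gives both the value of an element of S. *)
Lemma isolated_value z : sepK z -> z != 0 ->
  (forall s, fixing S s -> s z = z \/ ~~ (s z =v z)) ->
  exists2 a, a \in S & a =v z.
Proof.
move=> sz z0 hz; have [zs [uzs [hm hS rh _] zzs hzs]] := conj_seq algL KS sz.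
have zs0 : 0 \notin zs.
  by apply/negP => /hzs[s [_ sS] /eqP]; rewrite fmorph_eq0 (negbTE z0).
have szs s : fixing S s -> {in zs, forall r, s r \in zs}.
  move=> [_ sS] r; rewrite -!root_prod_XsubC; exact: root_fixing sS hS.
have seps r : r \in zs -> sepK r by move/hzs => [s fs <-]; exact: sep_conj.
have val_top T : {in zs &, forall r w, ~~ T r -> T w -> r <v w} ->
    exists2 a, a \in S & a =v (\prod_(r <- zs | T r) r)^-1.
  move=> hT; set y := \prod_(r <- zs | T r) r.
  have y0 : y != 0.
    rewrite prodf_seq_neq0; apply/allP => r rz; apply/implyP => _.
    by apply: contraNneq zs0 => <-.
  have [||a aS ha] := dominant_conj (O := O) algL KS (y := y) _ y0.
  - exact: sep_prod.
  - by move=> s fs; apply: topset_conj => //; exact: szs.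
  by exists a => //; rewrite eqv_sym; have := eqv_addr ha; rewrite addrC subrK.
have [|a1 a1S h1] := val_top (fun r => z <=v r).
  by move=> r w _ _ /=; rewrite -ltvNge; exact: ltv_le_trans.
have [|a2 a2S h2] := val_top (fun r => z <v r).
  by move=> r w _ _ /=; rewrite -levNgt; exact: lev_lt_trans.
exists (a2 / a1); first by rewrite rpredM ?rpredV.
have e : \prod_(r <- zs | z <=v r) r = z * \prod_(r <- zs | z <v r) r.
  transitivity (\prod_(r <- z :: filter (fun r => z <v r) zs) r); last first.
    by rewrite big_cons big_filter.
  rewrite -big_filter; apply: perm_big.
  apply: uniq_perm; first by rewrite filter_uniq.
    by rewrite /= mem_filter ltvv filter_uniq.
  move=> r; rewrite inE !mem_filter; case: (boolP (r \in zs)) => rz; last first.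
    by rewrite !andbF orbF; apply/esym; apply: contraNF rz => /eqP ->.
  rewrite !andbT; have /hzs[s fs <-] := rz.
  have [->|h] := hz s fs; first by rewrite eqxx lev_refl.
  have ne : s z != z by apply: contraNneq h => ->; exact: eqv_refl.
  rewrite (negbTE ne) /=; apply/idP/idP => [h'|/ltvW//].
  by rewrite ltvNge; apply: contra h => h''; rewrite /eqv h''.
set y2 := \prod_(r <- zs | z <v r) r in h2 e.
have y20 : y2 != 0.
  rewrite prodf_seq_neq0; apply/allP => r rz; apply/implyP => _.
  by apply: contraNneq zs0 => <-.
have := eqvM h2 (eqvV h1); rewrite e invrK mulrCA mulVf // mulr1.
by [].
Qed.

Lemma eventually_isolated b x (xs : seq L) : b != 0 -> x != 0 -> 1 <v b ->
  exists m0, forall m, (m0 <= m)%N -> forall r, r \in xs -> ~~ (b ^+ m * x =v r).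
Proof.
move=> b0 x0 hb; elim: xs => [|r xs [m0 h0]]; first by exists 0%N.
have [[m1 e1]|ne] := lem (exists m1, b ^+ m1 * x =v r).
  exists (maxn m0 m1.+1) => m; rewrite geq_max => /andP[hm0 hm1] r'.
  rewrite inE => /predU1P[->|]; last exact: h0.
  apply/negP => e2; have : b ^+ m1 * x =v b ^+ m * x.
    by apply: eqv_trans e1 _; rewrite eqv_sym.
  rewrite eqvM2r // => h; suff : b ^+ m1 <v b ^+ m by move/ltv_eqv; rewrite h.
  rewrite -(subnKC hm1) addSnnS exprD -{1}[b ^+ m1]mulr1 ltvM2l ?expf_neq0 //.
  by rewrite -(expr1n _ (m - m1.+1).+1) ltvX.
exists m0 => m hm r'; rewrite inE => /predU1P[->|]; last exact: h0.
by apply/negP => e; apply: ne; exists m.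
Qed.

(** Iterates of X^2 + X, used to build 1 + [pseq k x]: for suitable k it is a unit at the integral
    conjugates of x, and at the others its value is at most that of the conjugate. *)
Fixpoint pseq k (x : L) := if k is k'.+1 then pseq k' x ^+ 2 + pseq k' x else x.

Lemma pseq_morph (s : {rmorphism L -> L}) k x : s (pseq k x) = pseq k (s x).
Proof. by elim: k => //= k IH; rewrite rmorphD rmorphXn IH. Qed.
Lemma pseq_in (T : sfield L) k x : x \in T -> pseq k x \in T.
Proof. by move=> xT; elim: k => //= k IH; rewrite rpredD ?rpredX. Qed.
Lemma pseq_int k x : 1 <=v x -> 1 <=v pseq k x.
Proof. by move=> h; elim: k => //= k IH; rewrite levD ?lev1X. Qed.
Lemma pseq_neg k x : x <v 1 -> pseq k x <=v x.
Proof.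
move=> h; elim: k => [|k IH] /=; first exact: lev_refl.
have lt : pseq k x <v 1 := lev_lt_trans IH h.
have : pseq k x ^+ 2 <v pseq k x.
  by rewrite expr2 -[X in _ <v X]mulr1 ltvM2l ?(ltv_neq0 lt).
move=> h2; apply: lev_trans IH; rewrite -(eqv_lel _ (eqv_addr h2)).
exact: ltvW.
Qed.

(** If 1 + y is in M for some iterate y, the next iterate y (1 + y) and all later ones are in M, and
    adding 1 gives units. If this never happens, 1 + y is always a unit. *)
Lemma pseq_unit (rs : seq L) : exists k0, forall k, (k0 <= k)%N ->
  forall r, r \in rs -> 1 <=v r -> 1 =v 1 + pseq k r.
Proof.
elim: rs => [|r rs [k0 h0]]; first by exists 0%N.
have [[k1 h1]|ne] := lem (exists k1, 1 <v 1 + pseq k1 r).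
  exists (maxn k0 k1.+1) => k; rewrite geq_max => /andP[hk0 hk1] r'.
  rewrite inE => /predU1P[-> hr|]; last exact: h0.
  apply: eqv_addr; rewrite -(subnKC hk1); elim: (k - k1.+1)%N => [|j IH].
    rewrite addn0 /=; have -> : pseq k1 r ^+ 2 + pseq k1 r = (1 + pseq k1 r) * pseq k1 r by ring.
    by apply: ltvMr => //; exact: pseq_int.
  by rewrite addnS; apply: ltvD => //; rewrite expr2 ltvMr // ltvW.
exists k0 => k hk r'; rewrite inE => /predU1P[-> hr|]; last exact: h0.
rewrite /eqv levD ?lev_refl ?pseq_int //= levNgt; apply/negP => h.
by apply: ne; exists k.
Qed.

(** The residue 0 of b is a simple root of its reduced minimal polynomial over S: the situation of
    Hensel's lemma. *)
Variable b : L.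
Hypotheses (sb : sepK b) (hb : 1 <v b)
  (hconj : forall s, fixing S s -> s b = b \/ 1 =v s b).
Let algb : alg_over S b := algS algL KS b.
Let Sb := adjoin algb.

Lemma adjoin_fix (s : {rmorphism L -> L}) x :
  {in S, s =1 id} -> s b = b -> x \in Sb -> s x = x.
Proof.
move=> sS sbb /adjP[P PS ->].
by rewrite -horner_map sbb (polyOver_fixing sS PS).
Qed.

Lemma adjoin_sep x : x \in Sb -> sepK x.
Proof.
move=> /adjP[P /polyOverP PS ->]; rewrite horner_coef.
have s0 : sepK 0 by rewrite -(rmorph0 iota); exact: separable_overC.
elim/big_ind: _ => [//|x1 y h1 h2|i _].
  rewrite -[y]opprK -[- y]sub0r; apply: separable_overB => //; exact: separable_overB.
apply: separable_overM => //; first exact: Ssep.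
elim: (nat_of_ord i) => [|n IH]; first by rewrite expr0 -(rmorph1 iota); exact: separable_overC.
by rewrite exprS; exact: separable_overM.
Qed.

(** An automorphism over S that fixes b fixes x; any other makes b a unit, so sends b^m x to an
    element with the value of a conjugate of x. For large m, v(b^m x) avoids these finitely many
    values, and [isolated_value] applies to b^m x as well as to b. *)
Lemma henselian_value x : x \in Sb -> x != 0 -> exists2 a, a \in S & a =v x.
Proof.
move=> xSb x0; have sx := adjoin_sep xSb.
have [b0|b0] := eqVneq b 0.
  exists x; last exact: eqv_refl.
  case/adjP: xSb => P /polyOverP PS ->; rewrite b0 horner_coef0; exact: PS.
have [|a aS ha] := isolated_value sb b0.
  move=> s /hconj[|h]; [by left | right].
  by apply: contraTN hb => /(eqv_trans h)/eqv_ge; rewrite levNgt.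
have [xs [_ _ _ hxs]] := conj_seq algL KS sx.
have [m /(_ m (leqnn m)) hm] := eventually_isolated xs b0 x0 hb.
have zb : b ^+ m * x \in Sb by rewrite rpredM ?rpredX ?mem_adjoin.
have z0 : b ^+ m * x != 0 by rewrite mulf_neq0 ?expf_neq0.
have [|a' a'S ha'] := isolated_value (adjoin_sep zb) z0.
  move=> s fs; have [_ sS] := fs; have [e|e] := hconj fs.
    by left; apply: adjoin_fix.
  right; rewrite rmorphM rmorphXn; have sxx : s x \in xs by apply/hxs; exists s.
  apply: contra (hm _ sxx) => h; rewrite eqv_sym; apply: eqv_trans h.
  by rewrite -{1}[s x]mul1r eqvM ?eqv_refl // eqv1X.
exists (a' / a ^+ m); first by rewrite rpredM ?rpredV ?rpredX.
rewrite -[x](mulKf (expf_neq0 m b0)) mulrC; apply: eqvM => //.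
by apply/eqvV/eqvX.
Qed.


Definition cof (rs : seq L) (r : L) : {poly L} := \prod_(r' <- rem r rs) ('X - r'%:P).

Lemma cofE rs r : r \in rs -> \prod_(r' <- rs) ('X - r'%:P) = ('X - r%:P) * cof rs r.
Proof. by move=> h; rewrite (perm_big _ (perm_to_rem h)) big_cons. Qed.

Lemma deriv_cof rs r : r \in rs ->
  (\prod_(r' <- rs) ('X - r'%:P))^`().[r] = (cof rs r).[r].
Proof.
by move=> /cofE ->; rewrite derivM derivXsubC mul1r hornerD hornerM hornerXsubC subrr mul0r addr0.
Qed.

Lemma polyOver_prodX (rs : seq L) : {in rs, forall r, 1 <=v r} ->
  \prod_(r <- rs) ('X - r%:P) \is a polyOver (intO O).
Proof.
move=> h; rewrite big_seq; apply: rpred_prod => r /h hr.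
by rewrite polyOverXsubC.
Qed.

Lemma henselian_minpoly : exists rs : seq L, let f := \prod_(r <- rs) ('X - r%:P) in
  [/\ uniq rs, is_minpoly S b f, (forall r, r \in rs -> 1 <=v r) /\
      f \is a polyOver (intp O S), 1 =v f^`().[b] &
      forall r, r \in rs <-> exists2 s, fixing S s & s b = r].
Proof.
have [rs [urs hf brs hrs]] := conj_seq algL KS sb.
have hr r : r \in rs -> r = b \/ 1 =v r.
  by move/hrs => [s /hconj[->|h] <-]; [left | right].
have rs1 r : r \in rs -> 1 <=v r.
  by move/hr => [->|/eqv_le//]; exact: ltvW.
exists rs; split=> //.
  by split=> //; apply: polyOver_intp; [case: hf | exact: polyOver_prodX].
rewrite deriv_cof // /cof horner_prod; apply: eqv1_prod => r.
rewrite mem_rem_uniq // inE => /andP[ne /hr[e|h]]; first by rewrite e eqxx in ne.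
rewrite hornerXsubC -opprB eqvN; apply: (eqv_trans h).
by apply: eqv_addr; rewrite ltvN -(eqv_ltl _ h).
Qed.

Section Dedekind.
Variable rs : seq L.
Let f := \prod_(r <- rs) ('X - r%:P).
Hypotheses (urs : uniq rs) (hf : is_minpoly S b f) (rs1 : forall r, r \in rs -> 1 <=v r)
  (hrs : forall r, r \in rs <-> exists2 s, fixing S s & s b = r).

(** Lagrange interpolation: the sum of W(r) f / (X - r) over the conjugates r of b takes the value w
    f'(b) at b, with integral coefficients. They lie in S since this sum is the remainder of W f'
    modulo f. *)
Lemma dedekind w : w \in Sb -> (forall s, fixing S s -> 1 <=v s w) ->
  exists2 P, P \is a polyOver (intp O S) & P.[b] = w * f^`().[b].
Proof.
move=> /adjP[W WS eW] hw; have [fm fS rf fmin] := hf.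
have [_ PS] := polyOver_divmod fm fS (rpredM WS (polyOver_deriv fS)).
set P := _ %% _ in PS.
have Pr r : r \in rs -> P.[r] = W.[r] * f^`().[r].
  move=> hr; have fr : f.[r] = 0 by apply/rootP; rewrite root_prod_XsubC.
  by rewrite -hornerM (divp_eq (W * f^`()) f) hornerD hornerM fr mulr0 add0r.
have brs : b \in rs by rewrite -root_prod_XsubC.
exists P; last by rewrite Pr // eW.
pose Q := \sum_(r <- rs) W.[r] *: cof rs r.
have Qr r : r \in rs -> Q.[r] = W.[r] * f^`().[r].
  move=> hr; rewrite /Q (bigD1_seq r) //= hornerD hornerZ deriv_cof //.
  rewrite horner_sum big_seq_cond big1 ?addr0 // => r' /andP[hr' ne].
  rewrite hornerZ /cof horner_prod (big_rem r) /=; last by rewrite mem_rem_uniq // inE eq_sym ne.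
  by rewrite hornerXsubC subrr mul0r mulr0.
have sf : size f = (size rs).+1 by rewrite size_prod_XsubC.
have eP : P = Q.
  apply/eqP; rewrite -subr_eq0; apply/eqP.
  apply: (@roots_geq_poly_eq0 _ _ rs) => //.
    by apply/allP => r hr; rewrite rootE hornerD hornerN Pr // Qr // subrr.
  apply: leq_trans (size_polyD _ _) _; rewrite size_polyN geq_max; apply/andP; split.
    by rewrite -ltnS -sf ltn_modp monic_neq0.
  rewrite /Q big_seq; elim/big_ind: _ => [|u v hu hv|r hr]; first by rewrite size_poly0.
    by apply: leq_trans (size_polyD _ _) _; rewrite geq_max hu.
  apply: leq_trans (size_scale_leq _ _) _; rewrite /cof size_prod_XsubC size_rem //.
  by rewrite prednK //; case: (rs) hr.
apply: polyOver_intp => //; rewrite eP /Q big_seq; apply: rpred_sum => r hr.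
rewrite -mul_polyC; apply: rpredM; last first.
  by apply: polyOver_prodX => r' /mem_rem/rs1.
rewrite polyOverC; have /hrs[s fs <-] := hr; have [_ sS] := fs.
have -> : W.[s b] = s w by rewrite eW -horner_map (polyOver_fixing sS WS).
exact: hw.
Qed.
End Dedekind.

(** The unit q = 1 + [pseq k x] makes all conjugates of 1/q and x/q integral. Then [dedekind] writes
    f'(b)/q and f'(b) x/q as integral polynomials at b, and x is their quotient. *)
Lemma henselian_frac x : x \in Sb -> 1 <=v x ->
  exists P g, [/\ P \is a polyOver (intp O S), g \is a polyOver (intp O S),
    1 =v g.[b] & x = P.[b] / g.[b]].
Proof.
move=> xSb hx; have [rs [urs hf [rs1 fA] fb hrs]] := henselian_minpoly.
set f := \prod_(r <- rs) _ in hf fA fb.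
have [xs [_ _ xxs hxs]] := conj_seq algL KS (adjoin_sep xSb).
have [k /(_ k (leqnn k)) hk] := pseq_unit xs.
pose q := 1 + pseq k x.
have hq : 1 =v q by exact: hk.
have qSb : q \in Sb by rewrite rpredD ?rpred1 ?pseq_in.
have sq s : fixing S s -> (1 =v s q /\ 1 <=v s x) \/ (s q <=v s x /\ s q <v 1).
  move=> fs; have sxx : s x \in xs by apply/hxs; exists s.
  have eq : s q = 1 + pseq k (s x) by rewrite rmorphD rmorph1 pseq_morph.
  have [h|h] := boolP (1 <=v s x); first by left; rewrite eq hk.
  right; have h2 := pseq_neg k h; have h3 := lev_lt_trans h2 h.
  rewrite eq addrC -(eqv_lel _ (eqv_addr h3)) -(eqv_ltl _ (eqv_addr h3)).
  by rewrite h2 h3.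
have q0 s : fixing S s -> s q != 0.
  by move=> _; rewrite fmorph_eq0 (eqv1_neq0 hq).
have [||g gA eg] := dedekind urs hf rs1 hrs (w := q^-1); first by rewrite rpredV.
  move=> s fs; rewrite fmorphV -[1]invr1 levV ?oner_neq0 ?q0 //.
  by case: (sq s fs) => [[/eqv_ge]|[_ /ltvW]].
have [||P PA eP] := dedekind urs hf rs1 hrs (w := x / q); first by rewrite rpredM ?rpredV.
  move=> s fs; rewrite fmorph_div -(levM2r _ _ _ (q0 s fs)) mul1r divfK ?q0 //.
  case: (sq s fs) => [[h1 h2]|[]//].
  by rewrite -(eqv_lel _ h1).
have f0 : f^`().[b] != 0 by apply: eqv1_neq0 fb.
exists P, g; split=> //; first by rewrite eg; apply: eqv1M => //; exact: eqv1V.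
by rewrite eP eg; field; rewrite f0 (eqv1_neq0 hq).
Qed.

End Henselian.

(** * Arithmetic of p-th powers modulo p O + c M *)

Lemma polyOver_liftR (L : fieldType) (A : sring L) (P : {poly L}) :
  P \is a polyOver A -> exists Q : {poly subR A}, map_poly val Q = P.
Proof.
move=> /polyOverP hP; exists (\poly_(i < size P) (insubd (0 : subR A) P`_i)).
apply/polyP => i; rewrite coef_map coef_poly; case: ltnP => hi /=.
  by rewrite val_insubd hP.
by rewrite nth_default.
Qed.

Lemma map_etale_rel (R R' : comNzRingType) (g : {rmorphism R -> R'}) (f U W : {poly R}) m n :
  map_poly g ('X * f^`() ^+ n - (U \Po 'X^m) - f * W) =
  'X * (map_poly g f)^`() ^+ n - (map_poly g U \Po 'X^m) - map_poly g f * map_poly g W.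
Proof.
by rewrite !rmorphB !rmorphM rmorphXn /= map_comp_poly -deriv_map map_polyX map_polyXn.
Qed.

Lemma map_frob_rel (R R' : comNzRingType) (g : {rmorphism R -> R'}) (G P Q : {poly R}) a s n :
  map_poly g (a%:P * G ^+ n - P ^+ n - s%:P * Q) =
  (g a)%:P * map_poly g G ^+ n - map_poly g P ^+ n - (g s)%:P * map_poly g Q.
Proof. by rewrite !rmorphB !rmorphM !rmorphXn /= !map_polyC. Qed.

Lemma map_deriv_rel (R R' : comNzRingType) (g : {rmorphism R -> R'}) (f G : {poly R}) n :
  map_poly g (f^`() ^+ n * G) = (map_poly g f)^`() ^+ n * map_poly g G.
Proof. by rewrite rmorphM rmorphXn /= deriv_map. Qed.

Section RootIn.
Variables (F : fieldType) (O : vring F) (p : nat) (c : F) (T : sfield F).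
Hypotheses (pp : prime p) (c1 : lev O 1 c).
Local Notation "x <=v y" := (lev O x y).
Local Notation "x <v y" := (ltv O x y).
Local Notation "x =v y" := (eqv O x y).
Local Notation I := (rI O p c).
Let p0 := prime_gt0 pp.

Lemma rI_int x : I x -> 1 <=v x.
Proof.
by case/orP => [|/ltvW]; [exact/lev_trans/lev1_nat | exact: lev_trans].
Qed.

Definition pth (x : F) := exists2 y, y \in T & I (x - y ^+ p).

Lemma pth_int x y : 1 <=v x -> I (x - y ^+ p) -> 1 <=v y.
Proof.
move=> hx /rI_int h; rewrite -(levX_iff _ _ _ p0) expr1n -[y ^+ p](subKr x).
exact: levB.
Qed.

Lemma pthX y : y \in T -> pth (y ^+ p).
Proof. by move=> yT; exists y => //; rewrite subrr rI0. Qed.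
Lemma pth_pert x x' : I (x - x') -> pth x -> pth x'.
Proof.
move=> h [y yT hy]; exists y => //.
have -> : x' - y ^+ p = (x - y ^+ p) - (x - x') by ring.
exact: rIB.
Qed.
Lemma pthD x x' : 1 <=v x -> 1 <=v x' -> pth x -> pth x' -> pth (x + x').
Proof.
move=> hx hx' [y yT hy] [y' yT' hy']; exists (y + y'); first exact: rpredD.
have -> : x + x' - (y + y') ^+ p = (x - y ^+ p) + (x' - y' ^+ p) -
   ((y + y') ^+ p - (y ^+ p + y' ^+ p)) by ring.
apply: rIB; first exact: rID.
by apply: rIp; apply: lev_powsum => //; [exact: pth_int hx hy | exact: pth_int hx' hy'].
Qed.
Lemma pthM x x' : 1 <=v x -> 1 <=v x' -> pth x -> pth x' -> pth (x * x').
Proof.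
move=> hx hx' [y yT hy] [y' yT' hy']; exists (y * y'); first exact: rpredM.
have -> : x * x' - (y * y') ^+ p = (x - y ^+ p) * x' + (x' - y' ^+ p) * y ^+ p.
  by rewrite exprMn; ring.
by apply: rID; apply: rIM => //; apply: lev1X; exact: pth_int hx hy.
Qed.
Lemma pth_div x u : u \in T -> 1 =v u -> pth x -> pth (x / u ^+ p).
Proof.
move=> uT hu [y yT hy]; exists (y / u); first by rewrite rpredM ?rpredV.
have -> : x / u ^+ p - (y / u) ^+ p = (x - y ^+ p) * (u ^- p) by rewrite expr_div_n; ring.
by apply: rIM => //; exact/eqv_le/eqv1V/eqv1X.
Qed.
Lemma pth0 : pth 0.
Proof. by exists 0; rewrite ?rpred0 // expr0n gtn_eqF // subrr rI0. Qed.
Lemma pth_sum (J : Type) (r : seq J) (G : J -> F) : (forall i, 1 <=v G i) ->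
  (forall i, pth (G i)) -> pth (\sum_(i <- r) G i).
Proof.
move=> h1 h2; suff : 1 <=v \sum_(i <- r) G i /\ pth (\sum_(i <- r) G i) by case.
elim/big_ind: _ => // [|x y [hx px] [hy py]]; first by rewrite levr0; split=> //; exact: pth0.
by split; [exact: levD | exact: pthD].
Qed.
Lemma pthXn n x : 1 <=v x -> pth x -> pth (x ^+ n).
Proof.
move=> hx px; elim: n => [|n IH]; last by rewrite exprS; apply: pthM => //; exact: lev1X.
by rewrite expr0 -(expr1n _ p); apply: pthX; exact: rpred1.
Qed.
End RootIn.

(** * Roots modulo p O + c M along a Hensel root *)

Section HenselianRoots.
Variables (K : fieldType) (L : closedFieldType) (iota : {rmorphism K -> L}).
Hypothesis algL : algebraic_over iota.
Variable (O : vring L) (S : sfield L).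
Hypothesis KS : forall a, iota a \in S.
Local Notation "x <=v y" := (lev O x y).
Local Notation "x <v y" := (ltv O x y).
Local Notation "x =v y" := (eqv O x y).
Local Notation sepK := (separable_over iota).
Hypothesis Ssep : forall x, x \in S -> sepK x.
Variable b : L.
Hypotheses (sb : sepK b) (hb : 1 <v b)
  (hconj : forall s, fixing S s -> s b = b \/ 1 =v s b).
Local Notation Sb := (adjoin (algS algL KS b)).
Variables (p : nat) (c : L).
Hypotheses (pp : prime p) (hp : 1 <v p%:R) (c1 : 1 <=v c).
Local Notation I := (rI O p c).
Let A := intp O S.

(** The quotient of A by this ideal has characteristic p, which makes the relative Frobenius
    available. It need not be a domain. *)
Definition resI : {pred subR A} := fun a => I (val a).
Fact resI_ideal : idealr_closed resI.
Proof.
split.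
- by rewrite unfold_in /resI rmorph0 rI0.
- rewrite unfold_in /resI rmorph1 /rI negb_or; apply/andP; split; first by [].
  by rewrite ltvNge negbK.
move=> a u v hu hv; rewrite unfold_in /resI rmorphD rmorphM; apply: rID => //.
by rewrite mulrC; apply: rIM => //; case/andP: (valP a).
Qed.
HB.instance Definition _ := isIdealr.Build (subR A) resI resI_ideal.
Let A' := {ideal_quot resI}.
Let pq : {rmorphism subR A -> A'} := (\pi_{ideal_quot resI})%qT.

Lemma pq_eq0 x : pq x = 0 <-> I (val x).
Proof.
split=> [|h].
  by rewrite -(rmorph0 pq) => /eqP; rewrite -Quotient.idealrBE subr0.
by rewrite -(rmorph0 pq); apply/eqP; rewrite -Quotient.idealrBE subr0.
Qed.

Lemma chA' : p \in [pchar A'].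
Proof.
rewrite inE pp /=; apply/eqP; rewrite -(rmorph_nat pq); apply/pq_eq0.
by rewrite rmorph_nat; apply: rIp; exact: lev_refl.
Qed.


Let va : {rmorphism subR A -> L} := val.

Lemma pq_poly0 (Z : {poly subR A}) x : map_poly pq Z = 0 -> 1 <=v x ->
  I (map_poly va Z).[x].
Proof.
move=> e hx; rewrite horner_coef; apply: rI_sum => i _; apply: rIM; first exact: lev1X.
rewrite coef_map; apply/pq_eq0; have := congr1 (fun P : {poly A'} => P`_i) e.
by rewrite /= coef_map coef0.
Qed.

Lemma pq_poly_lift (P : {poly A'}) : exists Q : {poly subR A}, map_poly pq Q = P.
Proof.
exists (\poly_(i < size P) (repr P`_i)); apply/polyP => i; rewrite coef_map coef_poly.
by case: ltnP => h; [exact: reprK | rewrite nth_default //; exact: rmorph0].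
Qed.

(** By [etale_surj], b f'(b)^(p k) is congruent to U(b^p) with U over A. The coefficients of U have
    p-th roots modulo the ideal, hence so do U(b^p) and, f'(b) being a unit, b itself;
    [henselian_frac] reaches all integral elements. *)
Lemma henselian_pth_up : (forall a, a \in S -> 1 <=v a -> pth O p c S a) ->
  forall x, x \in Sb -> 1 <=v x -> pth O p c Sb x.
Proof.
move=> hS x xSb hx; have p0 := prime_gt0 pp.
have hb1 := ltvW hb.
have bSb : b \in Sb by exact: mem_adjoin.
have inS a : a \in S -> 1 <=v a -> pth O p c Sb a.
  by move=> aS /(hS _ aS)[y yS hy]; exists y => //; exact: sub_adjoin.
have hornA (P : {poly L}) z : P \is a polyOver A -> 1 <=v z -> pth O p c Sb z ->
    pth O p c Sb P.[z].
  move=> /polyOverP PA hz pz; rewrite horner_coef.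
  have Pi i : P`_i \in S /\ 1 <=v P`_i by apply/andP; exact: PA.
  apply: pth_sum => // i; first by apply: lev1M; [case: (Pi i) | exact: lev1X].
  apply: pthM => //; [by case: (Pi i) | exact: lev1X | | exact: pthXn].
  by apply: inS; case: (Pi i).
have [rs [urs hf [rs1 fA] fb hrs]] := henselian_minpoly algL KS sb hb hconj.
set f := \prod_(r <- rs) _ in hf fA fb; have [fm fS rf fmin] := hf.
have [f0 ef0] := polyOver_liftR fA.
have f1m : map_poly pq f0 \is monic.
  apply: monic_map; rewrite monicE; apply/eqP/val_inj; rewrite rmorph1.
  have : lead_coef (map_poly va f0) = 1 by rewrite ef0; apply/monicP.
  by rewrite !lead_coefE size_map_inj_poly ?coef_map ?rmorph0 //; exact: val_inj.
have [k [U1 [W1 e1]]] := etale_surj chA' f1m 'X.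
have [U eU] := pq_poly_lift U1; have [W eW] := pq_poly_lift W1.
pose Z := 'X * f0^`() ^+ (p * k) - (U \Po 'X^p) - f0 * W.
have Z0 : map_poly pq Z = 0.
  rewrite /Z map_etale_rel.
  by rewrite eU eW e1 [X in X - _ - _]addrC addrK subrr.
have u1 := eqv1X k fb.
have fbS : f^`().[b] \in Sb by apply/adjP; exists f^`() => //; exact: polyOver_deriv.
have pb : pth O p c Sb b.
  have h : I (b * f^`().[b] ^+ (p * k) - (map_poly va U).[b ^+ p]).
    have := pq_poly0 Z0 hb1; rewrite /Z map_etale_rel.
    rewrite ef0 !hornerD !hornerN !hornerM horner_exp horner_comp.
    by rewrite hornerX hornerXn (rootP rf) mul0r subr0.
  have eb : b * f^`().[b] ^+ (p * k) / (f^`().[b] ^+ k) ^+ p = b.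
    by rewrite -exprM mulnC mulfK // expf_neq0 // (eqv1_neq0 fb).
  rewrite -[X in pth _ _ _ _ X]eb; apply: pth_div => //; first by rewrite rpredX.
  apply: (@pth_pert _ _ _ _ _ (map_poly va U).[b ^+ p]); first by rewrite -rIN opprB.
  apply: hornA; [|exact: lev1X|exact: pthX].
  by apply/polyOverP => i; rewrite coef_map; exact: (valP U`_i).
have [P [g [PA gA hg ->]]] := henselian_frac Ssep sb hb hconj xSb hx.
(* The denominator is made a p-th power. *)
have -> : P.[b] / g.[b] = (P * g ^+ p.-1).[b] / g.[b] ^+ p.
  rewrite hornerM horner_exp -{2}(prednK p0) exprS.
  by have g0 := eqv1_neq0 hg; field; rewrite g0 expf_neq0.
apply: pth_div => //; first by apply/adjP; exists g => //; exact: polyOver_intpS gA.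
by apply: hornA => //; apply: rpredM => //; exact: rpredX.
Qed.


Lemma va_poly_inj : injective (map_poly va).
Proof.
move=> P Q e; apply/polyP => i; apply: val_inj; rewrite -!(coef_map va).
by rewrite e.
Qed.

Lemma size_va (Q : {poly subR A}) : size (map_poly va Q) = size Q.
Proof. by apply: size_map_inj_poly; [exact: val_inj | exact: rmorph0]. Qed.

(** With x = P(b)/g(b), the polynomial a g^p - P^p is modulo the ideal a polynomial in X^p divisible
    by f. By [etale_inj], after multiplication by a power of f' and reduction modulo f, the
    divisibility becomes a congruence a G_i^p = H_i^p for each pair of coefficients, and some G_i is
    a unit. *)
Lemma henselian_pth_down a : a \in S -> 1 <=v a -> pth O p c Sb a -> pth O p c S a.
Proof.
move=> aS ha [x xSb hx]; have p0 := prime_gt0 pp; have hb1 := ltvW hb.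
have hx1 := pth_int pp c1 ha hx.
have [rs [urs hf [rs1 fA] fb hrs]] := henselian_minpoly algL KS sb hb hconj.
set f := \prod_(r <- rs) _ in hf fA fb; have [fm fS rf fmin] := hf.
have aA : a%:P \is a polyOver A by rewrite polyOverC intpP aS.
(* The error a g(b)^p - P(b)^p has the value of some s in S, which is then in p O + c M. Its
   quotient by s is integral, hence a fraction at b, whose denominator is absorbed into g and P. *)
have [g [P [R [s [[gA PA RA] hg [sA sI] e]]]]] : exists g P R s,
   [/\ [/\ g \is a polyOver A, P \is a polyOver A & R \is a polyOver A], 1 =v g.[b],
       s \in A /\ I s & a * g.[b] ^+ p - P.[b] ^+ p = s * R.[b]].
  have [P [g [PA gA hg ex]]] := henselian_frac Ssep sb hb hconj xSb hx1.
  have g0 := eqv1_neq0 hg.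
  pose y := a * g.[b] ^+ p - P.[b] ^+ p.
  have ey : y = (a - x ^+ p) * g.[b] ^+ p.
    by rewrite /y ex mulrBl expr_div_n divfK ?expf_neq0.
  have Iy : I y by rewrite ey; apply: rIM => //; exact/eqv_le/eqv1X.
  have inSb (Q : {poly L}) : Q \is a polyOver A -> Q.[b] \in Sb.
    by move=> QA; apply/adjP; exists Q => //; exact: polyOver_intpS QA.
  have [y0|y0] := eqVneq y 0.
    exists g, P, 0, 0; rewrite !rpred0 mul0r -/y y0; split=> //; split=> //; exact: rI0.
  have ySb : y \in Sb.
    by rewrite /y rpredB ?rpredM ?rpredX ?inSb //; exact: sub_adjoin.
  have [s sS hs] := henselian_value Ssep sb hb hconj ySb y0.
  have s0 : s != 0 by rewrite (eqv0 hs).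
  have [||R [g2 [RA g2A hg2 eR]]] := @henselian_frac _ _ _ algL O S KS Ssep b sb hb hconj (y / s).
  - by rewrite rpredM ?rpredV //; exact: sub_adjoin.
  - by apply/eqv_le/eqv_divl => //; rewrite eqv_sym.
  have sI : I s by apply: rI_le Iy; exact: eqv_ge.
  exists (g * g2), (P * g2), (R * g2 ^+ p.-1), s; split.
  - by rewrite !rpredM ?rpredX.
  - by rewrite hornerM eqv1M.
  - by rewrite intpP sS (rI_int c1 sI).
  rewrite !hornerM horner_exp !exprMn mulrA -mulrBl -/y.
  have g20 := eqv1_neq0 hg2.
  have -> : y = s * (R.[b] / g2.[b]) by rewrite -eR mulrC divfK.
  by rewrite -(prednK p0) exprS /=; field.
pose Z := a%:P * g ^+ p - P ^+ p - s%:P * R.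
have ZA : Z \is a polyOver A.
  apply: rpredB; last by apply: rpredM => //; rewrite polyOverC.
  by apply: rpredB; [apply: rpredM => //; exact: rpredX | exact: rpredX].
have rZ : root Z b.
  by rewrite rootE !hornerD !hornerN !hornerM !horner_exp !hornerC e subrr.
have fZ : f %| Z by apply: fmin => //; exact: polyOver_intpS ZA.
have [uA _] := polyOver_divmod fm fA ZA.
have eZ : Z = Z %/ f * f by rewrite divpK.
have d1A : f^`() ^+ p.-1 \is a polyOver A by rewrite rpredX // polyOver_deriv.
(* The factor f'^(p-1) is the one required by [etale_inj]. *)
pose G := (f^`() ^+ p.-1 * g) %% f; pose H := (f^`() ^+ p.-1 * P) %% f.
have [qgA GA] := polyOver_divmod fm fA (rpredM d1A gA).
have [qpA HA] := polyOver_divmod fm fA (rpredM d1A PA).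
have eG := divp_eq (f^`() ^+ p.-1 * g) f; have eH := divp_eq (f^`() ^+ p.-1 * P) f.
have sG : (size G < size f)%N by rewrite ltn_modp monic_neq0.
have sH : (size H < size f)%N by rewrite ltn_modp monic_neq0.
rewrite -/G in GA eG; rewrite -/H in HA eH.
have [f0 ef0] := polyOver_liftR fA; have [g0 eg0] := polyOver_liftR gA.
have [P0 eP0] := polyOver_liftR PA; have [R0 eR0] := polyOver_liftR RA.
have [u0 eu0] := polyOver_liftR uA; have [G0 eG0] := polyOver_liftR GA.
have [H0 eH0] := polyOver_liftR HA; have [qg0 eqg0] := polyOver_liftR qgA.
have [qp0 eqp0] := polyOver_liftR qpA.
have aA' : a \in A by rewrite intpP aS.
pose a0 : subR A := Sub a aA'; pose s0 : subR A := Sub s sA.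
have E1 : a0%:P * g0 ^+ p - P0 ^+ p - s0%:P * R0 = u0 * f0.
  by apply: va_poly_inj; rewrite map_frob_rel rmorphM /= ef0 eg0 eP0 eR0 eu0 -eZ.
have E2 : f0^`() ^+ p.-1 * g0 = qg0 * f0 + G0.
  by apply: va_poly_inj; rewrite map_deriv_rel rmorphD rmorphM /= ef0 eg0 eqg0 eG0.
have E3 : f0^`() ^+ p.-1 * P0 = qp0 * f0 + H0.
  by apply: va_poly_inj; rewrite map_deriv_rel rmorphD rmorphM /= ef0 eP0 eqp0 eH0.
have f0m : f0 \is monic.
  rewrite monicE; apply/eqP/val_inj; rewrite rmorph1.
  have : lead_coef (map_poly va f0) = 1 by rewrite ef0; apply/monicP.
  by rewrite !lead_coefE size_map_inj_poly ?coef_map ?rmorph0 //; exact: val_inj.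
have f1m : map_poly pq f0 \is monic by exact: monic_map.
have ps0 : pq s0 = 0 by apply/pq_eq0.
have {}E1 := congr1 (map_poly pq) E1; rewrite map_frob_rel ps0 polyC0 mul0r subr0 rmorphM /= in E1.
have {}E2 := congr1 (map_poly pq) E2; rewrite map_deriv_rel rmorphD rmorphM /= in E2.
have {}E3 := congr1 (map_poly pq) E3; rewrite map_deriv_rel rmorphD rmorphM /= in E3.
set f1 := map_poly pq f0 in E1 E2 E3 f1m; set g1 := map_poly pq g0 in E1 E2.
set P1 := map_poly pq P0 in E1 E3; set G1 := map_poly pq G0 in E2.
set H1 := map_poly pq H0 in E3; set a1 := pq a0 in E1.
pose sg := pFrobenius_aut chA'.
have [V EV] : exists V, map_poly sg f1^`() ^+ p.-1 * (a1%:P * map_poly sg g1 - map_poly sg P1) =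
    map_poly sg f1 * V.
  apply: (@etale_inj _ p chA' f1 f1m _ (map_poly pq u0)).
  by rewrite comp_polyB comp_polyM comp_polyC -!frob_poly E1 mulrC.
have sf1m : map_poly sg f1 \is monic by exact: monic_map.
pose D := a1%:P * map_poly sg G1 - map_poly sg H1.
have ED : D = map_poly sg f1 *
    (V - a1%:P * map_poly sg (map_poly pq qg0) + map_poly sg (map_poly pq qp0)).
  have e2 : map_poly sg f1^`() ^+ p.-1 * map_poly sg g1 =
      map_poly sg (map_poly pq qg0) * map_poly sg f1 + map_poly sg G1.
    by have := congr1 (map_poly sg) E2; rewrite rmorphM rmorphXn rmorphD rmorphM.
  have e3 : map_poly sg f1^`() ^+ p.-1 * map_poly sg P1 =
      map_poly sg (map_poly pq qp0) * map_poly sg f1 + map_poly sg H1.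
    by have := congr1 (map_poly sg) E3; rewrite rmorphM rmorphXn rmorphD rmorphM.
  rewrite /D; apply/eqP; rewrite -subr_eq0; apply/eqP.
  transitivity (a1%:P * (map_poly sg f1^`() ^+ p.-1 * map_poly sg g1) -
     map_poly sg f1^`() ^+ p.-1 * map_poly sg P1 - map_poly sg f1 * V).
    by rewrite e2 e3; ring.
  by rewrite -EV; ring.
have sf1 : size (map_poly sg f1) = size f.
  rewrite -ef0 (size_va f0).
  transitivity (size f1); apply: size_map_poly_id0.
    by rewrite (monicP f1m) /sg pFrobenius_autE expr1n oner_neq0.
  by rewrite (monicP f0m) rmorph1 oner_neq0.
have smap (Q0 : {poly subR A}) (Q : {poly L}) : map_poly va Q0 = Q ->
    (size (map_poly sg (map_poly pq Q0)) <= size Q)%N.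
  move=> <-; rewrite size_va.
  exact: leq_trans (size_poly _ _) (size_poly _ _).
(* D is a multiple of a monic polynomial of larger degree. *)
have D0 : D = 0.
  rewrite ED; set V' := (X in _ * X); have [->|V0] := eqVneq V' 0; first by rewrite mulr0.
  have : (size D < size f)%N.
    apply: leq_ltn_trans (size_polyD _ _) _; rewrite size_polyN gtn_max; apply/andP; split.
      rewrite mul_polyC; apply: leq_ltn_trans (size_scale_leq _ _) _.
      exact: leq_ltn_trans (smap _ _ eG0) sG.
    exact: leq_ltn_trans (smap _ _ eH0) sH.
  rewrite ED -/V' (size_monicM sf1m V0) sf1 ltnNge.
  have : (0 < size V')%N by rewrite size_poly_gt0.
  by case: (size V') => // m _; rewrite addnS /= leq_addr.
have DI i : I (a * G`_i ^+ p - H`_i ^+ p).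
  have : pq (a0 * G0`_i ^+ p - H0`_i ^+ p) = 0.
    rewrite rmorphB rmorphM !rmorphXn; have := congr1 (fun Q : {poly A'} => Q`_i) D0.
    by rewrite /D coefB coefCM !coef_map coef0.
  move/pq_eq0; rewrite rmorphB rmorphM !rmorphXn.
  by rewrite -eG0 -eH0 !coef_map.
(* G(b) = f'(b)^(p-1) g(b) is a unit, so not all coefficients of G are in M. *)
have [i Gi] : exists i, 1 =v G`_i.
  apply: contrapT => hn; have : 1 <v G.[b].
    rewrite horner_coef; apply: ltv_sum => [|i _]; first exact: oner_neq0.
    apply: ltvMr; first exact: lev1X.
    have /andP[_ h] := polyOverP GA i; rewrite ltvNge; apply/negP => h'.
    by apply: hn; exists i; rewrite /eqv h h'.
  have -> : G.[b] = f^`().[b] ^+ p.-1 * g.[b].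
    have := congr1 (fun Q : {poly L} => Q.[b]) eG.
    by rewrite /= hornerD !hornerM horner_exp (rootP rf) mulr0 add0r.
  by rewrite -(eqv_ltr _ (eqv1M (eqv1X p.-1 fb) hg)) ltvv.
have Gi0 := eqv1_neq0 Gi.
have inS (Q : {poly L}) : Q \is a polyOver A -> Q`_i \in S.
  by move=> /polyOverP/(_ i)/andP[].
exists (H`_i / G`_i); first by rewrite rpredM ?rpredV ?inS.
have -> : a - (H`_i / G`_i) ^+ p = (a * G`_i ^+ p - H`_i ^+ p) * (G`_i ^- p).
  by rewrite mulrBl mulfK ?expf_neq0 // expr_div_n.
by apply: rIM => //; exact/eqv_le/eqv1V/eqv1X.
Qed.

End HenselianRoots.

(** * Values divisible by p *)

Section PDiv.
Variables (F : fieldType) (O : vring F) (p : nat).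
Local Notation "x <=v y" := (lev O x y).
Local Notation "x <v y" := (ltv O x y).
Local Notation "x =v y" := (eqv O x y).

(* p-divisibility of the convex subgroup generated by v p (of the whole value
   group if p = 0, since then every nonzero x satisfies x < p ^ 1). *)
Definition pdiv (S : {pred F}) := forall x, x \in S -> x != 0 -> 1 <=v x ->
  (exists n, x <v p%:R ^+ n) -> exists2 y, y \in S & x =v y ^+ p.

(** With u m = k p + 1, the p-th power of y^u / x^k has the value of x^(u m - k p) = x. *)
Lemma coprime_pdiv (S : sfield F) m x y : (0 < m)%N -> coprime m p ->
  x \in S -> x != 0 -> y \in S -> x ^+ m =v y ^+ p ->
  exists2 z, z \in S & x =v z ^+ p.
Proof.
move=> m0 cp xS x0 yS h; have [u v e _] := egcdnP p m0.
exists (y ^+ u / x ^+ v); first by rewrite rpredM ?rpredV ?rpredX.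
have e1 : x = x ^+ (u * m) / x ^+ (v * p).
  by rewrite e (eqP cp) exprD expr1 mulrC mulKf ?expf_neq0.
rewrite {1}e1 expr_div_n -!exprM; apply: eqvM; last exact: eqv_refl.
by rewrite mulnC exprM [(u * p)%N]mulnC [y ^+ _]exprM; exact: eqvX.
Qed.

Lemma lev_powsum_sum (pp : prime p) (n : nat) (G : nat -> F) : (forall i, 1 <=v G i) ->
  p%:R <=v (\sum_(i < n) G i) ^+ p - \sum_(i < n) (G i) ^+ p.
Proof.
move=> h; elim: n => [|n IH].
  by rewrite !big_ord0 expr0n gtn_eqF ?prime_gt0 // subrr levr0.
rewrite !big_ord_recr /=; set s := \sum_(i < n) G i; set t := \sum_(i < n) _.
have -> : (s + G n) ^+ p - (t + G n ^+ p) =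
   ((s + G n) ^+ p - (s ^+ p + G n ^+ p)) + (s ^+ p - t) by ring.
by apply: levD => //; apply: lev_powsum => //; exact: lev_sum.
Qed.
End PDiv.

(** Matrix, acting on rows of coefficients, of the substitution of X^p for X modulo f. *)
Definition frob_mx (F : fieldType) p n (f : {poly F}) : 'M[F]_n :=
  \matrix_(i < n) poly_rV ('X^(p * i) %% f).

Lemma horner_frob_mx (F L : fieldType) (a : {rmorphism F -> L}) p n (f : {poly F}) (b : L) :
  size f = n.+1 -> (map_poly a f).[b] = 0 -> forall u : 'rV[F]_n,
  (map_poly a (rVpoly (u *m frob_mx p n f))).[b] = (map_poly a (rVpoly u)).[b ^+ p].
Proof.
move=> sf rb u; rewrite mulmx_sum_row linear_sum rmorph_sum horner_sum.
rewrite (@horner_coef_wide _ n); last first.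
  by apply: leq_trans (size_poly _ _) (size_poly _ _).
apply: eq_bigr => i _; rewrite rowK linearZ /= poly_rV_K; last first.
  by rewrite -ltnS -sf ltn_modp -size_poly_eq0 sf.
rewrite map_polyZ hornerZ coef_map coef_rVpoly_ord; congr (_ * _).
rewrite map_modp map_polyXn -exprM.
have := congr1 (fun Q : {poly L} => Q.[b]) (divp_eq 'X^(p * i) (map_poly a f)).
by rewrite /= hornerD hornerM rb mulr0 add0r hornerXn => <-.
Qed.

(** * Extensions with orthogonal power bases *)

Section Orthogonal.
Variables (L : fieldType) (O : vring L) (S : sfield L) (b : L).
Hypothesis algb : alg_over S b.
Local Notation "x <=v y" := (lev O x y).
Local Notation "x <v y" := (ltv O x y).
Local Notation "x =v y" := (eqv O x y).
Local Notation Sb := (adjoin algb).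
Variables (p : nat) (n m : nat) (f : {poly L}) (s0 : L).
Hypotheses (pp : prime p) (hp : 1 <v p%:R) (n0 : (0 < n)%N) (b0 : b != 0).
Hypotheses (fm : f \is monic) (fS : f \is a polyOver S) (fb : root f b) (sf : size f = n.+1).
Hypothesis orth1 : forall P, P \is a polyOver S -> (size P <= n)%N ->
  forall i, P.[b] <=v P`_i * b ^+ i.
Hypothesis orth2 : forall P, P \is a polyOver S -> (size P <= n)%N ->
  forall i, P.[b ^+ p] <=v P`_i * b ^+ (p * i).
Hypotheses (m0 : (0 < m)%N) (cpm : coprime m p) (s0S : s0 \in S) (hs0 : b ^+ m =v s0).

Lemma orth_span x : x \in Sb -> exists P,
  [/\ P \is a polyOver S, (size P <= n)%N & x = P.[b]].
Proof.
move=> /adjP[P PS ->]; have [_ QS] := polyOver_divmod fm fS PS.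
exists (P %% f); split=> //; first by rewrite -ltnS -sf ltn_modp monic_neq0.
by rewrite {1}(divp_eq P f) hornerD hornerM (rootP fb) mulr0 add0r.
Qed.

(** The substitution matrix is invertible: a row in its kernel is a polynomial vanishing at b^p, and
    [orth2] makes all its coefficients zero. *)
Lemma orth_span_frob x : x \in Sb -> exists P,
  [/\ P \is a polyOver S, (size P <= n)%N & x = P.[b ^+ p]].
Proof.
move=> /orth_span[P [PS sP ->]].
pose va : {rmorphism subF S -> L} := val.
have [f0 ef0] := polyOver_lift fS; have [P0 eP0] := polyOver_lift PS.
have sf0 : size f0 = n.+1 by rewrite -sf -ef0 size_map_poly.
have f00 : f0 != 0 by rewrite -size_poly_eq0 sf0.
pose B := frob_mx p n f0.
have rb : (map_poly va f0).[b] = 0 by rewrite ef0; apply/rootP.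
have evB := horner_frob_mx p sf0 rb.
have Bu : B \in unitmx.
  rewrite -row_free_unit; apply: inj_row_free => u uB0.
  have e0 : (map_poly va (rVpoly u)).[b ^+ p] = 0.
    by rewrite -evB uB0 linear0 rmorph0 horner0.
  apply/rowP => i; rewrite mxE.
  have := orth2 (polyOver_val (rVpoly u)) _ i; rewrite e0 lev0r.
  rewrite mulf_eq0 expf_eq0 (negbTE b0) andbF orbF coef_map coef_rVpoly_ord fmorph_eq0.
  by move=> h; apply/eqP/h; apply: leq_trans (size_poly _ _) (size_poly _ _).
pose w := poly_rV P0 *m invmx B.
exists (map_poly va (rVpoly w)); split; first exact: polyOver_val.
  by apply: leq_trans (size_poly _ _) (size_poly _ _).
rewrite -evB /w mulmxKV // poly_rV_K ?eP0 //.
by move: sP; rewrite -eP0 size_map_poly.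
Qed.

(** By orthogonality x has the value of one of its terms P_i b^i, whose m-th power has the value of
    P_i^m s0^i. *)
Lemma orth_value x : x \in Sb -> x != 0 -> exists2 a, a \in S & a =v x ^+ m.
Proof.
move=> /orth_span[P [PS sP ex]] x0.
have [i hi] : exists i, P`_i * b ^+ i <=v x.
  apply: contrapT => h; suff : x <v x by rewrite ltvv.
  rewrite {2}ex horner_coef; apply: ltv_sum => // i _.
  by rewrite ltvNge; apply/negP => hi; apply: h; exists i.
have e : x =v P`_i * b ^+ i by rewrite /eqv hi ex orth1.
exists (P`_i ^+ m * s0 ^+ i); first by rewrite rpredM ?rpredX // (polyOverP PS).
rewrite eqv_sym; apply: eqv_trans (eqvX m e) _; rewrite exprMn; apply: eqvM.
  exact: eqv_refl.
by rewrite exprAC; exact: eqvX.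
Qed.

Variable c : L.
Hypothesis c1 : 1 <=v c.

(** Modulo p, x^p is the sum of the P_i^p b^(p i). Orthogonality of the powers of b^p lets the
    congruence with a be read off at the constant term, so P_0 is a root. *)
Lemma orth_pth_down a : a \in S -> 1 <=v a -> pth O p c Sb a -> pth O p c S a.
Proof.
move=> aS ha [x xSb hx]; have hx1 := pth_int pp c1 ha hx.
have [P [PS sP ex]] := orth_span xSb.
have term i : 1 <=v P`_i * b ^+ i by apply: lev_trans hx1 _; rewrite ex orth1.
pose Q := a%:P - \poly_(i < n) (P`_i ^+ p).
have QS : Q \is a polyOver S.
  rewrite rpredB ?polyOverC //; apply/polyOverP => i; rewrite coef_poly.
  by case: ifP => _; rewrite ?rpred0 ?rpredX // (polyOverP PS).
have sQ : (size Q <= n)%N.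
  apply: leq_trans (size_polyD _ _) _; rewrite size_polyN geq_max size_poly andbT.
  by apply: leq_trans (size_polyC_leq1 _) n0.
have eQ : Q.[b ^+ p] = a - \sum_(i < n) (P`_i * b ^+ i) ^+ p.
  rewrite hornerD hornerN hornerC horner_poly; congr (_ - _); apply: eq_bigr => i _.
  by rewrite exprMn exprAC.
have Q0 : Q`_0 * b ^+ (p * 0) = a - P`_0 ^+ p.
  by rewrite muln0 expr0 mulr1 coefB coefC coef_poly n0.
exists P`_0; first exact: (polyOverP PS).
rewrite -Q0; apply: rI_le (orth2 QS sQ 0) _; rewrite eQ.
have -> : a - \sum_(i < n) (P`_i * b ^+ i) ^+ p = (a - x ^+ p) +
   (x ^+ p - \sum_(i < n) (P`_i * b ^+ i) ^+ p) by ring.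
apply: rID => //; apply: rIp; rewrite ex (horner_coef_wide _ sP).
exact: (lev_powsum_sum pp n term).
Qed.

(** Expand x along the powers of b^p. A term t = s b^(p i) outside the ideal has 0 <= v t < v p, so
    v(t^m), a value of S, is divisible by p, and then so is v s, say v s = p v z. If a is a root of
    the unit s / z^p, then z a b^i is a root of t. *)
Lemma orth_pth_up : (forall a, a \in S -> 1 <=v a -> pth O p c S a) -> pdiv O p S ->
  forall x, x \in Sb -> 1 <=v x -> pth O p c Sb x.
Proof.
move=> hS pd x xSb hx; have p0 := prime_gt0 pp.
have [P [PS sP ex]] := orth_span_frob xSb.
have term i : 1 <=v P`_i * b ^+ (p * i) by apply: lev_trans hx _; rewrite ex orth2.
rewrite ex horner_coef; apply: pth_sum => // i; first by rewrite -exprM.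
rewrite -exprM; set t := _ * _.
have [It|nIt] := boolP (rI O p c t).
  by exists 0; rewrite ?rpred0 // expr0n gtn_eqF // subr0.
have t0 : t != 0 by apply: contraNneq nIt => ->; exact: rI0.
have tp : t <v p%:R by move: nIt; rewrite /rI negb_or => /andP[].
set s := P`_i in t t0 nIt tp *; have sS : s \in S by exact: (polyOverP PS).
have s_0 : s != 0 by apply: contraNneq t0 => e; rewrite /t e mul0r.
have ht : 1 <=v t by exact: term.
have s00 : s0 != 0 by rewrite -(eqv0 hs0) expf_neq0.
have ew : s ^+ m * s0 ^+ (p * i) =v t ^+ m.
  rewrite /t exprMn; apply: eqvM; first exact: eqv_refl.
  by rewrite exprAC eqv_sym; exact: eqvX.
have [||||y yS hy] := pd (s ^+ m * s0 ^+ (p * i)).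
- by rewrite rpredM ?rpredX.
- by rewrite (eqv0 ew) expf_neq0.
- by rewrite (eqv_ler _ ew) lev1X.
- by exists m; rewrite (eqv_ltl _ ew) ltvX.
have [||z zS hz] := coprime_pdiv (O := O) (S := S) (x := s) (y := y / s0 ^+ i) m0 cpm sS s_0.
- by rewrite rpredM ?rpredV ?rpredX.
- rewrite expr_div_n -exprM mulnC -(eqvM2r _ _ _ (expf_neq0 (p * i) s00)).
  by rewrite divfK ?expf_neq0.
have z0 : z != 0 by move: (eqv0 hz); rewrite (negbTE s_0) expf_eq0 p0 => /esym/negbT.
have [||a aS ha] := hS (s / z ^+ p).
- by rewrite rpredM ?rpredV ?rpredX.
- by apply/eqv_le/eqv_divl; rewrite ?expf_neq0.
exists (z * a * b ^+ i).
  by rewrite !rpredM ?rpredX ?mem_adjoin //; apply: sub_adjoin.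
have -> : t - (z * a * b ^+ i) ^+ p = (s / z ^+ p - a ^+ p) * (z ^+ p * b ^+ (p * i)).
  rewrite /t !exprMn -exprM [(i * p)%N]mulnC; field.
  by rewrite expf_neq0.
apply: rIM ha; apply: lev_trans ht _; rewrite /t; apply: levM; last exact: lev_refl.
exact: eqv_le.
Qed.

End Orthogonal.

(** * Independence of values and of residues *)

Section ResiduePolynomials.
Variables (F : fieldType) (O : vring F) (S : sfield F).
Local Notation "x <=v y" := (lev O x y).
Local Notation "x <v y" := (ltv O x y).
Local Notation "x =v y" := (eqv O x y).

Lemma ex_minval (g : nat -> F) n : (0 < n)%N ->
  exists2 k, (k < n)%N & forall i, (i < n)%N -> g k <=v g i.
Proof.
case: n => // n _; elim: n => [|n [k hk h]].
  by exists 0%N => // -[|//] _; exact: lev_refl.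
have [h'|h'] := orP (lev_total O (g k) (g n.+1)).
  exists k; first exact: ltnW.
  by move=> i; rewrite ltnS leq_eqVlt => /predU1P[->|/h].
exists n.+1 => // i; rewrite ltnS leq_eqVlt => /predU1P[->|/h]; first exact: lev_refl.
exact: lev_trans.
Qed.

(** Nonzero terms in different cosets of the value group of S have different values, so the sum
    takes the least of them. *)
Lemma distinct_orth (g : nat -> F) n (s : nat -> F) :
  (forall i j a, (i < j < n)%N -> a \in S -> ~~ (g i * a =v g j)) ->
  (forall i, s i \in S) -> forall i, (i < n)%N -> \sum_(j < n) s j * g j <=v s i * g i.
Proof.
move=> hg sS i hi; have n0 : (0 < n)%N by case: (n) hi.
have [k hk hmin] := ex_minval (fun j => s j * g j) n0.
have [e|t0] := eqVneq (s k * g k) 0.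
  by move: (hmin _ hi); rewrite e lev0r => /eqP ->; exact: levr0.
have sep j : (j < n)%N -> j != k -> s k * g k <v s j * g j.
  move=> hj jk; rewrite ltvNge; apply/negP => h; have e : s j * g j =v s k * g k.
    by rewrite /eqv h hmin.
  have sj0 : s j != 0.
    by apply: contraNneq t0 => e0; rewrite -(eqv0 e) e0 mul0r.
  have sk0 : s k != 0 by apply: contraNneq t0 => ->; rewrite mul0r.
  case: (ltngtP j k) => [lt|lt|ejk]; last by rewrite ejk eqxx in jk.
    suff : g j * (s j / s k) =v g k.
      by apply/negP; apply: hg; [rewrite lt hk | rewrite rpredM ?rpredV].
    by rewrite -(eqvM2l _ _ _ sk0) mulrCA (mulrC (s k)) divfK // mulrC.
  suff : g k * (s k / s j) =v g j.
    by apply/negP; apply: hg; [rewrite lt hj | rewrite rpredM ?rpredV].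
  by rewrite -(eqvM2l _ _ _ sj0) mulrCA (mulrC (s j)) divfK // mulrC eqv_sym.
apply: lev_trans (hmin _ hi); rewrite (bigD1 (Ordinal hk)) //=.
apply: eqv_ge; apply: eqv_addr; apply: ltv_sum => // j jk; apply: sep => //.
Qed.

(** Dividing P by a coefficient of least value gives an integral polynomial with a unit coefficient,
    whose value at x is a unit by assumption. *)
Lemma unit_orth x n (P : {poly F}) : 1 =v x -> P \is a polyOver S -> (size P <= n)%N ->
  (forall Q, Q \is a polyOver (intp O S) -> (size Q <= n)%N ->
     (exists i, 1 =v Q`_i) -> 1 =v Q.[x]) ->
  forall i, P.[x] <=v P`_i.
Proof.
move=> hx PS sP h i; have [hi|hi] := ltnP i (size P); last first.
  by rewrite [P`_i]nth_default // levr0.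
have [k hk hmin] := ex_minval (fun j => P`_j) (leq_ltn_trans (leq0n i) hi).
have [e|k0] := eqVneq P`_k 0.
  by move: (hmin _ hi); rewrite e lev0r => /eqP ->; exact: levr0.
have := h ((P`_k)^-1 *: P).
have QA : (P`_k)^-1 *: P \is a polyOver (intp O S).
  apply/polyOverP => j; rewrite coefZ intpP rpredM ?rpredV ?(polyOverP PS) //=.
  have [hj|hj] := ltnP j (size P); last by rewrite [P`_j]nth_default // mulr0 levr0.
  by rewrite -(levM2l _ _ _ k0) mulr1 mulVKf // hmin.
have sQ : (size ((P`_k)^-1 *: P) <= n)%N by rewrite size_scale ?invr_eq0.
move=> /(_ QA sQ); rewrite hornerZ => hQ.
have /hQ e : exists i, 1 =v ((P`_k)^-1 *: P)`_i.
  by exists k; rewrite coefZ mulVf // eqv_refl.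
apply: lev_trans (hmin _ hi); apply: eqv_ge.
by move: e; rewrite -(eqvM2l _ _ _ k0) mulr1 mulVKf.
Qed.

(** Leading coefficients in M are dropped one at a time, changing the value at x only by elements of
    M, until a unit one can be scaled to 1. *)
Lemma residue_monic n (P : {poly F}) x : 1 <=v x -> P \is a polyOver (intp O S) ->
  (size P <= n)%N -> (exists i, 1 =v P`_i) -> 1 <v P.[x] ->
  exists g, [/\ g \is monic, g \is a polyOver (intp O S), (size g <= n)%N & 1 <v g.[x]].
Proof.
move=> hx; elim: n P => [|n IH] P PA sP [i hi] hP.
  by move: sP hi; rewrite leqn0 size_poly_eq0 => /eqP ->; rewrite coef0 => /eqv1_neq0; rewrite eqxx.
have /andP[PnS Pn1] : (P`_n \in S) && (1 <=v P`_n) by have := polyOverP PA n.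
have [u|nu] := boolP (1 =v P`_n).
  have un := eqv1_neq0 u; have sz : size P = n.+1.
    by apply/eqP; rewrite eqn_leq sP /= ltnNge; apply: contra un => /leq_sizeP/(_ n (leqnn n)) ->.
  exists ((P`_n)^-1 *: P); split.
  - by rewrite monicE lead_coefZ lead_coefE sz mulVf.
  - apply/polyOverP => j; rewrite coefZ intpP; have /andP[h1 h2] := polyOverP PA j.
    by rewrite rpredM ?rpredV // lev1M // eqv_le // eqv1V.
  - by rewrite size_scale ?invr_eq0 // sz.
  - by rewrite hornerZ ltvMl // eqv_le // eqv1V.
have hn : 1 <v P`_n by rewrite ltvNge; apply: contra nu => h; rewrite /eqv Pn1.
pose Q := \poly_(j < n) P`_j.
have eP : P = Q + P`_n *: 'X^n.
  apply/polyP => j; rewrite coefD coef_poly coefZ coefXn; case: (ltngtP j n) => hj.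
  - by rewrite mulr0 addr0.
  - by rewrite mulr0 addr0 nth_default // (leq_trans sP).
  - by rewrite hj mulr1 add0r.
have [||||g [gm gA sg hg]] := IH Q.
- apply/polyOverP => j; rewrite coef_poly; case: ifP => _; last exact: rpred0.
  exact: (polyOverP PA).
- exact: size_poly.
- exists i; rewrite coef_poly; case: ltnP => // h; case/negP: nu.
  move: h; rewrite leq_eqVlt => /predU1P[-> //|h].
  by move: hi; rewrite nth_default ?(leq_trans sP) // => /eqv1_neq0; rewrite eqxx.
- have -> : Q.[x] = P.[x] - P`_n * x ^+ n.
    have := congr1 (fun R : {poly F} => R.[x]) eP.
    by rewrite /= hornerD hornerZ hornerXn => ->; rewrite addrK.
  by apply: ltvB => //; apply: ltvMr => //; exact: lev1X.
by exists g; split=> //; exact: leqW.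
Qed.

Lemma lev_horner_sub (A : sring F) (P : {poly F}) x y : {in A, forall a, 1 <=v a} ->
  P \is a polyOver A -> 1 <=v x -> 1 <=v y -> x - y <=v P.[x] - P.[y].
Proof.
move=> hA PA hx hy; rewrite !horner_coef -sumrB; apply: lev_sum => i _.
by rewrite -mulrBr; apply: levMl; [exact/hA/(polyOverP PA) | exact: lev_subXX].
Qed.

(** Modulo p, (z - 1)^p is z^p - 1: in residue characteristic p the only root of unity of p-power
    order is 1. *)
Lemma ltv_unitp p k x : prime p -> 1 <v p%:R -> 1 <=v x ->
  1 <v x ^+ (p ^ k) - 1 -> 1 <v x - 1.
Proof.
move=> pp hp hx; elim: k => [|k IH]; first by rewrite expn0 expr1.
rewrite expnSr exprM => h; apply: IH; move: h; set z := x ^+ (p ^ k) => h.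
have hz : 1 <=v z by exact: lev1X.
rewrite -(ltvX_iff _ _ _ (prime_gt0 pp)) expr1n.
have := lev_powsum pp (levB hz (lev_refl O 1)) (lev_refl O 1).
rewrite subrK expr1n => h'.
have -> : (z - 1) ^+ p = (z ^+ p - 1) - (z ^+ p - ((z - 1) ^+ p + 1)) by ring.
by apply: ltvB => //; exact: ltv_le_trans h'.
Qed.

(** Otherwise 1 + u + ... + u^(n-1) vanishes, while its residue is that of n, a unit. *)
Lemma root_unity_residue p n (u : F) : prime p -> 1 <v p%:R -> (0 < n)%N -> coprime n p ->
  u ^+ n = 1 -> 1 <v u - 1 -> u = 1.
Proof.
move=> pp hp n0 cp un hu; apply/eqP; rewrite -subr_eq0.
have hn := coprime_eqv1 pp hp cp.
have := subrXX (u : F) 1 n; rewrite un expr1n subrr => /esym/eqP; rewrite mulf_eq0 => /orP[//|].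
have h1 : 1 <=v u by rewrite -(subrK 1 u) levD ?lev_refl // ltvW.
set s := \sum_(i < n) _; move/eqP => s0.
have : 1 <v n%:R - s.
  have -> : n%:R - s = \sum_(i < n) (1 - u ^+ (n.-1 - i) * 1 ^+ i).
    by rewrite sumrB sumr_const card_ord.
  apply: ltv_sum => [|i _]; first exact: oner_neq0.
  rewrite expr1n mulr1 -[X in X - _](expr1n _ (n.-1 - i)); apply: ltv_le_trans (lev_subXX _ _ _) => //.
    by rewrite -opprB ltvN.
  exact: lev_refl.
by rewrite s0 subr0 -(eqv_ltr _ hn) ltvv.
Qed.
End ResiduePolynomials.

(** * Good fields between K and K^r *)

Section Ramification.
Variables (K : fieldType) (L : closedFieldType) (iota : {rmorphism K -> L}).
Hypothesis algL : algebraic_over iota.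
Variable (O : vring L).
Local Notation "x <=v y" := (lev O x y).
Local Notation "x <v y" := (ltv O x y).
Local Notation "x =v y" := (eqv O x y).
Local Notation sepK := (separable_over iota).

Fact im_closed : divring_closed [pred x : L | `[< exists a, x = iota a >]].
Proof.
split=> [|_ _ /asboolP[a ->] /asboolP[b ->]|_ _ /asboolP[a ->] /asboolP[b ->]].
- by apply/asboolP; exists 1; rewrite rmorph1.
- by apply/asboolP; exists (a - b); rewrite rmorphB.
- by apply/asboolP; exists (a / b); rewrite fmorph_div.
Qed.
Definition imK := SField im_closed.
Lemma imP x : reflect (exists a, x = iota a) (x \in imK).
Proof. exact: asboolP. Qed.
Lemma imK_iota a : iota a \in imK. Proof. by apply/imP; exists a. Qed.

Fact ram_closed : divring_closed [pred x : L | `[< ram_field iota O x >]].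
Proof.
split=> [|x y /asboolP[sx fx] /asboolP[sy fy]|x y /asboolP[sx fx] /asboolP[sy fy]];
  apply/asboolP; split.
- by rewrite -(rmorph1 iota); exact: separable_overC.
- by move=> s _; rewrite rmorph1.
- exact: separable_overB.
- by move=> s hs; rewrite rmorphB fx ?fy.
- by apply: separable_overM => //; exact: separable_overV.
- by move=> s hs; rewrite fmorph_div fx ?fy.
Qed.
Definition ramS := SField ram_closed.
Lemma ramP x : ram_field iota O x <-> x \in ramS.
Proof. by split=> [h|/asboolP//]; apply/asboolP. Qed.
Lemma ram_sep x : x \in ramS -> sepK x. Proof. by case/ramP. Qed.
Lemma imK_ram x : x \in imK -> x \in ramS.
Proof.
case/imP => a ->; apply/ramP; split; first exact: separable_overC.
by move=> s [[_ h] _].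
Qed.

Variable p : nat.
Hypotheses (pp : prime p) (hp : 1 <v p%:R).

Definition vtors (S : sfield L) := forall x, x \in S -> x != 0 ->
  exists m, [/\ (0 < m)%N, coprime m p & exists2 a, a \in imK & a =v x ^+ m].

(** Values, descent and ascent are all compared directly with K, so that the properties compose
    along towers and pass to unions of chains. *)
Record good (S : sfield L) : Prop := Good {
  good_im : forall a, iota a \in S;
  good_ram : forall x, x \in S -> x \in ramS;
  good_vtors : vtors S;
  good_down : forall c a, c \in imK -> 1 <=v c -> a \in imK -> 1 <=v a ->
     pth O p c S a -> pth O p c imK a;
  good_up : pdiv O p imK -> root_cond O p imK ->
     forall c a, c \in imK -> c != 0 -> 1 <=v c -> a \in S -> 1 <=v a -> pth O p c S a }.

Lemma good_imK : good imK.
Proof.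
split=> //; [exact: imK_iota | exact: imK_ram | | ].
  move=> x xK x0; exists 1%N; rewrite coprime1n; split=> //; exists x => //.
  exact: eqv_refl.
by move=> _ h c a cK c0 _ aK ha; exact: h.
Qed.


Lemma sub_imK (S : sfield L) x : (forall a, iota a \in S) -> x \in imK -> x \in S.
Proof. by move=> h /imP[a ->]. Qed.

Lemma vtors_up (S : sfield L) x y m a : (forall a, iota a \in S) -> (0 < m)%N -> coprime m p ->
  x \in S -> x != 0 -> a =v x ^+ m -> y \in imK -> a =v y ^+ p ->
  exists2 z, z \in S & x =v z ^+ p.
Proof.
move=> KS m0 cp xS x0 ha yK hy; apply: (coprime_pdiv m0 cp xS x0 (sub_imK KS yK)).
by apply: eqv_trans hy; rewrite eqv_sym.
Qed.

Lemma vtors_down (S : sfield L) x y : vtors S -> x \in imK -> x != 0 -> y \in S ->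
  x =v y ^+ p -> exists2 z, z \in imK & x =v z ^+ p.
Proof.
move=> hS xK x0 yS h; have p0 := prime_gt0 pp.
have y0 : y != 0 by move: (eqv0 h); rewrite (negbTE x0) expf_eq0 p0 => /esym/negbT.
have [m [m0 cp [a aK ha]]] := hS y yS y0.
apply: (coprime_pdiv m0 cp xK x0 aK); apply: eqv_trans (eqvX m h) _.
by rewrite exprAC eqv_sym; exact: eqvX.
Qed.

Lemma pdiv_up (S : sfield L) : (forall a, iota a \in S) -> vtors S -> pdiv O p imK -> pdiv O p S.
Proof.
move=> KS hS hK x xS x0 hx [n hn]; have [m [m0 cp [a aK ha]]] := hS x xS x0.
have [|||y yK hy] := hK a aK.
- by rewrite (eqv0 ha) expf_neq0.
- by rewrite (eqv_ler _ ha) lev1X.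
- by exists (n * m)%N; rewrite (eqv_ltl _ ha) exprM ltvX.
exact: vtors_up KS m0 cp xS x0 ha yK hy.
Qed.

Lemma pdiv_down (S : sfield L) : (forall a, iota a \in S) -> vtors S -> pdiv O p S -> pdiv O p imK.
Proof.
move=> KS hS hd x xK x0 hx hn; have [y yS hy] := hd x (sub_imK KS xK) x0 hx hn.
exact: vtors_down hS xK x0 yS hy.
Qed.

Lemma vtors_trans (S S' : sfield L) m : vtors S -> (0 < m)%N -> coprime m p ->
  (forall x, x \in S' -> x != 0 -> exists2 a, a \in S & a =v x ^+ m) -> vtors S'.
Proof.
move=> hS m0 cp h x xS x0; have [a aS ha] := h x xS x0.
have a0 : a != 0 by rewrite (eqv0 ha) expf_neq0.
have [m' [m'0 cp' [a' a'K ha']]] := hS a aS a0.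
exists (m * m')%N; split; [by rewrite muln_gt0 m0 | by rewrite coprimeMl cp | ].
by exists a' => //; apply: eqv_trans ha' _; rewrite exprM; exact: eqvX.
Qed.

Lemma adjoin_ram (S : sfield L) b (algb : alg_over S b) x :
  (forall x, x \in S -> x \in ramS) -> b \in ramS -> x \in adjoin algb -> x \in ramS.
Proof.
move=> h bR /adjP[P PS ->]; apply: rpred_horner => //.
by apply/polyOverP => i; apply: h; exact: (polyOverP PS).
Qed.

Lemma good_henselian (S : sfield L) (hS : good S) b (KS := good_im hS) : b \in ramS -> 1 <v b ->
  (forall s, fixing S s -> s b = b \/ 1 =v s b) -> good (adjoin (algS algL KS b)).
Proof.
move=> bR hb hconj; have Ssep x : x \in S -> sepK x by move/(good_ram hS)/ram_sep.
have sb := ram_sep bR; split.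
- by move=> a; apply: sub_adjoin; exact: KS.
- by move=> x; apply: adjoin_ram => //; exact: good_ram.
- apply: (vtors_trans (good_vtors hS) (m := 1)); rewrite ?coprime1n // => x xS x0.
  by have [a aS ha] := henselian_value Ssep sb hb hconj xS x0; exists a.
- move=> c a cK c1 aK ha /(henselian_pth_down Ssep sb hb hconj pp hp c1 (sub_imK KS aK) ha).
  exact: good_down.
move=> pd rt c a cK c0 c1; apply: henselian_pth_up => // a' a'S.
exact: good_up.
Qed.

Lemma good_orth (S : sfield L) (hS : good S) b (KS := good_im hS) n m f s0 :
  b \in ramS -> (0 < n)%N -> b != 0 -> f \is monic -> f \is a polyOver S -> root f b ->
  size f = n.+1 ->
  (forall P, P \is a polyOver S -> (size P <= n)%N -> forall i, P.[b] <=v P`_i * b ^+ i) ->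
  (forall P, P \is a polyOver S -> (size P <= n)%N -> forall i, P.[b ^+ p] <=v P`_i * b ^+ (p * i)) ->
  (0 < m)%N -> coprime m p -> s0 \in S -> b ^+ m =v s0 -> good (adjoin (algS algL KS b)).
Proof.
move=> bR n0 b0 fm fS fb sf o1 o2 m0 cp s0S hs0; split.
- by move=> a; apply: sub_adjoin; exact: KS.
- by move=> x; apply: adjoin_ram => //; exact: good_ram.
- apply: (vtors_trans (good_vtors hS) m0 cp) => x xS x0.
  exact: (orth_value fm fS fb sf o1 s0S hs0 xS x0).
- move=> c a cK c1 aK ha.
  move/(orth_pth_down pp n0 fm fS fb sf o1 o2 c1 (sub_imK KS aK) ha).
  exact: good_down.
move=> pd rt c a cK c0 c1; apply: (orth_pth_up pp b0 fm fS fb sf o2 m0 cp s0S hs0 c1).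
  by move=> a' a'S; exact: good_up.
exact: pdiv_up (good_vtors hS) pd.
Qed.

(** Each property involves finitely many elements of the field at a time, which lie in one member of
    a chain, so Zorn's lemma applies. *)
Lemma good_maximal : exists2 T, good T & forall S, good S ->
  (forall x, x \in T -> x \in S) -> forall x, x \in S -> x \in T.
Proof.
pose P (X : set L) := exists2 S, good S & forall x, X x <-> x \in S.
have [||X [T gT XT] Xmax] := @Zorn_union L P (fun x => x \in imK).
- by exists imK => //; exact: good_imK.
- move=> C [X0 CX0] CP Ctot; pose U := [pred t : L | `[< exists2 X, C X & X t >]].
  have two x y : x \in U -> y \in U -> exists S, [/\ good S, {subset S <= U}, x \in S & y \in S].
    move=> /asboolP[X CX Xx] /asboolP[Y CY Yy].
    suff [Z [CZ Zx Zy]] : exists Z, [/\ C Z, Z x & Z y].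
      have [S gS ZS] := CP _ CZ; exists S; split=> //; try exact/ZS.
      by move=> z /ZS Zz; apply/asboolP; exists Z.
    have [XY|YX] := Ctot _ _ CX CY; [exists Y | exists X]; split=> //.
      exact: XY.
    exact: YX.
  have Ucl : divring_closed U.
    split=> [|x y xU yU|x y xU yU].
    + have [S gS XS] := CP _ CX0; apply/asboolP; exists X0 => //.
      by apply/XS; exact: rpred1.
    + by have [S [gS SU xS yS]] := two x y xU yU; apply: SU; exact: rpredB.
    + by have [S [gS SU xS yS]] := two x y xU yU; apply: SU; rewrite rpredM ?rpredV.
  pose SU := SField Ucl; exists SU; last by move=> x; split=> [h|/asboolP//]; apply/asboolP.
  have one x : x \in SU -> exists S, [/\ good S, {subset S <= SU} & x \in S].
    by move=> xU; have [S [gS SS xS _]] := two x x xU xU; exists S.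
  have pthS c x (S : sfield L) : {subset S <= SU} -> pth O p c S x -> pth O p c SU x.
    by move=> h [y yS hy]; exists y => //; exact: h.
  split.
  + move=> a; have [S gS XS] := CP _ CX0; apply/asboolP; exists X0 => //.
    by apply/XS; exact: good_im.
  + by move=> x /one[S [gS _ xS]]; exact: good_ram xS.
  + by move=> x /one[S [gS _ xS]]; exact: good_vtors xS.
  + move=> c a cK c1 aK ha [y /one[S [gS _ yS]] hy]; apply: (good_down gS) => //.
    by exists y.
  + move=> pd rt c a cK c0 c1 /one[S [gS SS aS]] ha; apply: (pthS _ _ S) => //.
    exact: good_up.
exists T => // S gS TS x xS; apply/XT; apply: (Xmax (fun x => x \in S)) => //.
  by move=> y /XT/TS.
by exists S.
Qed.

End Ramification.

(** * A maximal good field is the ramification field *)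

Section MaximalGood.
Variables (K : fieldType) (L : closedFieldType) (iota : {rmorphism K -> L}).
Hypothesis algL : algebraic_over iota.
Variable (O : vring L).
Local Notation "x <=v y" := (lev O x y).
Local Notation "x <v y" := (ltv O x y).
Local Notation "x =v y" := (eqv O x y).
Local Notation sepK := (separable_over iota).
Local Notation ramS := (ramS algL O).
Variable p : nat.
Hypotheses (pp : prime p) (hp : 1 <v p%:R).
Variable T : sfield L.
Hypothesis gT : good algL O p T.
Hypothesis Tmax : forall S, good algL O p S ->
  (forall x, x \in T -> x \in S) -> forall x, x \in S -> x \in T.
Let KT := good_im gT.
Let TR := good_ram gT.
Let p0 := prime_gt0 pp.

Lemma T_sep x : x \in T -> sepK x. Proof. by move/TR/ram_sep. Qed.

Lemma ram_group_fixing s : in_ram_group iota O s -> fixing T s.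
Proof.
by move=> hs; case: (hs) => [[bs _] _]; split=> // x /TR/ramP[_]; apply.
Qed.

Lemma ram_ltv s x : in_ram_group iota O s -> sepK x -> x != 0 -> x <v s x - x.
Proof. by move=> [_ h] sx x0; apply/vltP; exact: h. Qed.

(** A ramification automorphism moves b by an element of value above v b > 0, so cannot send it to a
    unit and must fix it. Thus b is in K^r, T(b) is good, and maximality applies. *)
Lemma T_henselian b : sepK b -> 1 <v b ->
  (forall s, fixing T s -> s b = b \/ 1 =v s b) -> b \in T.
Proof.
move=> sb hb hconj; have [->|b0] := eqVneq b 0; first exact: rpred0.
have bR : b \in ramS.
  apply/ramP; split=> // s hs; have [//|h] := hconj s (ram_group_fixing hs).
  have h1 : 1 =v s b - b by apply: (eqv_trans h); apply: eqv_addr; rewrite ltvN -(eqv_ltl _ h).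
  have := ltv_trans hb (ram_ltv hs sb b0).
  by rewrite -(eqv_ltr _ h1) ltvv.
have g := good_henselian pp hp gT bR hb hconj.
apply: (Tmax g); last exact: mem_adjoin.
by move=> x; exact: sub_adjoin.
Qed.


Lemma prod_le_lt (rs : seq L) mu r0 : 0 \notin rs -> (forall r, r \in rs -> r <=v mu) ->
  r0 \in rs -> r0 <v mu -> \prod_(r <- rs) r <v mu ^+ size rs.
Proof.
move=> rs0 h r0s hr0; rewrite (perm_big _ (perm_to_rem r0s)) big_cons.
have -> : size rs = (size (rem r0 rs)).+1.
  by rewrite size_rem // prednK //; case: (rs) r0s.
have : {subset rem r0 rs <= rs} by move=> r /mem_rem.
move: (rem r0 rs) => s hs; rewrite exprS; apply: ltv_leM => //.
  rewrite prodf_seq_neq0; apply/allP => r /hs hr; apply: contraNneq rs0 => <-.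
  exact: hr.
elim: s hs => [|r s IH] hs; first by rewrite big_nil lev_refl.
rewrite big_cons exprS; apply: levM; first by apply: h; apply: hs; rewrite mem_head.
by apply: IH => r' hr'; apply: hs; rewrite inE hr' orbT.
Qed.

Lemma lev_exp_prod (s : seq L) mu : (forall r, r \in s -> mu <=v r) ->
  mu ^+ size s <=v \prod_(r <- s) r.
Proof.
elim: s => [|r s IH] h; first by rewrite big_nil lev_refl.
rewrite big_cons exprS; apply: levM; first by apply: h; rewrite mem_head.
by apply: IH => r' hr'; apply: h; rewrite inE hr' orbT.
Qed.

Lemma ex_maxval (rs : seq L) : rs != [::] ->
  exists2 m, m \in rs & forall r, r \in rs -> r <=v m.
Proof.
elim: rs => // r rs IH _; have [->|ne] := eqVneq rs [::].
  by exists r; rewrite ?mem_head // => r'; rewrite inE => /eqP ->; exact: lev_refl.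
have [m mrs hm] := IH ne; have [h|h] := orP (lev_total O r m).
  by exists m; rewrite ?inE ?mrs ?orbT // => r'; rewrite inE => /predU1P[->|/hm].
exists r; first exact: mem_head.
move=> r'; rewrite inE => /predU1P[->|/hm]; first exact: lev_refl.
by move=> h'; exact: lev_trans h' h.
Qed.

(* The product y of the conjugates of maximal value strictly dominates its other
   conjugates, so 1 - y^-1 / tr (y^-1) is a Hensel element and y lies in T. *)
Lemma T_isometry x s : sepK x -> fixing T s -> s x =v x.
Proof.
move=> sx fs; have [->|x0] := eqVneq x 0; first by rewrite rmorph0 eqv_refl.
have [rs [urs hh xrs hrs]] := conj_seq algL KT sx.
have [hm hS rh hmin] := hh.
have rs0 : 0 \notin rs.
  by apply/negP => /hrs[t _ /eqP]; rewrite fmorph_eq0 (negbTE x0).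
have [|m0 m0rs hm0] := @ex_maxval rs; first by case: (rs) xrs.
pose top r := m0 <=v r.
set y := \prod_(r <- rs | top r) r.
have y0 : y != 0.
  rewrite prodf_seq_neq0; apply/allP => r rz; apply/implyP => _.
  by apply: contraNneq rs0 => <-.
have stab t : fixing T t -> {in rs, forall r, t r \in rs}.
  by move=> [_ tS] r; rewrite -!root_prod_XsubC; exact: root_fixing tS hS.
have sy : sepK y.
  apply: (sep_prod algL) => r /hrs[t ft <-].
  exact (sep_conj KT ft sx).
have ydom t : fixing T t -> t y = y \/ t y <v y.
  move=> ft; apply: topset_conj => //; first exact: stab.
  move=> r w _ _; rewrite /top -ltvNge; exact: ltv_le_trans.
have [a aT ha] := dominant_conj algL KT sy y0 ydom.
have eza : y^-1 =v a by have := eqv_addr ha; rewrite addrC subrK.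
have a0 : a != 0 by rewrite -(eqv0 eza) invr_eq0.
pose b := 1 - y^-1 / a.
have yT : y \in T.
  suff bT : b \in T.
    have eb : a * (1 - b) = y^-1 by rewrite /b subKr mulrC divfK.
    by rewrite -[y]invrK -eb rpredV rpredM // rpredB // rpred1.
  apply: T_henselian.
  - rewrite /b; apply: separable_overB => //; first by apply: T_sep; exact: rpred1.
    by apply: separable_overM => //; apply: separable_overV => //; exact: T_sep.
  - have -> : b = (a - y^-1) / a by rewrite /b mulrBl mulfV.
    by rewrite -(ltvM2r _ _ _ a0) mul1r divfK // -(eqv_ltl _ eza).
  move=> t ft; have [_ tT] := ft.
  have tb : t b = 1 - (t y)^-1 / a by rewrite rmorphB rmorph1 fmorph_div fmorphV (tT a aT).
  have [e|lt] := ydom t ft; first by left; rewrite tb e.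
  right; rewrite tb; apply: eqv_addr; rewrite ltvN -(ltvM2r _ _ _ a0) mul1r divfK //.
  by rewrite -(eqv_ltl _ eza) /ltv levV // fmorph_eq0.
(* Otherwise an automorphism over T sending m0 to r would lower the value of y, although y is in
   T. *)
have alltop r : r \in rs -> top r.
  move=> rr; apply: contraT => nr.
  have hm0' : is_minpoly T m0 (\prod_(r <- rs) ('X - r%:P)).
    split=> //; first by rewrite root_prod_XsubC.
    move=> P PT rP; apply: hmin => //; have /hrs[t [_ tT] et] := m0rs.
    by rewrite -(fmorph_root t) (polyOver_fixing tT PT) et.
  have [|t [bt tT tm]] := extend_aut (algS algL KT) hm0' (x' := r).
    by rewrite root_prod_XsubC.
  have ft : fixing T t by [].
  have ty : t y = y by exact: tT.
  suff : t y <v y by rewrite ty ltvv.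
  have -> : t y = \prod_(r <- map t (filter top rs)) r.
    by rewrite /y -big_filter rmorph_prod big_map.
  have -> : y = \prod_(r <- filter top rs) r by rewrite big_filter.
  apply: (@ltv_le_trans _ _ (m0 ^+ size (filter top rs))); last first.
    by apply: lev_exp_prod => r'; rewrite mem_filter => /andP[].
  rewrite -(size_map t); apply: (@prod_le_lt _ _ r).
  - apply: contra rs0 => /mapP[r' + e]; rewrite mem_filter e => /andP[_ hr'].
    exact: stab.
  - move=> w /mapP[r' + e]; rewrite mem_filter e => /andP[_ hr'].
    by apply: hm0; exact: stab.
  - by apply/mapP; exists m0; rewrite // mem_filter /top lev_refl.
  - by rewrite ltvNge.
have eqm r : r \in rs -> r =v m0 by move=> rr; rewrite /eqv hm0 //; exact: alltop.
by apply: eqv_trans (eqm _ (stab s fs _ xrs)) _; rewrite eqv_sym eqm.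
Qed.

Lemma T_in_ram b : sepK b -> b != 0 ->
  (forall s, fixing T s -> b <v s b - b -> s b = b) -> b \in ramS.
Proof.
move=> sb b0 h; apply/ramP; split=> // s hs.
by apply: h; [exact: ram_group_fixing | exact: ram_ltv].
Qed.

(** A ramification automorphism multiplies b by an n-th root of unity of residue 1, that is, by 1,
    so b is in K^r. The powers of b, and those of b^p as p is prime to n, lie in distinct cosets of
    the value group of T, so [good_orth] applies. *)
Lemma T_radical b n : (0 < n)%N -> coprime n p -> b != 0 -> b ^+ n \in T ->
  (forall i a, (0 < i < n)%N -> a \in T -> ~~ (b ^+ i =v a)) -> b \in T.
Proof.
move=> n0 cp b0 bnT hi; pose f := 'X^n - (b ^+ n)%:P.
have n1 := coprime_eqv1 pp hp cp.
have fT : f \is a polyOver T by rewrite rpredB ?rpredX ?polyOverX ?polyOverC.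
have rf : root f b by rewrite rootE hornerD hornerN hornerXn hornerC subrr.
have sf : size f = n.+1 by rewrite size_XnsubC.
have fm : f \is monic by rewrite monicXnsubC.
have sb : sepK b.
  apply: (separable_over_trans algL (P := f)) => //.
    by move=> i; apply: T_sep; exact: (polyOverP fT).
  rewrite derivB derivC subr0 derivXn hornerMn hornerXn -mulr_natr mulf_neq0 ?expf_neq0 //.
  exact: eqv1_neq0 n1.
have bR : b \in ramS.
  apply: T_in_ram => // s [_ sT] h.
  have u1 : s b / b = 1.
    apply: (@root_unity_residue _ O p n) => //.
      by rewrite expr_div_n -rmorphXn (sT _ bnT) mulfV ?expf_neq0.
    by rewrite -(ltvM2r _ _ _ b0) mul1r mulrBl mul1r divfK.
  by apply: (mulIf (invr_neq0 b0)); rewrite u1 mulfV.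
have orth k : (0 < k)%N -> coprime k n -> forall P, P \is a polyOver T -> (size P <= n)%N ->
    forall i, P.[b ^+ k] <=v P`_i * b ^+ (k * i).
  move=> k0 ckn P PT sP i; have [hin|hin] := ltnP i n; last first.
    by rewrite nth_default ?(leq_trans sP) // mul0r levr0.
  rewrite (horner_coef_wide _ sP) -[b ^+ (k * i)]/((fun i => b ^+ (k * i)) i).
  under eq_bigr do rewrite -exprM.
  apply: (distinct_orth (S := T) (g := fun i => b ^+ (k * i)) (s := fun i => P`_i)) => //; last first.
    by move=> j; exact: (polyOverP PT).
  move=> i1 j1 a /andP[lt jn] aT; apply/negP => e.
  have e1 : b ^+ (k * (j1 - i1)) =v a.
    have : b ^+ (k * i1) * a =v b ^+ (k * i1) * b ^+ (k * (j1 - i1)).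
      by rewrite -exprD -mulnDr subnKC // ltnW.
    by rewrite eqvM2l ?expf_neq0 // eqv_sym.
  (* As k is prime to n and 0 < j1 - i1 < n, the remainder of d modulo n is an exponent excluded by
     hypothesis. *)
  set d := (k * (j1 - i1))%N in e1.
  have r0 : (0 < d %% n)%N.
    rewrite lt0n; apply/negP => /eqP hd; have : (n %| d)%N by rewrite /dvdn hd.
    rewrite /d Gauss_dvdr; last by rewrite coprime_sym.
    rewrite gtnNdvd ?subn_gt0 //; exact: leq_ltn_trans (leq_subr _ _) jn.
  suff : b ^+ (d %% n) =v a / (b ^+ n) ^+ (d %/ n).
    apply/negP; apply: hi; first by rewrite r0 ltn_mod n0.
    by apply: rpredM => //; rewrite rpredV; exact: rpredX.
  rewrite -(eqvM2r _ _ _ (expf_neq0 (d %/ n) (expf_neq0 n b0))) divfK ?expf_neq0 //.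
  by rewrite -exprM -exprD addnC mulnC -divn_eq.
have g := good_orth pp gT bR n0 b0 fm fT rf sf _ _ n0 cp bnT (eqv_refl O _).
apply: (Tmax (g _ _)); last exact: mem_adjoin.
- by move=> P PT sP i; have := orth 1%N isT (coprime1n _) P PT sP i; rewrite expr1 mul1n.
- by apply: orth => //; rewrite coprime_sym.
- by move=> x; exact: sub_adjoin.
Qed.


Let A := intp O T.
Lemma A_int : {in A, forall a, 1 <=v a}. Proof. by move=> a /andP[]. Qed.

(** A ramification automorphism keeps the residue of b, and f has no other root with this residue
    since f'(b) is a unit; so b is in K^r. The independence of residues assumed for b and b^p gives
    the two orthogonal bases. *)
Lemma T_unramified b n f : 1 =v b -> (0 < n)%N -> f \is monic -> f \is a polyOver A ->
  size f = n.+1 -> root f b -> 1 =v f^`().[b] ->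
  (forall Q, Q \is a polyOver A -> (size Q <= n)%N -> (exists i, 1 =v Q`_i) -> 1 =v Q.[b]) ->
  (forall Q, Q \is a polyOver A -> (size Q <= n)%N -> (exists i, 1 =v Q`_i) ->
     1 =v Q.[b ^+ p]) -> b \in T.
Proof.
move=> b1 n0 fm fA sf rf f1 h1 h2.
have b0 := eqv1_neq0 b1; have fT := polyOver_intpS fA.
have sb : sepK b.
  apply: (separable_over_trans algL (P := f)) => //; last exact: eqv1_neq0 f1.
  by move=> i; apply: T_sep; exact: (polyOverP fT).
have bR : b \in ramS.
  apply: T_in_ram => // s [_ sT] h; apply/eqP; rewrite -subr_eq0; apply: contraT => ne.
  have sb1 : 1 <=v s b.
    rewrite -(subrK b (s b)); apply: levD; last exact: eqv_le.
    by apply: lev_trans (ltvW h); exact: eqv_le.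
  (* Here q is integral, q(b) = f'(b) is a unit and q(s b) = 0 as s b differs from b, against b and
     s b being congruent modulo M. *)
  have /factor_theorem[q eq] := rf.
  have XA : 'X - b%:P \is a polyOver (intO O) by rewrite polyOverXsubC; exact: eqv_le.
  have fO : f \is a polyOver (intO O) by apply: polyOverS fA => z /A_int.
  have [qO _] := polyOver_divmod (monicXsubC b) XA fO.
  rewrite {1}eq mulpK ?polyXsubC_eq0 // in qO.
  have qsb : q.[s b] = 0.
    have := root_fixing sT fT rf; rewrite eq rootE hornerM hornerXsubC mulf_eq0 (negbTE ne).
    by rewrite orbF => /eqP.
  have qb : q.[b] = f^`().[b].
    by rewrite eq derivM derivXsubC hornerD !hornerM hornerXsubC subrr mulr0 add0r hornerC mulr1.
  have := lev_horner_sub (O := O) (A := intO O) _ qO sb1 (eqv_le b1).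
  rewrite qsb sub0r levN qb => /(_ (fun _ => id)) h3.
  have : 1 <v f^`().[b] by apply: ltv_le_trans h3; rewrite (eqv_ltl _ b1).
  by rewrite -(eqv_ltr _ f1) ltvv.
have o1 P : P \is a polyOver T -> (size P <= n)%N -> forall i, P.[b] <=v P`_i * b ^+ i.
  move=> PT sP i; apply: lev_trans (unit_orth b1 PT sP h1 i) _.
  by rewrite -{1}[P`_i]mulr1 levM ?lev_refl // eqv_le // eqv1X.
have o2 P : P \is a polyOver T -> (size P <= n)%N -> forall i, P.[b ^+ p] <=v P`_i * b ^+ (p * i).
  move=> PT sP i; apply: lev_trans (unit_orth (eqv1X p b1) PT sP h2 i) _.
  by rewrite -{1}[P`_i]mulr1 levM ?lev_refl // eqv_le // eqv1X.
have g := good_orth pp gT bR n0 b0 fm fT rf sf o1 o2 (ltn0Sn 0) (coprime1n p) (rpred1 T).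
apply: (Tmax (g _)); last exact: mem_adjoin.
- by rewrite expr1 eqv_sym.
- by move=> x; exact: sub_adjoin.
Qed.

(** The residue of x has degree less than n over the residue field of T, expressed by a lifted monic
    polynomial. *)
Definition resroot n x := exists g : {poly L},
  [/\ g \is monic, g \is a polyOver A, (size g <= n)%N & 1 <v g.[x]].

Lemma resroot_ex x : 1 <=v x -> exists n, resroot n x.
Proof.
move=> hx; have [P [P0 PT] rP] := algS algL KT x.
have sP : (0 < size P)%N by rewrite size_poly_gt0.
have [k hk hmin] := ex_minval O (fun i => P`_i) sP.
have k0 : P`_k != 0.
  apply: contraNneq P0 => e; rewrite -lead_coef_eq0 lead_coefE.
  by have := hmin (size P).-1; rewrite e prednK // leqnn lev0r; apply.
exists (size P); apply: (@residue_monic _ O T (size P) ((P`_k)^-1 *: P)) => //.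
- apply/polyOverP => j; rewrite coefZ intpP rpredM ?rpredV ?(polyOverP PT) //=.
  have [hj|hj] := ltnP j (size P); last by rewrite [P`_j]nth_default // mulr0 levr0.
  by rewrite -(levM2l _ _ _ k0) mulr1 mulVKf // hmin.
- by rewrite size_scale ?invr_eq0.
- by exists k; rewrite coefZ mulVf // eqv_refl.
- by rewrite hornerZ (rootP rP) mulr0 ltvr0 oner_neq0.
Qed.

Lemma resroot_unit n x Q : ~ resroot n x -> 1 <=v x -> Q \is a polyOver A -> (size Q <= n)%N ->
  (exists i, 1 =v Q`_i) -> 1 =v Q.[x].
Proof.
move=> nr hx QA sQ hQ; rewrite /eqv (lev1_horner QA hx) /= levNgt; apply/negP => h.
by apply: nr; exact: residue_monic hQ h.
Qed.

(** The residue field of L is purely inseparable over that of T. Let f be monic of least size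
    vanishing at the residue of x. If the residue of x^p has smaller degree, induction applies to
    x^p; otherwise f has a simple residue root, and a root b of f congruent to x lies in T by
    [T_unramified]. *)
Lemma T_residue n x : 1 =v x -> resroot n x ->
  exists k t, t \in T /\ 1 <v x ^+ (p ^ k) - t.
Proof.
elim/ltn_ind: n x => n IH x x1 rx; have hx := eqv_le x1.
have exn : exists n, `[< resroot n x >] by exists n; apply/asboolP.
case: (ex_minnP exn) => N /asboolP[f [fm fA sf fx]] Nmin.
have {exn} Nmin' m : (m < N)%N -> ~ resroot m x.
  by move=> mN rm; have := Nmin m (asboolT rm); rewrite leqNgt mN.
have Nn : (N <= n)%N by apply: Nmin; apply/asboolP.
have {}sf : size f = N.
  apply/eqP; rewrite eqn_leq sf leqNgt; apply/negP => h; apply: (Nmin' _ h).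
  by exists f; split.
have N1 : (1 < N)%N.
  rewrite ltnNge; apply/negP => h; have := fm; rewrite monicE lead_coefE sf.
  move: fx; rewrite (size1_polyC (p := f)) ?sf // hornerC coefC.
  case: N h {Nmin Nmin' Nn sf} => [|[|//]] _ /=; first by move=> hf /eqP e; rewrite e ltvv in hf.
  by move=> hf /eqP e; rewrite e ltvv in hf.
have [rp|nrp] := lem (resroot N.-1 (x ^+ p)).
  have lt : (N.-1 < n)%N by rewrite prednK // ltnW.
  have [k [t [tT ht]]] := IH N.-1 lt (x ^+ p) (eqv1X p x1) rp.
  by exists k.+1, t; split=> //; rewrite expnS exprM.
pose m := N.-1; have Nm : N = m.+1 by rewrite prednK // ltnW.
have m0 : (0 < m)%N by rewrite -ltnS -Nm.
have nrx : ~ resroot m x by apply: Nmin'; rewrite Nm.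
have dA : f^`() \is a polyOver A by exact: polyOver_deriv.
(* Otherwise minimality puts all coefficients of f' in M, so f is congruent to some g(X^p), and g
   gives the residue of x^p a smaller degree. *)
have f1 : 1 =v f^`().[x].
  rewrite /eqv (lev1_horner dA hx) /= levNgt; apply/negP => hd.
  have cM i : 1 <v (f^`())`_i.
    have h1 : 1 <=v (f^`())`_i by exact/A_int/(polyOverP dA).
    rewrite ltvNge; apply/negP => h2.
    have : 1 =v f^`().[x].
      apply: (resroot_unit nrx hx dA); last by exists i; rewrite /eqv h1 h2.
      by rewrite -ltnS -Nm -sf lt_size_deriv // monic_neq0.
    by rewrite /eqv => /andP[_]; rewrite levNgt hd.
  have fM i : ~~ (p %| i)%N -> 1 <v f`_i.
    case: i => [|i] pi; first by rewrite dvdn0 in pi.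
    have := cM i; rewrite coef_deriv -mulr_natr.
    have u : 1 =v i.+1%:R by apply: (coprime_eqv1 pp hp); rewrite coprime_sym prime_coprime.
    by rewrite -(eqv_ltr _ (eqvM (eqv_refl O f`_i.+1) u)) mulr1.
  have pm : (p %| m)%N.
    apply: contraT => /fM; have := monicP fm; rewrite lead_coefE sf -/m => ->.
    by rewrite ltvv.
  have [d ed] := dvdnP pm.
  pose g := \poly_(i < d.+1) f`_(i * p).
  have gd : g`_d = 1 by rewrite coef_poly ltnSn -ed -(monicP fm) lead_coefE sf.
  have sg : size g = d.+1.
    apply/eqP; rewrite eqn_leq size_poly ltnNge; apply/negP => /leq_sizeP/(_ d (leqnn d)) e.
    by move: gd; rewrite e => /esym/eqP; rewrite oner_eq0.
  have dm : (d < m)%N.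
    rewrite ed ltn_Pmulr ?prime_gt1 //; apply: contraTltn m0; rewrite ed.
    by rewrite leqn0 => /eqP ->.
  apply: nrp; exists g; split.
  - by rewrite monicE lead_coefE sg gd.
  - apply/polyOverP => i; rewrite coef_poly; case: ifP => _; last exact: rpred0.
    exact: (polyOverP fA).
  - by rewrite sg.
  pose R := f - (g \Po 'X^p).
  have RM i : 1 <v R`_i.
    rewrite coefB coef_comp_poly_Xn //; case: ifP => [/dvdnP[k ek]|/negbT/fM]; last by rewrite subr0.
    suff -> : f`_i - g`_(i %/ p) = 0 by rewrite ltvr0 oner_neq0.
    rewrite ek mulnK // coef_poly; case: ltnP => hk; first by rewrite subrr.
    rewrite nth_default ?subrr // sf Nm ed; apply: leq_trans (leq_mul hk (leqnn p)).
    by rewrite mulSn -addn1 addnC leq_add2r.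
  have -> : g.[x ^+ p] = f.[x] - R.[x].
    by rewrite /R hornerD hornerN horner_comp hornerXn opprB addrC subrK.
  apply: ltvB => //; rewrite horner_coef; apply: ltv_sum => [|i _]; first exact: oner_neq0.
  by apply: ltvMr; [exact: lev1X | exact: RM].
have [rs ers] := closed_field_poly_normal f; rewrite (monicP fm) scale1r in ers.
have [b brs hb] : exists2 b, b \in rs & 1 <v x - b.
  apply: contrapT => hn; have : f.[x] <=v 1.
    rewrite ers horner_prod big_seq; elim/big_ind: _ => [|u v hu hv|r rrs].
    - exact: lev_refl.
    - by rewrite -[X in _ <=v X]mulr1 levM.
    rewrite hornerXsubC levNgt; apply/negP => hr; apply: hn; by exists r.
  by rewrite levNgt fx.
have rf : root f b by rewrite ers root_prod_XsubC.
have b1 : 1 =v b.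
  apply: (eqv_trans x1); rewrite -[b](subKr x); apply: eqv_addr.
  by rewrite ltvN -(eqv_ltl _ x1).
have hb1 := eqv_le b1.
have close (Q : {poly L}) y z : Q \is a polyOver A -> 1 <=v y -> 1 <=v z -> 1 <v y - z ->
    1 =v Q.[y] -> 1 =v Q.[z].
  move=> QA hy hz h hQ; apply: (eqv_trans hQ); rewrite -[Q.[z]](subKr Q.[y]).
  apply: eqv_addr; rewrite ltvN -(eqv_ltl _ hQ).
  by apply: ltv_le_trans h _; exact: lev_horner_sub A_int QA hy hz.
exists 0%N, b; rewrite expn0 expr1; split=> //.
apply: (T_unramified b1 m0 fm fA) => //; first by rewrite sf Nm.
- exact: close f1.
- by move=> Q QA sQ hQ; apply: (close _ x) => //; exact: resroot_unit nrx hx QA sQ hQ.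
move=> Q QA sQ hQ; apply: (close _ (x ^+ p)) => //; try exact: lev1X.
- by apply: ltv_le_trans hb _; exact: lev_subXX.
by apply: (resroot_unit nrp) => //; exact: lev1X.
Qed.

(** Some j v x is a value of T. Removing the p-part of j leaves y = x^(p^k), whose value has order m
    prime to p modulo the values of T. An m-th root of an element of T with the value of y^m has the
    value of y, and lies in T by [T_radical]. *)
Lemma T_value x : x != 0 -> exists k t, t \in T /\ x ^+ (p ^ k) =v t.
Proof.
move=> x0.
(* If the powers of x had values in distinct cosets, they would be linearly independent over T. *)
have [j [j0 [a aT ha]]] : exists j, (0 < j)%N /\ exists2 a, a \in T & x ^+ j =v a.
  apply: contrapT => hn; have [P [P0 PT] rP] := algS algL KT x.
  case/eqP: P0; apply/polyP => i; rewrite coef0.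
  have [hi|hi] := ltnP i (size P); last by rewrite nth_default.
  have := @distinct_orth _ O T (fun i => x ^+ i) (size P) (fun i => P`_i) _ _ i hi.
  rewrite -horner_coef (rootP rP) lev0r mulf_eq0 expf_eq0 (negbTE x0) andbF orbF.
  move=> h; apply/eqP/h; last by move=> j; exact: (polyOverP PT).
  move=> i1 j1 a /andP[lt _] aT; apply/negP => e; apply: hn; exists (j1 - i1)%N.
  rewrite subn_gt0 lt; split=> //; exists a => //.
  rewrite -(eqvM2l _ _ _ (expf_neq0 i1 x0)) -exprD subnKC ?(ltnW lt) //.
  by rewrite eqv_sym.
have [k [j' [ej cp]]] : exists k j', j = (p ^ k * j')%N /\ coprime j' p.
  exists (logn p j), (j %/ p ^ logn p j)%N; split.
    by rewrite mulnC divnK // pfactor_dvdnn.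
  by have [l cl {1}->] := pfactor_coprime pp j0; rewrite mulnK ?expn_gt0 ?p0 // coprime_sym.
have j'0 : (0 < j')%N by move: j0; rewrite ej muln_gt0 => /andP[].
pose y := x ^+ (p ^ k); have y0 : y != 0 by rewrite expf_neq0.
pose Q m := (0 < m)%N && `[< exists2 a, a \in T & y ^+ m =v a >].
have exQ : exists m, Q m.
  by exists j'; rewrite /Q j'0; apply/asboolP; exists a => //; rewrite -exprM -ej.
case: (ex_minnP exQ) => m /andP[m0 /asboolP[am amT ham]] mmin.
have am0 : am != 0 by rewrite -(eqv0 ham) expf_neq0.
have mj : (m %| j')%N.
  rewrite /dvdn -leqn0 leqNgt; apply/negP => r0.
  have : Q (j' %% m)%N.
    rewrite /Q r0; apply/asboolP; exists (a / am ^+ (j' %/ m)).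
      by rewrite rpredM ?rpredV ?rpredX.
    have -> : y ^+ (j' %% m) = y ^+ j' / (y ^+ m) ^+ (j' %/ m).
      by rewrite {2}(divn_eq j' m) exprD mulnC exprM mulrC mulKf ?expf_neq0.
    by apply: eqvM; [rewrite -exprM -ej | apply/eqvV/eqvX].
  by move/mmin; rewrite leqNgt ltn_mod m0.
have cpm : coprime m p by apply: coprime_dvdl mj cp.
have [b rb] : exists b, root ('X^m - am%:P) b.
  by apply/closed_rootP; rewrite size_XnsubC // eqSS -lt0n.
have ebm : b ^+ m = am.
  by apply/eqP; rewrite -subr_eq0; move: rb; rewrite rootE hornerD hornerN hornerXn hornerC.
have yb : y =v b by rewrite -(eqvX_iff _ _ _ m0) ebm.
exists k, b; split=> //; apply: (T_radical m0 cpm) => //.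
- by rewrite -(eqv0 yb).
- by rewrite ebm.
move=> i a' /andP[i0 im] a'T; apply/negP => e.
have : Q i.
  rewrite /Q i0; apply/asboolP; exists a' => //; exact: eqv_trans (eqvX i yb) e.
by move/mmin; rewrite leqNgt im.
Qed.

(** Some p-power of b is an element of T times a unit w, and some p-power of w is congruent modulo M
    to an element of T. As s is an isometry over T, it preserves this congruence; hence a p-power of
    s b / b has residue 1, and then so does s b / b. *)
Lemma T_fixing_ram s : fixing T s -> in_ram_group iota O s.
Proof.
move=> fs; have [bs sT] := fs; split; first by split=> // a; exact/sT/KT.
move=> b sb b0; apply/vltP.
have [k [t [tT ht]]] := T_value b0.
have t0 : t != 0 by rewrite -(eqv0 ht) expf_neq0.
have bk0 : b ^+ (p ^ k) != 0 by rewrite expf_neq0.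
pose w := b ^+ (p ^ k) / t.
have w1 : 1 =v w by exact: eqv_divl.
have sX x n : sepK x -> sepK (x ^+ n).
  move=> sx; elim: n => [|n IH]; first by rewrite expr0; apply: T_sep; exact: rpred1.
  by rewrite exprS; exact: separable_overM.
have sw : sepK w by apply: separable_overM; [|exact: sX|apply: separable_overV => //; exact: T_sep].
have [n rw] := resroot_ex (eqv_le w1).
have [k' [t' [t'T ht']]] := T_residue w1 rw.
have se : sepK (w ^+ (p ^ k') - t') by apply: separable_overB => //; [exact: sX | exact: T_sep].
have := T_isometry se fs; rewrite rmorphB rmorphXn (sT _ t'T) => he.
have sb0 : s b != 0 by rewrite fmorph_eq0.
have u1 : 1 =v s b / b by apply: eqv_divl => //; exact: T_isometry.
pose q := (p ^ k')%N.
have hq : 1 <v s w ^+ q - w ^+ q.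
  have -> : s w ^+ q - w ^+ q = (s w ^+ q - t') - (w ^+ q - t') by ring.
  by apply: ltvB => //; rewrite (eqv_ltr _ he).
suff : 1 <v s b / b - 1 by rewrite -(ltvM2r _ _ _ b0) mul1r mulrBl mul1r divfK.
apply: (@ltv_unitp _ O p (k + k')) => //; first exact: eqv_le.
have wq1 := eqv1X q w1; have wq0 := eqv1_neq0 wq1.
have -> : (s b / b) ^+ (p ^ (k + k')) - 1 = (s w ^+ q - w ^+ q) / w ^+ q.
  rewrite mulrBl mulfV // -expr_div_n expnD exprM; congr (_ ^+ _ - _).
  rewrite /w fmorph_div rmorphXn (sT _ tT) expr_div_n.
  by field; rewrite t0 bk0.
by apply: ltvMr => //; exact/eqv_le/eqv1V.
Qed.

Lemma ram_sub_T x : x \in ramS -> x \in T.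
Proof.
move=> /ramP[sx fx]; apply: (fixed_in algL KT sx) => s /T_fixing_ram.
exact: fx.
Qed.

End MaximalGood.

(** * (DRvp), (DRst) and divisibility by p *)

Section Conditions.
Variables (F : fieldType) (O : vring F) (p : nat).
Hypotheses (pp : prime p) (hp : ltv O 1 p%:R).
Local Notation "x <=v y" := (lev O x y).
Local Notation "x <v y" := (ltv O x y).
Local Notation "x =v y" := (eqv O x y).
Let p0 := prime_gt0 pp.

Definition vp_cond (S : {pred F}) :=
  p%:R = 0 :> F \/ exists2 x, x \in S & (1 <v x) && (x <v p%:R).
Definition st_cond (S : {pred F}) :=
  forall x, x \in S -> x != 0 -> exists2 y, y \in S & x =v y ^+ p.

Lemma st_pdiv S : st_cond S -> pdiv O p S.
Proof. by move=> h x xS x0 _ _; exact: h. Qed.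

(** With c = x, the difference x - y^p lies in p O + x M, so has value above v x. *)
Lemma root_small (S : sfield F) x : root_cond O p S -> x \in S -> x != 0 -> 1 <=v x ->
  x <v p%:R -> exists2 y, y \in S & x =v y ^+ p.
Proof.
move=> rt xS x0 hx xp; have [y yS hy] := rt x x xS x0 xS hx; exists y => //.
by apply: eqv_sub; case/orP: hy => [|//]; exact: ltv_le_trans.
Qed.

(** Values in [0, v p) are divisible by [root_small]. For p nonzero, an x0 with 0 < v x0 < v p
    splits v p as v x0 + v(p / x0), so v p is divisible too, and subtracting it repeatedly handles v
    x < n v p. *)
Lemma root_vp_pdiv (S : sfield F) : root_cond O p S -> vp_cond S -> pdiv O p S.
Proof.
move=> rt [e|[x0 x0S /andP[h1 h2]]] x xS xn0 hx [n hn].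
  by apply: root_small => //; rewrite e ltvr0.
have [pF0|pF0] := eqVneq (p%:R : F) 0.
  by apply: root_small => //; rewrite pF0 ltvr0.
have x00 := ltv_neq0 h2.
have [|y0 y0S hy0] := root_small rt x0S x00 _ h2; first exact: ltvW.
have [||||y1 y1S hy1] := @root_small S (p%:R / x0) rt.
- by rewrite rpredM ?rpredV ?rpred_nat.
- by rewrite mulf_neq0 ?invr_eq0.
- by rewrite -(levM2r _ _ _ x00) mul1r divfK // ltvW.
- by rewrite -(ltvM2r _ _ _ x00) divfK // -{1}[p%:R]mulr1 ltvM2l.
have hpy : p%:R =v (y0 * y1) ^+ p.
  by rewrite exprMn -[p%:R](divfK x00) mulrC; exact: eqvM.
elim: n x xS xn0 hx hn => [|n IH] x xS xn0 hx hn.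
  by move: hn; rewrite expr0 ltvNge hx.
have [lt|le] := boolP (x <v p%:R); first exact: root_small.
rewrite -levNgt in le.
have [||||y yS hy] := IH (x / p%:R).
- by rewrite rpredM ?rpredV ?rpred_nat.
- by rewrite mulf_neq0 ?invr_eq0.
- by rewrite -(levM2r _ _ _ pF0) mul1r divfK.
- by rewrite -(ltvM2r _ _ _ pF0) divfK // -exprSr.
exists (y * (y0 * y1)); first by rewrite !rpredM.
by rewrite exprMn -[x](divfK pF0); exact: eqvM.
Qed.

(** If p v y = v p, then v y lies strictly between 0 and v p. *)
Lemma pdiv_vp (S : sfield F) : pdiv O p S -> vp_cond S.
Proof.
move=> pd; have [e|n0] := eqVneq (p%:R : F) 0; [by left | right].
have [||||y yS hy] := pd p%:R.
- exact: rpred_nat.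
- exact: n0.
- exact: ltvW.
- by exists 2; rewrite expr2 -{1}[p%:R]mulr1 ltvM2l.
have h1 : 1 <v y by rewrite -(ltvX_iff _ _ _ p0) expr1n -(eqv_ltr _ hy).
have y0 : y != 0 by move: (eqv0 hy); rewrite (negbTE n0) expf_eq0 p0 => /esym/negbT.
exists y => //; rewrite h1 (eqv_ltr _ hy) -(prednK p0) exprS -{1}[y]mulr1 ltvM2l //.
by rewrite -(expr1n _ p.-1) ltvX // -ltnS prednK // prime_gt1.
Qed.
End Conditions.

(** * Transfer between K and K^r *)

Section Transfer.
Variables (K : fieldType) (L : closedFieldType) (iota : {rmorphism K -> L}).
Hypothesis algL : algebraic_over iota.
Variable (O : vring L).
Local Notation "x <=v y" := (lev O x y).
Local Notation "x <v y" := (ltv O x y).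
Local Notation "x =v y" := (eqv O x y).
Local Notation ramS := (ramS algL O).
Local Notation imK := (imK iota).
Variable p : nat.
Hypotheses (pp : prime p) (hp : 1 <v p%:R).

Lemma good_ramS : good algL O p ramS.
Proof.
have [T gT Tmax] := good_maximal algL O p.
have e : T =i ramS.
  move=> x; apply/idP/idP; first exact: good_ram gT x.
  exact: ram_sub_T pp hp T gT Tmax x.
have pe c a : pth O p c T a <-> pth O p c ramS a.
  by split=> -[y yS hy]; exists y => //; move: yS; rewrite e.
split=> //.
- by move=> a; rewrite -e; exact: good_im gT a.
- by move=> x; rewrite -e; exact: good_vtors gT x.
- by move=> c a cK c1 aK ha /pe; exact: good_down gT c a cK c1 aK ha.
by move=> pd rt c a cK c0 c1; rewrite -e => aT ha; apply/pe; exact: good_up gT pd rt c a cK c0 c1 aT ha.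
Qed.

Lemma root_down : root_cond O p ramS -> root_cond O p imK.
Proof.
move=> rt c a cK c0 aK ha; have KR x : x \in imK -> x \in ramS by exact: imK_ram.
have [c1 [c1K c10 h1 hc]] : exists c1, [/\ c1 \in imK, c1 != 0, 1 <=v c1 & c <=v c1].
  have [h|h] := orP (lev_total O 1 c); first by exists c; rewrite lev_refl.
  by exists 1; rewrite lev_refl oner_neq0 rpred1.
have := rt c1 a (KR _ c1K) c10 (KR _ aK) ha.
move/(good_down good_ramS c1K h1 aK ha) => [b bK hb]; exists b => //.
exact: rI_lec hc hb.
Qed.

(** Ascent in good fields concerns bounds c in K. A bound of nonnegative value in K^r is replaced by
    an element of K with the value of some c^m, m > 0, which is at least v c. *)
Lemma root_up : pdiv O p imK -> root_cond O p imK -> root_cond O p ramS.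
Proof.
move=> pd rt c a cR c0 aR ha.
have [c1 [c1K c10 h1 hc]] : exists c1, [/\ c1 \in imK, c1 != 0, 1 <=v c1 & c <=v c1].
  have [h|h] := orP (lev_total O c 1).
    by exists 1; rewrite lev_refl oner_neq0 rpred1.
  have [m [m0 _ [c1 c1K hc1]]] := good_vtors good_ramS cR c0; exists c1.
  rewrite (eqv0 hc1) expf_neq0 // !(eqv_ler _ hc1) lev1X //; split=> //.
  by rewrite -(prednK m0) exprS levMr ?lev_refl // lev1X.
have [b bR hb] := good_up good_ramS pd rt c1K c10 h1 aR ha.
by exists b => //; exact: rI_lec hc hb.
Qed.

Lemma pdiv_ram : pdiv O p ramS <-> pdiv O p imK.
Proof.
have g := good_ramS.
by split; [exact: pdiv_down (good_im g) (good_vtors g) | exact: pdiv_up (good_im g) (good_vtors g)].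
Qed.

Lemma st_ram : st_cond O p ramS <-> st_cond O p imK.
Proof.
have g := good_ramS; split=> h x xS x0.
  have [y yS hy] := h x (imK_ram algL O xS) x0.
  exact: vtors_down (good_vtors g) xS x0 yS hy.
have [m [m0 cp [a aK ha]]] := good_vtors g xS x0.
have [|y yK hy] := h a aK; first by rewrite (eqv0 ha) expf_neq0.
exact: vtors_up (good_im g) m0 cp xS x0 ha yK hy.
Qed.

(** (DRvp) is traded for [pdiv], which passes both ways; going up, [pdiv] for K is also what makes
    the roots ascend. *)
Lemma gdr_ram : (root_cond O p ramS /\ vp_cond O p ramS) <->
  (root_cond O p imK /\ vp_cond O p imK).
Proof.
split=> -[rt vp].
  have rtK := root_down rt; split=> //; apply: pdiv_vp => //; apply/pdiv_ram.
  exact: root_vp_pdiv.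
have pd := root_vp_pdiv rt vp; split; first exact: root_up.
by apply: pdiv_vp => //; apply/pdiv_ram.
Qed.

Lemma semitame_ram : (root_cond O p ramS /\ st_cond O p ramS) <->
  (root_cond O p imK /\ st_cond O p imK).
Proof.
split=> -[rt st]; first by split; [exact: root_down | exact/st_ram].
by split; [apply: root_up => //; exact: st_pdiv | exact/st_ram].
Qed.

End Transfer.

(** * The conditions of the theorem, one residue characteristic at a time *)

Section Statement.
Variables (F : fieldType) (O : vring F) (S : sfield F) (SP : F -> Prop).
Hypothesis SPE : forall x, SP x <-> x \in S.

Lemma DRvp_cond : DRvp O SP <-> forall p, residue_char O p -> vp_cond O p S.
Proof.
split=> h p hp; have [e|[x hx]] := h p hp; try by left.
  by case: hx => /SPE xS [/vltP h1 /vltP h2]; right; exists x => //; rewrite h1.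
by move=> /andP[/vltP h1 /vltP h2]; right; exists x; split=> //; exact/SPE.
Qed.

Lemma DRst_cond : DRst O SP <-> forall p, residue_char O p -> st_cond O p S.
Proof.
have E x y p : x != 0 -> (0 < p)%N -> eqv O x (y ^+ p) ->
    [/\ y != 0, O (x / y ^+ p) & O (y ^+ p / x)].
  move=> x0 p0 h; have y0 : y != 0.
    by move: (eqv0 h); rewrite (negbTE x0) expf_eq0 p0 => /esym/negbT.
  split=> //; apply/lev1.
    by apply: eqv_le; apply: eqv_divl; rewrite ?expf_neq0.
  by apply: eqv_le; apply: eqv_divl => //; rewrite eqv_sym.
split=> h p hp x; have p0 : (0 < p)%N by case: hp => /prime_gt0.
  move=> /SPE xS x0; have [y [/SPE yS y0 h1 h2]] := h p hp x xS x0; exists y => //.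
  have yp0 := expf_neq0 p y0; apply/andP; split; apply/levP.
    by exists (y ^+ p / x) => //; rewrite mulrC divfK.
  by exists (x / y ^+ p) => //; rewrite mulrC divfK.
move=> /SPE xS x0; have [y yS /E[//|//|y0 h1 h2]] := h p hp x xS x0.
by exists y; split=> //; exact/SPE.
Qed.

Lemma gdr_cond : gdr_in O SP <->
  forall p, residue_char O p -> root_cond O p S /\ vp_cond O p S.
Proof.
rewrite /gdr_in (DRvr_root O SPE) DRvp_cond; split=> [[h1 h2] p hp|h].
  by split; [exact: h1 | exact: h2].
by split=> p /h[].
Qed.

Lemma semitame_cond : semitame_in O SP <->
  forall p, residue_char O p -> root_cond O p S /\ st_cond O p S.
Proof.
rewrite /semitame_in (DRvr_root O SPE) DRst_cond; split=> [[h1 h2] p hp|h].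
  by split; [exact: h1 | exact: h2].
by split=> p /h[].
Qed.

End Statement.

Fact full_closed (F : fieldType) : divring_closed (predT : {pred F}).
Proof. by []. Qed.
Definition fullS (F : fieldType) : sfield F := SField (@full_closed F).

(** * Replacing K by its image in L *)

Section Image.
Variables (K L : fieldType) (iota : {rmorphism K -> L}) (OK : vring K) (O : vring L).
Hypothesis hext : forall a, O (iota a) <-> OK a.
Variable S : sfield L.
Hypothesis SE : forall x, x \in S <-> exists a, x = iota a.

Lemma lev_iota a b : lev O (iota a) (iota b) = lev OK a b.
Proof.
apply/asboolP/asboolP => -[].
- by move/eqP; rewrite fmorph_eq0 => /eqP ->; left.
- rewrite -fmorph_div => -[/eqP]; rewrite fmorph_eq0 => /eqP a0 /hext h.
  by right.
- by move=> ->; left; rewrite rmorph0.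
move=> [/eqP a0 h]; right; split; first by apply/eqP; rewrite fmorph_eq0.
by rewrite -fmorph_div; apply/hext.
Qed.
Lemma ltv_iota a b : ltv O (iota a) (iota b) = ltv OK a b.
Proof. by rewrite /ltv lev_iota. Qed.

Lemma residue_char_iota p : residue_char O p <-> residue_char OK p.
Proof.
by rewrite /residue_char !vltP -ltv_iota rmorph1 rmorph_nat.
Qed.

Lemma rI_iota p c x : rI O p (iota c) (iota x) = rI OK p c x.
Proof. by rewrite /rI -(rmorph_nat iota) lev_iota ltv_iota. Qed.

Let inS a : iota a \in S. Proof. by apply/SE; exists a. Qed.

Lemma root_iota p : root_cond O p S <-> root_cond OK p (fullS K).
Proof.
split=> h c a.
  move=> _ c0 _ ha; have [||b /SE[b' ->] hb] := h (iota c) (iota a) (inS c) _ (inS a).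
  - by rewrite fmorph_eq0.
  - by rewrite -(rmorph1 iota) lev_iota.
  by exists b' => //; rewrite -rI_iota rmorphB rmorphXn.
move=> /SE[c' ->] + /SE[a' ->]; rewrite fmorph_eq0 -(rmorph1 iota) lev_iota => c0 ha.
have [b _ hb] := h c' a' isT c0 isT ha.
by exists (iota b) => //; rewrite -rmorphXn -rmorphB rI_iota.
Qed.

Lemma vp_iota p : vp_cond O p S <-> vp_cond OK p (fullS K).
Proof.
split=> -[e|[x xS hx]].
- by left; apply/eqP; rewrite -(fmorph_eq0 iota) rmorph_nat e.
- move: xS hx => /SE[a ->]; rewrite -(rmorph_nat iota) -(rmorph1 iota) !ltv_iota.
  by right; exists a.
- by left; rewrite -(rmorph_nat iota) e rmorph0.
by right; exists (iota x) => //; rewrite -(rmorph_nat iota) -(rmorph1 iota) !ltv_iota.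
Qed.

Lemma st_iota p : st_cond O p S <-> st_cond OK p (fullS K).
Proof.
have E a b : eqv O (iota a) (iota b ^+ p) = eqv OK a (b ^+ p).
  by rewrite /eqv -rmorphXn !lev_iota.
split=> h x.
  move=> _ x0; have [|y /SE[b ->]] := h (iota x) (inS x); first by rewrite fmorph_eq0.
  by rewrite E; exists b.
move=> /SE[a ->]; rewrite fmorph_eq0 => a0; have [b _ hb] := h a isT a0.
by exists (iota b) => //; rewrite E.
Qed.

End Image.

Theorem theorem1p5 (K : fieldType) (OK : K -> Prop) (hOK : valuation_ring OK)
  (L : closedFieldType) (iota : {rmorphism K -> L})
  (halg : algebraic_over iota)
  (OL : L -> Prop) (hOL : valuation_ring OL)
  (hext : forall a : K, OL (iota a) <-> OK a) :
  (gdr_in OL (ram_field iota OL) <-> gdr_in OK (fun _ => True)) /\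
  (semitame_in OL (ram_field iota OL) <-> semitame_in OK (fun _ => True)).
Proof.
pose O := VRing hOL; pose O' := VRing hOK.
have SPE x : ram_field iota O x <-> x \in ramS halg O by exact: ramP.
have SPE' x : True <-> x \in fullS K by [].
have hext' : forall a, O (iota a) <-> O' a := hext.
have SE x : x \in imK iota <-> exists a, x = iota a by split=> /imP.
have rc p : residue_char O p <-> residue_char O' p := residue_char_iota hext' p.
rewrite (gdr_cond O SPE) (gdr_cond O' SPE') (semitame_cond O SPE) (semitame_cond O' SPE').
have eg p : residue_char O p -> (root_cond O p (ramS halg O) /\ vp_cond O p (ramS halg O)) <->
    (root_cond O' p (fullS K) /\ vp_cond O' p (fullS K)).
  move=> [pp /vltP hp]; rewrite gdr_ram //.
  by rewrite (root_iota hext' SE) (vp_iota hext' SE).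
have es p : residue_char O p -> (root_cond O p (ramS halg O) /\ st_cond O p (ramS halg O)) <->
    (root_cond O' p (fullS K) /\ st_cond O' p (fullS K)).
  move=> [pp /vltP hp]; rewrite semitame_ram //.
  by rewrite (root_iota hext' SE) (st_iota hext' SE).
by split; split=> h p hp; [apply/eg/h | apply/eg/h | apply/es/h | apply/es/h] => //; apply/rc.
Qed.
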